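(* Let $N\ge1$, $\mathcal A\in\mathcal P_b(N+1)$ and $\lambda\ge1$. Then the problem $\inf_{\mathcal B\in\mathcal P_b(N+1)}F(\mathcal B,\mathcal A;\lambda)$ has a solution. Moreover, every minimizer $\mathcal A(\lambda)=(A_1(\lambda),\dots,A_{N+1}(\lambda))$ satisfies $\bigcup_{i=1}^NA_i(\lambda)\subseteq\mathrm{hull}(\mathcal A)$.
   Context: An $(N+1)$-partition of $\mathbb R^n$ is $(A_1,\dots,A_{N+1})$, sets of locally finite perimeter with $\sum_i|A_i\cap Q|=|Q|$ for compact $Q$, each identified with its density-one points (so the measure-theoretic boundary equals the topological one); $\mathcal P_b(N+1)$: those with $A_1,\dots,A_N$ bounded. $\mathrm{hull}(\mathcal A)$: closed convex hull of $\bigcup_{j\le N}A_j$. $F(\mathcal B,\mathcal A;\lambda)=\frac12\sum_{j=1}^{N+1}P(B_j)+\frac\lambda2\sum_{j=1}^{N+1}\bar\sigma(B_j,A_j)$, where $\bar\sigma(E,G)=\int_{E\Delta G}d(x,\partial G)dx$ (equal to $0$ if $|E\Delta G|=0$ and $+\infty$ if $\partial G=\emptyset$ and $|E\Delta G|>0$). *)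

(* Defs.v *)
From HB Require Import structures.
From mathcomp Require Import all_boot all_order all_algebra.
From mathcomp Require Import all_classical all_reals all_analysis.
Set Implicit Arguments. Unset Strict Implicit. Unset Printing Implicit Defensive.
Import Order.TTheory GRing.Theory Num.Theory.
Import numFieldNormedType.Exports.
Local Open Scope classical_set_scope.
Local Open Scope ring_scope.

Section Defs.
Variables (R : realType) (n : nat).

Local Notation Rn := (matrix R 1 n).

(* Euclidean norm and distance (the library norm on 'rV is the sup norm,
   which induces the same topology but not the same metric). *)
Definition enorm (x : Rn) : R := Num.sqrt (\sum_(i < n) x ord0 i ^+ 2).
Definition edist (x y : Rn) : R := enorm (x - y).
Definition eball (x : Rn) (r : R) : set Rn := [set y | edist x y < r].

Local Notation BorelRn := (g_sigma_algebraType (@open Rn)).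

(* mu is Lebesgue measure on the Borel sets: its value on every half-open box
   is the product of the side lengths (this determines it uniquely). *)
Definition is_lebesgue (mu : {measure set BorelRn -> \bar R}) : Prop :=
  forall a b : Rn, (forall i, a ord0 i <= b ord0 i) ->
    mu [set x : BorelRn | forall i, a ord0 i < x ord0 i <= b ord0 i]
    = (\prod_(i < n) (b ord0 i - a ord0 i))%:E.

Variable mu : {measure set BorelRn -> \bar R}.

Definition tboundary (A : set Rn) : set Rn := closure A `\` interior A.

Definition evec (j : 'I_n) : Rn := delta_mx ord0 j.

Definition comp (phi : Rn -> Rn) (i : 'I_n) : Rn -> R := fun x => phi x ord0 i.

Definition C1c_field (phi : Rn -> Rn) : Prop :=
  (forall i j x, derivable (comp phi i) x (evec j)) /\
  (forall i j, continuous (fun x => derive (comp phi i) x (evec j))) /\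
  (exists K : set Rn, compact K /\ forall x, ~ K x -> phi x = 0).

Definition div (phi : Rn -> Rn) (x : Rn) : R :=
  \sum_(i < n) derive (comp phi i) x (evec i).

Definition perimeter_in (U E : set Rn) : \bar R :=
  ereal_sup [set (\int[mu]_(x in (E : set BorelRn)) (div phi x)%:E)%E
            | phi in [set phi | C1c_field phi /\
                 (forall x, enorm (phi x) <= 1) /\
                 (forall x, ~ U x -> phi x = 0)]].

Definition perimeter (E : set Rn) : \bar R := perimeter_in setT E.

Definition loc_finite_perimeter (E : set Rn) : Prop :=
  measurable (E : set BorelRn) /\
  forall r : R, 0 < r -> (perimeter_in (eball 0 r) E < +oo)%E.

Definition density_one (E : set Rn) (x : Rn) : Prop :=
  (fun r : R => fine (mu (E `&` eball x r)) / fine (mu (eball x r)))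
    @ 0^'+ --> (1 : R).

Definition bounded_set (E : set Rn) : Prop :=
  exists M : R, forall x, E x -> enorm x <= M.

(* (N+1)-partitions, indexed by 'I_N.+1; the last index ord_max is the
   (possibly unbounded) (N+1)-th set. *)
Definition partition (N : nat) (A : 'I_N.+1 -> set Rn) : Prop :=
  (forall i, loc_finite_perimeter (A i)) /\
  (forall Q : set Rn, compact Q ->
     (\sum_(i < N.+1) mu (A i `&` Q) = mu Q)%E) /\
  (forall i, A i = density_one (A i)).

Definition partition_b (N : nat) (A : 'I_N.+1 -> set Rn) : Prop :=
  partition A /\ forall i : 'I_N.+1, i != ord_max -> bounded_set (A i).

Definition convex_set (C : set Rn) : Prop :=
  forall x y t, C x -> C y -> 0 <= t <= 1 -> C (t *: x + (1 - t) *: y).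

Definition hull (N : nat) (A : 'I_N.+1 -> set Rn) : set Rn :=
  \bigcap_(C in [set C | closed C /\ convex_set C /\
      (forall i : 'I_N.+1, i != ord_max -> A i `<=` C)]) C.

(* distance to a set, +oo for the empty set *)
Definition dist_to (S : set Rn) (x : Rn) : \bar R :=
  ereal_inf [set (edist x y)%:E | y in S].

Definition sigma_bar (E G : set Rn) : \bar R :=
  (\int[mu]_(x in (setY E G : set BorelRn)) dist_to (tboundary G) x)%E.

Definition Fenergy (N : nat) (B A : 'I_N.+1 -> set Rn) (lambda : R) : \bar R :=
  ((2^-1)%:E * (\sum_(j < N.+1) perimeter (B j))
   + (lambda / 2)%:E * (\sum_(j < N.+1) sigma_bar (B j) (A j)))%E.

End Defs.

(* Main.v *)
(** Minimizers come from the direct method.  A minimizing sequence can be confined to a fixed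
    cube: intersecting the bounded chambers with a half-space containing the bounded chambers
    of the datum increases neither the perimeters nor the distance terms.  Sets of bounded
    perimeter in a cube are totally bounded in measure, because the translation estimate
    |E \ (E - h)| <= |h| P(E) makes E nearly constant on most cells of a fine grid; a fast
    Cauchy subsequence then has indicators that are eventually constant almost everywhere, and
    the energy is lower semicontinuous along it.  The Lebesgue density theorem turns the limit
    into a family of density-one sets.  For the hull property, a point of a bounded chamber
    outside the hull is separated by a half-space, and the same cut strictly decreases the
    distance term, since the distance to the boundary is positive beyond the half-space. *)
Require Import Defs.
From HB Require Import structures.
From mathcomp Require Import all_boot all_order all_algebra.
From mathcomp Require Import all_classical all_reals all_analysis.
From mathcomp Require Import measurable_realfun lra ring.
Import Order.TTheory GRing.Theory Num.Theory.
Import numFieldNormedType.Exports.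
Local Open Scope classical_set_scope.
Local Open Scope ring_scope.
Set Implicit Arguments. Unset Strict Implicit. Unset Printing Implicit Defensive.

(** * Borel sets of R^n *)

(** Everything about perimeter is drawn from the supremum over test fields: no reduced boundary or
    Gauss-Green formula appears, and each perimeter inequality modifies a test field or passes to
    the limit for a fixed one. Lebesgue measure is given only by its values on half-open boxes, so
    translation invariance comes from the uniqueness of measures agreeing on boxes. Two features of
    the definitions shape the rest. Chambers must equal their density-one sets exactly, a condition
    destroyed by cuts and limits; the argument therefore handles families having exactly one member
    at almost every point, and normalises them only at the end. The last chamber may be unbounded;
    its perimeter is read off from the union of the other chambers, which is its complement up to a
    null set. Measure estimates use cubes and balls of the sup norm; the comparison with Euclidean
    balls costs factors depending on [n] only. *)

Section Borel.
Context {R : realType} {n : nat}.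
Local Notation V := 'rV[R]_n.
Local Notation T := (g_sigma_algebraType (@open V)).

Lemma coord_le_norm (x : V) i : `|x ord0 i| <= `|x|.
Proof.
rewrite [leRHS]/Num.norm /= mx_normrE.
by apply/bigmax_geP; right => /=; exists (ord0, i).
Qed.

Lemma norm_leP (x : V) e : 0 <= e -> reflect (forall i, `|x ord0 i| <= e) (`|x| <= e).
Proof.
move=> e0; apply: (iffP idP) => [xe i|xe]; first exact: le_trans (coord_le_norm x i) xe.
rewrite [leLHS]/Num.norm /= mx_normrE; apply/bigmax_leP; split => // -[i j] _ /=.
by rewrite (ord1 i).
Qed.

Lemma norm_ltP (x : V) e : 0 < e -> reflect (forall i, `|x ord0 i| < e) (`|x| < e).
Proof.
move=> e0; apply: (iffP idP) => [xe i|xe]; first exact: le_lt_trans (coord_le_norm x i) xe.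
rewrite [ltLHS]/Num.norm /= mx_normrE; apply/bigmax_ltP; split => // -[i j] _ /=.
by rewrite (ord1 i).
Qed.

(** Two kinds of boxes are needed: closed ones are compact, half-open ones are stable under
    intersection and are the sets on which [is_lebesgue] prescribes the measure. *)
Definition cbox (a b : V) : set V := [set x | forall i, a ord0 i <= x ord0 i <= b ord0 i].
Definition hbox (a b : V) : set V := [set x | forall i, a ord0 i < x ord0 i <= b ord0 i].

Lemma cbox_compact a b : compact (cbox a b).
Proof.
have := @rV_compact R n (fun i => `[a ord0 i, b ord0 i]%classic)
  (fun i => @segment_compact _ _ _).
by congr compact; apply/seteqP; split => x /= xab i; have := xab i; rewrite /= in_itv.
Qed.

(** Boxes with rational corners are countable; those inside U are enumerated by [unpickle], and
    every other index yields the empty set. Besides generating the Borel sets, this exhausts an open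
    set by compact sets, which serves as inner regularity in [weak_type]. *)
Lemma open_bigcup_cbox (U : set V) : open U -> exists F : nat -> set V,
  U = \bigcup_k F k /\ forall k, F k = set0 \/ exists a b, F k = cbox a b.
Proof.
move=> oU.
pose bx (q : {ffun 'I_n -> rat * rat}) : set V :=
  cbox (\row_i ratr (q i).1) (\row_i ratr (q i).2).
pose F k := if unpickle k is Some q then [set x | bx q `<=` U /\ bx q x] else set0.
exists F; split; last first.
  move=> k; rewrite /F; case: unpickle => [q|]; last by left.
  have [qU|qU] := pselect (bx q `<=` U).
    right; exists (\row_i ratr (q i).1), (\row_i ratr (q i).2).
    by apply/seteqP; split => [x []//|x ?]; split.
  by left; apply/seteqP; split => // x [].
apply/seteqP; split => [x Ux|x [k _]]; last first.
  by rewrite /F; case: unpickle => // q [] /[apply].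
have /nbhs_ballP[e /= e0 xeU] : nbhs x U by apply: open_nbhs_nbhs.
have qx i : exists q : rat * rat, x ord0 i - e < ratr q.1 < x ord0 i /\
    x ord0 i < ratr q.2 < x ord0 i + e.
  have [|q1] := @rat_in_itvoo _ (x ord0 i - e) (x ord0 i).
    by rewrite ltrBlDr ltrDl.
  have [|q2] := @rat_in_itvoo _ (x ord0 i) (x ord0 i + e); first by rewrite ltrDl.
  by rewrite !in_itv /= => h2 h1; exists (q1, q2).
have [q qP] := choice qx.
exists (pickle (finfun q)) => //; rewrite /F pickleK; split; last first.
  by move=> i; rewrite !mxE ffunE; have [/andP[_ /ltW ->] /andP[/ltW ->]] := qP i.
move=> y yq; apply: xeU; rewrite -ball_normE /ball_/=; apply/norm_ltP => // i.
have := yq i; rewrite !mxE ffunE; have [] := qP i.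
move=> /andP[h1 h2] /andP[h3 h4] /andP[h5 h6].
by rewrite ltr_norml; apply/andP; split; lra.
Qed.

Lemma open_measurableV (U : set V) : open U -> @measurable _ T U.
Proof. by move=> oU; apply: sub_sigma_algebra. Qed.

Lemma closed_measurableV (U : set V) : closed U -> @measurable _ T U.
Proof.
by move=> /closed_openC/open_measurableV/measurableC; rewrite setCK.
Qed.

Lemma continuous_measurableV (f : V -> R) : continuous f ->
  measurable_fun setT (f : T -> R).
Proof.
move=> cf; apply: (measurability _ (RGenOpens.measurableE R)).
move=> _ [_ [a [b ->] <-]]; rewrite setTI; apply: open_measurableV.
by apply: open_comp => // x _; exact: cf.
Qed.

(* Half-spaces generate: every open set is a countable union of closed rational boxes. *)
Lemma borel_ind (D : set (set V)) : sigma_algebra setT D ->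
  (forall i a, D [set x : V | a < x ord0 i]) ->
  forall F, @measurable _ T F -> D F.
Proof.
move=> sD Dh F mF; apply: mF => /=; split => // U oU.
have [D0 DC DU] := sD.
have {}DC A : D A -> D (~` A) by move=> /DC; rewrite setTD.
have DI (A : nat -> set V) : (forall k, D (A k)) -> D (\bigcap_k A k).
  by move=> DA; rewrite -[X in D X]setCK setC_bigcap; apply/DC/DU => k; apply/DC.
have DI2 A B : D A -> D B -> D (A `&` B).
  move=> DA DB; have -> : A `&` B = \bigcap_k (if k is 0%N then A else B).
    apply/seteqP; split => [x [Ax Bx] [|k]//|x h]; split; [exact: (h 0%N)|exact: (h 1%N)].
  by apply: DI => -[].
have [G [-> GP]] := open_bigcup_cbox oU; apply: DU => k.
have [->//|[a [b ->]]] := GP k.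
(* Only strict lower bounds are available from [Dh]: the upper face is the complement of one, and
   the closed lower face is the countable intersection of the bounds [a - 1/(k+1)]. *)
have -> : cbox a b = \big[setI/setT]_(i <- index_enum 'I_n)
   (~` [set x : V | b ord0 i < x ord0 i] `&` \bigcap_k [set x : V | a ord0 i - k.+1%:R^-1 < x ord0 i]).
  rewrite -bigcap_seq; apply/seteqP; split => [x xab i _|x h i].
    have /andP[h1 h2] := xab i; split => /=; first by apply/negP; rewrite -leNgt.
    by move=> m _ /=; rewrite ltrBlDr (le_lt_trans h1)// ltrDl invr_gt0.
  have /= [/negP] := h i (mem_index_enum _); rewrite -leNgt => -> h2; rewrite andbT.
  apply/ler_addgt0Pr => e e0.
  have := h2 (Num.truncn e^-1) I => /=; rewrite ltrBlDr => /ltW/le_trans; apply.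
  rewrite lerD2l -[leRHS]invrK lef_pV2 ?posrE ?invr_gt0//.
  by apply/ltW/Num.Theory.truncnS_gt.
elim/big_rec: _ => [|i A _ DA]; first by rewrite -setC0; exact: DC.
apply: (DI2 _ _) => //; apply: (DI2 _ _); first exact/DC/Dh.
by apply: DI => m; exact: Dh.
Qed.

Lemma half_measurable i (a : R) : @measurable _ T [set x : V | a < x ord0 i].
Proof.
apply: open_measurableV; rewrite -/((fun x : V => x ord0 i) @^-1` [set y | a < y]).
by apply: open_comp => [x _|]; [exact: coord_continuous|exact: open_gt].
Qed.

(** Meant for addition and subtraction on [T * T], whose measurability is required for the product
    sigma-algebra, so that continuity does not give it directly. *)
Lemma measurable_fun_coord d (X : measurableType d) (f : X -> V) :
  (forall i, measurable_fun setT (fun x => f x ord0 i)) ->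
  measurable_fun setT (f : X -> T).
Proof.
move=> mf _ F mF; rewrite setTI; move: F mF.
apply: (@borel_ind [set F | measurable (f @^-1` F)]); first split => /=.
- by rewrite preimage_set0.
- by move=> A mA; rewrite setTD preimage_setC; exact: measurableC.
- by move=> A mA; rewrite preimage_bigcup; exact: bigcup_measurable.
- move=> i a /=; have -> : f @^-1` [set x : V | a < x ord0 i] =
     setT `&` (fun x => f x ord0 i) @^-1` `]a, +oo[.
    by rewrite setTI; apply/seteqP; split => x; rewrite /= in_itv/= andbT.
  by apply: mf => //; exact: measurable_itv.
Qed.

Lemma hbox_measurable a b : @measurable _ T (hbox a b).
Proof.
have -> : hbox a b = \big[setI/setT]_(i <- index_enum 'I_n)
   (~` [set x : V | b ord0 i < x ord0 i] `&` [set x : V | a ord0 i < x ord0 i]).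
  rewrite -bigcap_seq; apply/seteqP; split => [x xab i _|x h i].
    by have /andP[h1 h2] := xab i; split => //=; apply/negP; rewrite -leNgt.
  by have /= [/negP] := h i (mem_index_enum _); rewrite -leNgt => -> ->.
elim/big_rec: _ => [|i A _ DA]; first exact: measurableT.
apply: measurableI => //; apply: measurableI; last exact: half_measurable.
by apply: measurableC; exact: half_measurable.
Qed.

(** A box whose corners are in the wrong order is empty, so the identity needs no case
    distinction. *)
Lemma hboxI a b c d : hbox a b `&` hbox c d =
  hbox (\row_i Num.max (a ord0 i) (c ord0 i)) (\row_i Num.min (b ord0 i) (d ord0 i)).
Proof.
apply/seteqP; split => [x [h1 h2] i|x h]; last split => i.
- by rewrite !mxE gt_max le_min; case/andP: (h1 i) => -> ->; case/andP: (h2 i) => -> ->.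
- by have := h i; rewrite !mxE gt_max le_min => /andP[/andP[-> _] /andP[-> _]].
- by have := h i; rewrite !mxE gt_max le_min => /andP[/andP[_ ->] /andP[_ ->]].
Qed.

Definition cube (r : R) : set V := hbox (const_mx (- r)) (const_mx r).

Lemma cube_norm (x : V) r : 0 < r -> `|x| < r -> cube r x.
Proof.
move=> r0 /norm_ltP => /(_ r0) h i; rewrite !mxE.
by move: (h i); rewrite ltr_norml => /andP[-> /ltW ->].
Qed.

Lemma norm_cube (x : V) r : 0 < r -> cube r x -> `|x| <= r.
Proof.
move=> r0 h; apply/norm_leP; first exact: ltW.
move=> i; have := h i; rewrite !mxE => /andP[/ltW h1 h2].
by rewrite ler_norml h1 h2.
Qed.

Lemma bigcup_cube : \bigcup_k cube k.+1%:R = setT.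
Proof.
apply/seteqP; split => // x _; exists (Num.truncn `|x|) => //; apply: cube_norm => //.
exact: Num.Theory.truncnS_gt.
Qed.

(** Half-open boxes form an intersection-stable generating class, exhausted by cubes of finite
    measure, so the pi-lambda uniqueness theorem applies. *)
Lemma borel_measure_unique (m1 m2 : {measure set T -> \bar R}) :
  (forall a b : V, (forall i, a ord0 i <= b ord0 i) -> m1 (hbox a b) = m2 (hbox a b)) ->
  (forall a b : V, (forall i, a ord0 i <= b ord0 i) -> (m1 (hbox a b) < +oo)%E) ->
  forall F, measurable F -> m1 F = m2 F.
Proof.
move=> m12 fin; pose G := [set F | exists a b, F = hbox a b].
apply: (measure_unique (G : set (set T)) (fun k => cube k.+1%:R)).
- apply/seteqP; split; last first.
    by apply: smallest_sub => [|_ [a [b ->]]];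
      [exact: sigma_algebra_measurable|exact: hbox_measurable].
  apply: borel_ind; first exact: smallest_sigma_algebra.
  (* A half-space is the union of growing boxes that keep one face on its boundary. *)
  move=> i a; have -> : [set x : V | a < x ord0 i] = \bigcup_k
     hbox (\row_j (if j == i then a else (- k.+1%:R))) (const_mx k.+1%:R : V).
    apply/seteqP; split => [x /= ax|x [k _ /(_ i)]]; last first.
      by rewrite !mxE eqxx => /andP[].
    have [k _ /= kx] : (\bigcup_k cube k.+1%:R) x by rewrite bigcup_cube.
    exists k => // j; have := kx j; rewrite !mxE; case: eqP => // -> /andP[_ ->].
    by rewrite ax.
  have [_ _] := smallest_sigma_algebra setT G; apply => k.
  by apply: sub_sigma_algebra; eexists; eexists.
- by move=> _ _ [a [b ->]] [c [d ->]]; rewrite hboxI; eexists; eexists.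
- by move=> k; eexists; eexists.
- exact: bigcup_cube.
- move=> _ [a [b ->]].
  have [ab|/existsNP[i abi]] := pselect (forall i, a ord0 i <= b ord0 i); first exact: m12.
  suff -> : hbox a b = set0 by rewrite !measure0.
  apply/seteqP; split => // x /(_ i) /andP[h1 h2]; apply: abi.
  exact: ltW (lt_le_trans h1 h2).
- by move=> k; apply: fin => i; rewrite !mxE ge0_cp.
Qed.

End Borel.

(** * Lebesgue measure of cubes and translates *)

Section Lebesgue.
Context {R : realType} {n : nat}.
Local Notation V := 'rV[R]_n.
Local Notation T := (g_sigma_algebraType (@open V)).
Context (mu : {measure set T -> \bar R}) (Hmu : is_lebesgue mu).

Lemma mu_cube r : 0 <= r -> mu (cube r) = ((2 * r) ^+ n)%:E.
Proof.
move=> r0; rewrite [cube r](_ : _ = [set x : V | forall i, (const_mx (- r) : V) ord0 i < x ord0 i <= (const_mx r : V) ord0 i])//.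
rewrite Hmu => [|i]; last by rewrite !mxE ge0_cp.
rewrite -[X in _ ^+ X]card_ord -prodr_const; congr (_%:E).
by apply: eq_bigr => i _; rewrite !mxE; ring.
Qed.

Lemma cube_measurable r : @measurable _ T (cube r).
Proof. exact: hbox_measurable. Qed.

Lemma mu_bounded_lty (F : set V) M : @measurable _ T F ->
  (forall x, F x -> `|x| <= M) -> (mu F < +oo)%E.
Proof.
move=> mF FM; have M0 : 0 < `|M| + 1 by rewrite ltr_wpDl.
apply: (@le_lt_trans _ _ (mu (cube (`|M| + 1)))); last first.
  by rewrite mu_cube ?ltry// ltW.
apply: le_measure; rewrite ?inE//; first exact: cube_measurable.
move=> x /FM xM; apply: cube_norm => //.
by rewrite (le_lt_trans xM)// (le_lt_trans (ler_norm M))// ltrDl.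
Qed.

Lemma mu_compact_lty (K : set V) : compact K -> (mu K < +oo)%E.
Proof.
move=> cK; have [M [_ KM]] := compact_bounded cK.
apply: (@mu_bounded_lty _ (M + 1)); last by apply: KM; rewrite ltrDl.
by apply: closed_measurableV; apply: compact_closed.
Qed.

Lemma mu_sigma_finite : sigma_finite setT mu.
Proof.
exists (fun k => cube k.+1%:R); first by rewrite bigcup_cube.
by move=> k; split; [exact: cube_measurable|rewrite mu_cube// ltry].
Qed.

(** The preimage of E under [translate h] is the set E - h; translated sets appear below in this
    form. *)
Definition translate (h : V) : T -> T := fun x => x + h.

Lemma measurable_translate (h : V) : measurable_fun setT (translate h).
Proof.
move=> _ F mF; rewrite setTI; move: F mF.
apply: (@borel_ind _ _ [set F | @measurable _ T (translate h @^-1` F)]); first split => /=.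
- by rewrite preimage_set0.
- by move=> A mA; rewrite setTD preimage_setC; exact: measurableC.
- by move=> A mA; rewrite preimage_bigcup; exact: bigcup_measurable.
- move=> i a /=; have -> : translate h @^-1` [set x : V | a < x ord0 i] =
     [set x : V | a - h ord0 i < x ord0 i].
    by apply/seteqP; split => x /=; rewrite /translate mxE ltrBlDr.
  exact: half_measurable.
Qed.

(** The pushforward of [mu] under a translation has the prescribed values on half-open boxes, hence
    equals [mu] by uniqueness. *)
Lemma mu_translate h (F : set V) : @measurable _ T F ->
  mu (translate h @^-1` F) = mu F.
Proof.
have mh := measurable_translate h.
pose pf : {measure set T -> \bar R} := pushforward mu (translate h).
pose m1 := pf mh.
suff : forall F, @measurable _ T F -> m1 F = mu F by move=> /(_ F).
apply: borel_measure_unique => a b ab.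
  rewrite /m1/= /pushforward.
  rewrite [_ @^-1` _](_ : _ = [set x : V | forall i, (a - h) ord0 i < x ord0 i <= (b - h) ord0 i]); last first.
    by apply/seteqP; split=> x /= xab i; have := xab i; rewrite /translate !mxE ltrBlDr lerBrDr.
  rewrite Hmu; last by move=> i; rewrite !mxE lerD2r.
  rewrite -[hbox a b]/([set x : V | forall i, a ord0 i < x ord0 i <= b ord0 i]).
  rewrite Hmu//; congr EFin; apply: eq_bigr => i _; rewrite !mxE; ring.
rewrite /m1/= /pushforward.
  rewrite [_ @^-1` _](_ : _ = [set x : V | forall i, (a - h) ord0 i < x ord0 i <= (b - h) ord0 i]); last first.
    by apply/seteqP; split=> x /= xab i; have := xab i; rewrite /translate !mxE ltrBlDr lerBrDr.
  rewrite Hmu ?ltry//; by move=> i; rewrite !mxE lerD2r.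
Qed.

Lemma ge0_integral_translate (h : V) (F : set T) (f : T -> \bar R) : @measurable _ T F ->
  measurable_fun F f -> (forall x, F x -> 0 <= f x)%E ->
  (\int[mu]_(x in translate h @^-1` F) f (translate h x) = \int[mu]_(x in F) f x)%E.
Proof.
move=> mF mf f0; have mh := measurable_translate h.
rewrite -(@ge0_integral_pushforward _ _ T T _ (translate h) mh mu F f)//.
  by apply: eq_measure_integral => A mA _; exact: (mu_translate h mA).
by move=> x /set_mem; exact: f0.
Qed.

Lemma integral_translate h (f : T -> R) : measurable_fun setT f ->
  mu.-integrable setT (EFin \o f) ->
  mu.-integrable setT (EFin \o (fun x => f (translate h x))) /\
  (\int[mu]_x (f (translate h x))%:E = \int[mu]_x (f x)%:E)%E.
Proof.
move=> mf /integrableP[_ intf].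
have mfh : measurable_fun setT (fun x : T => f (translate h x) : R).
  by apply: measurableT_comp => //; exact: measurable_translate.
have intfh : mu.-integrable setT (EFin \o (fun x => f (translate h x))).
  apply/integrableP; split; first exact/measurable_EFinP.
  apply: le_lt_trans intf.
  rewrite -(@ge0_integral_translate h setT (fun x => `|(f x)%:E|%E))//.
  by apply: measurableT_comp => //; exact/measurable_EFinP.
split => //.
have mh := measurable_translate h.
transitivity (\int[pushforward mu (translate h)]_x (f x)%:E)%E.
  rewrite (@integral_pushforward _ _ T T R _ mh mu setT (EFin \o f))//.
  exact/measurable_EFinP.
by apply: eq_measure_integral => A mA _; exact: (mu_translate h mA).
Qed.

(** Balls are open and cubes half-open, so a ball is enclosed between two centred cubes with a spare
    factor 2. The resulting bounds [r ^+ n] and [(2 * r) ^+ n] on the measure of a ball are crude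
    but sufficient. *)
Lemma ball_cube (x y : V) r : 0 < r ->
  (cube (r / 2) (y - x) -> ball x r y) /\ (ball x r y -> cube r (y - x)).
Proof.
move=> r0; rewrite -ball_normE /ball_/= distrC; split; last exact: cube_norm.
have r20 : 0 < r / 2 by rewrite divr_gt0.
by move=> /(norm_cube r20)/le_lt_trans; apply; lra.
Qed.

Lemma ball_measurable (x : V) r : 0 < r -> @measurable _ T (ball x r).
Proof. by move=> r0; apply: open_measurableV; exact: ball_open. Qed.

Lemma mu_ball_le (x : V) r : 0 < r -> (mu (ball x r) <= ((2 * r) ^+ n)%:E)%E.
Proof.
move=> r0; rewrite -mu_cube; last exact: ltW.
rewrite -(mu_translate (- x) (cube_measurable _)).
apply: le_measure; rewrite ?inE; [exact: ball_measurable| |].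
  by rewrite -[X in measurable X]setTI; apply: measurable_translate => //; exact: cube_measurable.
by move=> y /(ball_cube _ _ r0).2.
Qed.

Lemma mu_ball_ge (x : V) r : 0 < r -> ((r ^+ n)%:E <= mu (ball x r))%E.
Proof.
move=> r0; have -> : r ^+ n = (2 * (r / 2)) ^+ n by congr (_ ^+ n); field.
rewrite -mu_cube; last by rewrite ltW// divr_gt0.
rewrite -(mu_translate (- x) (cube_measurable _)).
apply: le_measure; rewrite ?inE; [|exact: ball_measurable|].
  by rewrite -[X in measurable X]setTI; apply: measurable_translate => //; exact: cube_measurable.
by move=> y /(ball_cube _ _ r0).1.
Qed.

End Lebesgue.

(** * C1 functions *)

(* Restated over an arbitrary normed module: on ['rV[R]_n] the two inheritance paths to
   the topology are convertible but do not unify. *)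
Section NormedContinuity.
Context {R : realType} {M : normedModType R}.

Lemma normed_continuousD (f g : M -> R) : continuous f -> continuous g ->
  continuous (fun x => f x + g x).
Proof. by move=> cf cg x; apply: cvgD; [exact: cf|exact: cg]. Qed.

Lemma normed_continuousM (f g : M -> R) : continuous f -> continuous g ->
  continuous (fun x => f x * g x).
Proof. by move=> cf cg x; apply: cvgM; [exact: cf|exact: cg]. Qed.

Lemma normed_continuous_comp (f : M -> R) (s : R -> R) : continuous f -> continuous s ->
  continuous (fun x => s (f x)).
Proof. by move=> cf cs x; apply: (continuous_comp (cf x)); exact: cs. Qed.

Lemma normed_continuous_translate (f : M -> R) h : continuous f ->
  continuous (fun x => f (x + h)).
Proof.
move=> cf x; apply: (@continuous_comp _ _ _ (fun x => x + h) f); last exact: cf.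
by apply: cvgD; [exact: cvg_id|exact: cvg_cst].
Qed.

Lemma normed_near_forall (I : finType) (P : I -> set M) (x : M) :
  (forall i, nbhs x (P i)) -> nbhs x [set y | forall i, P i y].
Proof. exact: filter_forall. Qed.

Lemma normed_continuous_lipschitz (f : M -> R) :
  (forall x, exists C e, 0 < e /\ forall y, `|x - y| < e -> `|f x - f y| <= C * `|x - y|) ->
  continuous f.
Proof.
move=> lf x; have [C [e [e0 Cf]]] := lf x.
apply/cvgrPdist_lt => eps eps0; near=> y.
have xy : `|x - y| < e by near: y; exact: cvgr_dist_lt.
apply: le_lt_trans (Cf _ xy) _; apply: (@le_lt_trans _ _ ((`|C| + 1) * `|x - y|)).
  by rewrite ler_wpM2r// (le_trans (ler_norm C))// lerDl.
rewrite -ltr_pdivlMl; last by rewrite ltr_wpDl.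
near: y; apply: cvgr_dist_lt => //.
by rewrite mulr_gt0// invr_gt0 ltr_wpDl.
Unshelve. all: end_near. Qed.

End NormedContinuity.

Section C1.
Context {R : realType} {n : nat}.
Local Notation V := 'rV[R]_n.

(** As in [C1c_field], only partial derivatives along the basis vectors are required; continuity of
    f itself is derived in [C1_continuous]. *)
Definition C1 (f : V -> R) : Prop :=
  (forall j x, derivable f x (evec R j)) /\
  (forall j, continuous (fun x => derive f x (evec R j))).

Lemma evecE (i j : 'I_n) : evec R i ord0 j = (j == i)%:R.
Proof. by rewrite /evec mxE eqxx. Qed.

(** Turns a directional derivative into a derivative in one real variable, to which the mean value
    theorem and the chain rule apply. *)
Lemma is_derive_line (f : V -> R) (x v : V) t : derivable f (x + t *: v) v ->
  is_derive t 1 (fun s => f (x + s *: v)) ('D_v f (x + t *: v)).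
Proof.
have E : (fun h : R => h^-1 *: (((fun s => f (x + s *: v)) \o shift t) (h *: 1) - f (x + t *: v)))
   = (fun h => h^-1 *: ((f \o shift (x + t *: v)) (h *: v) - f (x + t *: v))).
  apply/funext => h /=; congr (_ *: (f _ - _)).
  by rewrite [h%:A]mulr1 scalerDl addrCA.
move=> df; apply: DeriveDef; first by rewrite /derivable E.
by rewrite /derive E.
Qed.

Lemma line_lipschitz (f : V -> R) (x v : V) (C t : R) :
  (forall s, derivable f (x + s *: v) v) ->
  (forall s, `|s| <= `|t| -> `|'D_v f (x + s *: v)| <= C) ->
  `|f (x + t *: v) - f x| <= C * `|t|.
Proof.
move=> df DC; pose g s := f (x + s *: v).
have dg (s : R) : is_derive s 1 g ('D_v f (x + s *: v)) by exact: is_derive_line.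
have cg a b : {within `[a, b], continuous g}.
  by apply: derivable_within_continuous => s _; apply: ex_derive.
have -> : f x = g 0 by rewrite /g scale0r addr0.
rewrite -/(g t); have [t0|/ltW t0] := leP 0 t.
  have [c] := MVT_segment t0 (fun s _ => dg s) (cg _ _).
  rewrite in_itv/= => /andP[c0 ct] ->; rewrite subr0 normrM.
  by apply: ler_wpM2r => //; apply: DC; rewrite !ger0_norm.
have [c] := MVT_segment t0 (fun s _ => dg s) (cg _ _).
rewrite in_itv/= => /andP[ct c0]; rewrite sub0r => E.
rewrite -normrN opprB E normrM normrN.
by apply: ler_wpM2r => //; apply: DC; rewrite !ler0_norm// lerN2.
Qed.

(** Continuous partial derivatives are locally bounded. Going from x to y one coordinate at a time
    and using the mean value inequality on each segment makes f locally Lipschitz. *)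
Lemma C1_continuous (f : V -> R) : C1 f -> continuous f.
Proof.
move=> [df cdf]; apply: (@normed_continuous_lipschitz _ 'rV[R]_n) => x; pose C := \sum_(j < n) (`|'D_(evec R j) f x| + 1).
have CP j : `|'D_(evec R j) f x| + 1 <= C.
  by rewrite /C (bigD1 j)//= lerDl sumr_ge0// => i _; rewrite addr_ge0.
have : \forall y \near x, forall j, `|'D_(evec R j) f y| <= C.
  apply: (@normed_near_forall _ 'rV[R]_n) => j.
  have /cvgrPdist_lt/(_ 1 ltr01) := cdf j x.
  apply: filterS => y; rewrite distrC => h; apply: le_trans (CP j).
  by rewrite -lerBlDl; apply: le_trans (lerB_dist _ _) (ltW h).
case/nbhs_ballP => e /= e0 xe.
exists (C * n%:R), e; split => // y xy.
(* The point [p k] has its first k coordinates from y and the others from x. Sup-norm balls are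
   boxes, so the segments between successive points stay in the ball where the derivatives are
   bounded. *)
pose p k : V := \row_i (if (i < k)%N then y ord0 i else x ord0 i).
have p0 : p 0%N = x by apply/rowP => i; rewrite mxE.
have pn : p n = y by apply/rowP => i; rewrite mxE ltn_ord.
have pS (k : 'I_n) : p k.+1 = p k + (y ord0 k - x ord0 k) *: evec R k.
  apply/rowP => i; rewrite !mxE/= ltnS leq_eqVlt.
  have [->|ik] := eqVneq i k; first by rewrite eqxx ltnn/= mulr1 subrKC.
  rewrite -val_eqE/= in ik; rewrite (negbTE ik) /= mulr0 addr0; by case: ifP.
have step (k : 'I_n) : `|f (p k.+1) - f (p k)| <= C * `|x - y|.
  rewrite pS; apply: le_trans (_ : _ <= C * `|y ord0 k - x ord0 k|) _.
    apply: line_lipschitz => [s|s sk]; first exact: df.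
    apply: xe; rewrite -ball_normE /ball_/=; apply/norm_ltP => // i.
    rewrite !mxE/=; have := xy => /norm_ltP-/(_ e0 i); rewrite !mxE => xyi.
    have [->|ik] := eqVneq i k.
      rewrite ltnn /= mulr1 opprD addrA subrr sub0r normrN.
      apply: le_lt_trans sk _; rewrite distrC; move: xy => /norm_ltP-/(_ e0 k).
      by rewrite !mxE.
    by rewrite mulr0 addr0; case: ifP => // _; rewrite subrr normr0.
  apply: ler_wpM2l; first by rewrite (le_trans _ (CP k))// addr_ge0.
  by have := coord_le_norm (x - y) k; rewrite !mxE distrC.
have : `|f (p n) - f (p 0%N)| <= \sum_(k < n) C * `|x - y|.
  rewrite -(telescope_sumr (fun k => f (p k)))// big_mkord.
  by apply: le_trans (ler_norm_sum _ _ _) _; apply: ler_sum => k _; exact: step.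
by rewrite p0 pn sumr_const card_ord distrC -(mulr_natr (C * _)) mulrAC.
Qed.

Lemma C1_cst (c : R) : C1 (cst c).
Proof.
split=> [j x|j]; first exact: derivable_cst.
rewrite (_ : (fun x => _) = cst 0); first exact: cst_continuous.
by apply/funext => x; rewrite derive_cst.
Qed.

Lemma C1D f g : C1 f -> C1 g -> C1 (f \+ g).
Proof.
move=> [df cf] [dg cg]; split=> [j x|j]; first exact: derivableD.
rewrite (_ : (fun x => _) = (fun x => derive f x (evec R j)) \+ (fun x => derive g x (evec R j))).
  exact: normed_continuousD.
by apply/funext => x; rewrite deriveD.
Qed.

Lemma C1M f g : C1 f -> C1 g -> C1 (f \* g).
Proof.
move=> Cf Cg; have [df cf] := Cf; have [dg cg] := Cg.
split=> [j x|j]; first exact: derivableM.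
rewrite (_ : (fun x => _) = (fun x => f x * derive g x (evec R j) + g x * derive f x (evec R j))).
  exact: (normed_continuousD (normed_continuousM (C1_continuous Cf) (cg j)) (normed_continuousM (C1_continuous Cg) (cf j))).
by apply/funext => x; rewrite deriveM.
Qed.

Lemma C1_comp f (s ds : R -> R) : C1 f -> (forall t : R, is_derive t 1 s (ds t)) ->
  continuous ds -> C1 (s \o f) /\
  forall j x, 'D_(evec R j) (s \o f) x = ds (f x) * 'D_(evec R j) f x.
Proof.
move=> Cf dsP cds; have [df cf] := Cf.
have dc j x : is_derive x (evec R j) (s \o f) (ds (f x) * 'D_(evec R j) f x).
  have E g : (fun h : R => h^-1 *: ((g \o shift x) (h *: evec R j) - g x)) =
      (fun h : R => h^-1 *: (((fun s => g (x + s *: evec R j)) \o shift 0) (h *: 1) - g (x + 0 *: evec R j))).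
    apply/funext => h /=; congr (_ *: (g _ - g _)); last by rewrite scale0r addr0.
    by rewrite [h%:A]mulr1 addr0 addrC.
  have dx : derivable f (x + 0 *: evec R j) (evec R j) by exact: df.
  have d1 : is_derive (0:R) 1 (fun t : R => f (x + t *: evec R j)) ('D_(evec R j) f x).
    by have := is_derive_line dx; rewrite scale0r addr0.
  have d2 : is_derive (0:R) 1 (s \o (fun t : R => f (x + t *: evec R j))) (ds (f x) * 'D_(evec R j) f x).
    apply: is_derive1_comp; rewrite ?scale0r ?addr0//; exact: dsP.
  apply: DeriveDef; first by rewrite /derivable E; case: d2.
  by rewrite /derive E; case: d2 => _ <-.
split; last by move=> j x; rewrite derive_val.
split=> [j x|j]; first exact: ex_derive.
rewrite (_ : (fun x => _) = (fun x => ds (f x) * 'D_(evec R j) f x)).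
  exact: (normed_continuousM (normed_continuous_comp (C1_continuous Cf) cds) (cf j)).
by apply/funext => x; rewrite derive_val.
Qed.

Lemma is_derive_coord (i : 'I_n) (x v : V) : is_derive x v (fun y : V => y ord0 i) (v ord0 i).
Proof.
have E : (fun h : R => h^-1 *: (((fun y : V => y ord0 i) \o shift x) (h *: v) - x ord0 i)) @ 0^'
    --> v ord0 i.
  apply: cvg_near_cst; near=> h; rewrite /= !mxE addrK [_ *: _]mulrA mulVf ?mul1r//.
  by near: h; exact: nbhs_dnbhs_neq.
apply: DeriveDef; first by apply/cvg_ex; exists (v ord0 i).
exact: cvg_lim E.
Unshelve. all: end_near. Qed.

Lemma C1_coord (i : 'I_n) : C1 (fun y : V => y ord0 i).
Proof.
split=> [j x|j]; first by have [] := is_derive_coord i x (evec R j).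
rewrite (_ : (fun x => _) = cst (evec R j ord0 i)); first exact: cst_continuous.
by apply/funext => x; have [_ ->] := is_derive_coord i x (evec R j).
Qed.

Lemma C1_sum (I : Type) (r : seq I) (F : I -> V -> R) : (forall i, C1 (F i)) ->
  C1 (fun x => \sum_(i <- r) F i x).
Proof.
move=> CF; elim: r => [|i r IH].
  rewrite (_ : (fun x => _) = cst 0); first exact: C1_cst.
  by apply/funext => x; rewrite big_nil.
rewrite (_ : (fun x => _) = F i \+ (fun x => \sum_(i <- r) F i x)); first exact: C1D.
by apply/funext => x; rewrite big_cons.
Qed.

Lemma C1_translate f h : C1 f -> C1 (fun x => f (x + h)) /\
  forall j x, 'D_(evec R j) (fun x => f (x + h)) x = 'D_(evec R j) f (x + h).
Proof.
move=> [df cf].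
have E j x : (fun t : R => t^-1 *: (((fun x => f (x + h)) \o shift x) (t *: evec R j) - f (x + h))) =
  (fun t : R => t^-1 *: ((f \o shift (x + h)) (t *: evec R j) - f (x + h))).
  by apply/funext => t /=; rewrite addrA.
have D j x : 'D_(evec R j) (fun x => f (x + h)) x = 'D_(evec R j) f (x + h).
  by rewrite /derive E.
split; last exact: D.
split=> [j x|j].
  by have := df j (x + h); rewrite /derivable -E.
rewrite (_ : (fun x => _) = (fun x => 'D_(evec R j) f (x + h))); last exact/funext.
exact: (@normed_continuous_translate _ 'rV[R]_n _ h (cf j)).
Qed.

Lemma derive_out_compact (f : V -> R) K (v x : V) : compact K -> (forall x, ~ K x -> f x = 0) ->
  ~ K x -> 'D_v f x = 0.
Proof.
move=> cK fK Kx; rewrite -(derive_cst (0 : R) x v); apply: near_eq_derive.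
have oK : open (~` K) by rewrite openC; apply: compact_closed.
by apply: filterS (open_nbhs_nbhs (conj oK Kx)) => y /fK.
Qed.

End C1.

(** * The divergence of a test field integrates to zero *)

Section SmoothStep.
Context {R : realType}.
Implicit Types t : R.

Definition ppart t : R := Num.max t 0.

Lemma ppart_continuous : continuous ppart.
Proof. by move=> t; apply: continuous_max; [exact: cvg_id|exact: cvg_cst]. Qed.

(** Squaring removes the kink of the positive part: in every sign case the first-order remainder is
    at most [h ^+ 2]. *)
Lemma is_derive_ppart2 t : is_derive t 1 (fun s => ppart s ^+ 2) (2 * ppart t).
Proof.
have ub h : `|ppart (h + t) ^+ 2 - ppart t ^+ 2 - h * (2 * ppart t)| <= `|h| ^+ 2.
  rewrite -normrX (ger0_norm (sqr_ge0 h)) ler_norml /ppart /Num.max.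
  by case: ifP => [|/negbT]; case: ifP => [|/negbT]; rewrite -?leNgt => h1 h2; apply/andP; split; nra.
have E : (fun h : R => h^-1 *: (((fun s => ppart s ^+ 2) \o shift t) (h *: 1) - ppart t ^+ 2)) @ 0^'
    --> 2 * ppart t.
  apply/cvgrPdist_lt => e e0; near=> h; rewrite /= [h%:A]mulr1.
  have h0 : h != 0 by near: h; exact: nbhs_dnbhs_neq.
  have -> : 2 * ppart t - h^-1 *: (ppart (h + t) ^+ 2 - ppart t ^+ 2) =
     - (h^-1 * (ppart (h + t) ^+ 2 - ppart t ^+ 2 - h * (2 * ppart t))).
    by rewrite /GRing.scale/=; field.
  rewrite normrN normrM; apply: (@le_lt_trans _ _ (`|h^-1| * `|h| ^+ 2)).
    by rewrite ler_wpM2l.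
  rewrite expr2 mulrA -normrM mulVf// normr1 mul1r.
  by near: h; exact: dnbhs0_lt.
apply: DeriveDef; first by apply/cvg_ex; exists (2 * ppart t).
exact: cvg_lim E.
Unshelve. all: end_near. Qed.

(* A C1 quadratic spline rising from 0 at [t <= 0] to 1 at [t >= 1]. *)
Definition step t : R :=
  2 * ppart t ^+ 2 - 4 * ppart (t - 2^-1) ^+ 2 + 2 * ppart (t - 1) ^+ 2.
Definition dstep t : R :=
  4 * ppart t - 8 * ppart (t - 2^-1) + 4 * ppart (t - 1).

Lemma is_derive_step t : is_derive t 1 step (dstep t).
Proof.
have d a : is_derive t 1 (fun s => ppart (s - a) ^+ 2) (2 * ppart (t - a)).
  rewrite -[X in is_derive _ _ _ X]mulr1.
  apply: (@is_derive1_comp _ (fun s => ppart s ^+ 2) (fun s => s - a)).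
    exact: is_derive_ppart2.
  by apply: is_derive_eq; rewrite subr0.
have d0 := is_derive_ppart2 t.
have d1 := d 2^-1; have d2 := d 1.
rewrite /step; apply: is_derive_eq; rewrite /dstep /GRing.scale/=; ring.
Qed.

Lemma dstep_continuous : continuous dstep.
Proof.
have c a : continuous (fun t => ppart (t - a)).
  by move=> t; apply: (continuous_comp (f := fun t => t - a)); [apply: cvgB; [exact: cvg_id|exact: cvg_cst]|exact: ppart_continuous].
move=> t; apply: cvgD; last by apply: cvgM; [exact: cvg_cst|exact: c].
apply: cvgB; apply: cvgM; try exact: cvg_cst; [exact: ppart_continuous|exact: c].
Qed.

Lemma step0 t : t <= 0 -> step t = 0.
Proof.
by move=> t0; rewrite /step /ppart !max_r; [ring|lra..].
Qed.

Lemma step1 t : 1 <= t -> step t = 1.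
Proof.
by move=> t1; rewrite /step /ppart !max_l; [field|lra..].
Qed.

Lemma step_itv t : 0 <= step t <= 1.
Proof.
rewrite /step /ppart /Num.max.
by case: ifP => [|/negbT]; case: ifP => [|/negbT]; case: ifP => [|/negbT];
  rewrite -?leNgt => h1 h2 h3; apply/andP; split; nra.
Qed.

Lemma dstep_ge0 t : 0 <= dstep t.
Proof.
rewrite /dstep /ppart /Num.max.
by case: ifP => [|/negbT]; case: ifP => [|/negbT]; case: ifP => [|/negbT];
  rewrite -?leNgt => h1 h2 h3; lra.
Qed.

End SmoothStep.

(** * Integrals of compactly supported functions and of their derivatives *)

Section CompactSupport.
Context {R : realType} {n : nat}.
Local Notation V := 'rV[R]_n.
Local Notation T := (g_sigma_algebraType (@open V)).
Context (mu : {measure set T -> \bar R}) (Hmu : is_lebesgue mu).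

Lemma supp_bounded (g : V -> R) K : continuous g -> compact K ->
  (forall x, ~ K x -> g x = 0) -> exists C : R, 0 <= C /\ forall x, `|g x| <= C.
Proof.
move=> cg cK gK; have cgK : compact (g @` K).
  by apply: continuous_compact => //; exact: continuous_subspaceT.
have [M [_ /(_ (`|M| + 1))]] := compact_bounded cgK.
rewrite (le_lt_trans (ler_norm M)) ?ltrDl// => /(_ isT) KM.
exists (`|M| + 1); split; first by rewrite addr_ge0.
move=> x; have [Kx|Kx] := pselect (K x); first by apply: KM; exists x.
by rewrite gK// normr0 addr_ge0.
Qed.

Lemma bounded_supp_integrable (g : T -> R) (E : set T) M C : measurable E ->
  measurable_fun setT g -> (forall x, `|g x| <= C) ->
  (forall x : V, M < `|x| -> g x = 0) -> mu.-integrable E (EFin \o g).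
Proof.
move=> mE mg gC gM; have M0 : 0 < `|M| + 1 by rewrite ltr_wpDl.
apply: (@integrableS _ _ _ mu setT) => //.
have mQ := @cube_measurable R n (`|M| + 1).
have -> : EFin \o g = (EFin \o g) \_ (cube (`|M| + 1)).
  apply/funext => x; rewrite patchE; case: ifPn => // xQ /=; rewrite gM//.
  rewrite ltNge; apply: contra xQ => xM; apply/mem_set/cube_norm => //.
  by rewrite (le_lt_trans xM)// (le_lt_trans (ler_norm _))// ltrDl.
apply/(integrable_mkcond (EFin \o g) mQ); apply: measurable_bounded_integrable => //.
- by rewrite mu_cube ?ltry// ltW.
- exact: measurable_funTS.
- exists C; split; first exact: num_real.
  by move=> x Cx y _; exact: le_trans (gC y) (ltW Cx).
Qed.

Lemma supp_integrable (g : V -> R) K (E : set T) : continuous g -> compact K ->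
  (forall x, ~ K x -> g x = 0) -> measurable E -> mu.-integrable E (EFin \o (g : T -> R)).
Proof.
move=> cg cK gK mE; have [C [_ gC]] := supp_bounded cg cK gK.
have [M [_ /(_ (`|M| + 1))]] := compact_bounded cK.
rewrite (le_lt_trans (ler_norm M)) ?ltrDl// => /(_ isT) KM.
apply: (@bounded_supp_integrable _ _ (`|M| + 1) C) => //.
  exact: continuous_measurableV.
by move=> x xM; apply: gK => /KM /(lt_le_trans xM); rewrite ltxx.
Qed.

(** Differentiation under the integral sign. For shifts s within distance 1 of t the supports all
    lie in one cube, and a constant multiple of its indicator dominates the derivatives. *)
Lemma is_derive_integral_translate (f : V -> R) K (E : set T) j (t : R) :
  C1 f -> compact K -> (forall x, ~ K x -> f x = 0) -> measurable E ->
  is_derive t 1 (fun s : R => \int[mu]_(x in E) f (x + s *: evec R j))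
    (\int[mu]_(x in E) 'D_(evec R j) f (x + t *: evec R j)).
Proof.
move=> Cf cK fK mE; have [df cdf] := Cf; set e := evec R j.
have [C [C0 fC]] := supp_bounded (cdf j) cK (fun x => derive_out_compact e cK fK (x := x)).
have [C' [C'0 fC']] := supp_bounded (C1_continuous Cf) cK fK.
have [M [_ /(_ (`|M| + 1))]] := compact_bounded cK.
rewrite (le_lt_trans (ler_norm M)) ?ltrDl// => /(_ isT) KM.
have norme : `|e| <= 1.
  by apply/norm_leP => // i; rewrite evecE; case: eqP; rewrite ?normr1 ?normr0.
have dl x (s : R) : is_derive s 1 (fun s : R => f (x + s *: e)) ('D_e f (x + s *: e)).
  by apply: is_derive_line; exact: df.
(* The radius of the support plus the bound [|t| + 1] on the size of the shifts. *)
pose r := `|M| + 1 + `|t| + 1.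
have r0 : 0 <= r by rewrite /r !addr_ge0.
pose G (y : T) : R := C * \1_(cube r) y.
have out y s : `]t - 1, t + 1[%classic s -> ~ cube r y -> ~ K (y + s *: e).
  rewrite /= in_itv/= => /andP[s1 s2] ry Ky; apply: ry; apply: cube_norm.
    by rewrite /r ltr_wpDl// !addr_ge0.
  have -> : y = (y + s *: e) - s *: e by rewrite addrK.
  apply: le_lt_trans (ler_normB _ _) _; rewrite /r -addrA; apply: ler_ltD; first exact: KM.
  rewrite normrZ; apply: (@le_lt_trans _ _ `|s|); first by rewrite ler_piMr.
  rewrite ltr_norml; have := ler_norm t; have := lerNnormlW (lexx `|t|) => h1 h2.
  by apply/andP; split; lra.
have mG : mu.-integrable E (EFin \o G).
  apply: (@bounded_supp_integrable _ _ r C) => //.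
  - by apply: measurable_funM => //; apply: measurable_indic; exact: cube_measurable.
  - move=> x; rewrite /G indicE normrM (ger0_norm C0) ler_piMr//.
    by case: (_ \in _); rewrite ?normr1 ?normr0.
  - move=> x rx; rewrite /G indicE memNset ?mulr0// => /norm_cube h.
    have r1 : 0 < r by rewrite /r ltr_wpDl// !addr_ge0.
    by move: (h r1); rewrite leNgt rx.
have It : `]t - 1, t + 1[%classic t by rewrite /= in_itv/= ltrBlDr ltrDl ltr01.
have intf s : `]t - 1, t + 1[%classic s ->
    mu.-integrable E (EFin \o (fun x : T => f (x + s *: e))).
  move=> Is; apply: (@bounded_supp_integrable _ _ r C') => //.
    apply: continuous_measurableV.
    exact: (@normed_continuous_translate _ 'rV[R]_n _ (s *: e) (C1_continuous Cf)).
  move=> x rx; apply: fK; apply: out => // /norm_cube h.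
  have r1 : 0 < r by rewrite /r ltr_wpDl// !addr_ge0.
  by move: (h r1); rewrite leNgt rx.
have derf (s : R) (y : T) : `]t - 1, t + 1[%classic s -> E y ->
   derivable (fun s : R => f (y + s *: e)) s 1 by move=> _ _; case: (dl y s).
have d1E s y : partial1of2 (fun (s : R) (y : T) => f (y + s *: e)) s y = 'D_e f (y + s *: e).
  by rewrite partial1of2E; case: (dl y s).
have GC s y : `]t - 1, t + 1[%classic s -> E y ->
  `|partial1of2 (fun (s : R) (y : T) => f (y + s *: e)) s y| <= G y.
  move=> Is _; rewrite d1E /G indicE; case: (boolP (y \in cube r)) => yr.
    by rewrite mulr1.
  rewrite (derive_out_compact _ cK fK) ?normr0 ?mulr0//.
  by apply: out => // h; move: yr; rewrite (mem_set h).
have G0 y : 0 <= G y by rewrite /G mulr_ge0.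
have D1 := derivable_under_integral mE It intf derf G0 mG GC.
have D2 := differentiation_under_integral mE It intf derf G0 mG GC.
apply: DeriveDef; first exact: D1.
rewrite -derive1E D2; apply: eq_Rintegral => y _; exact: d1E.
Qed.

(** By translation invariance the integral of f(x + s e_j) does not depend on s, so its derivative
    at s = 0, the integral of the partial derivative, vanishes. No iterated integration is
    involved. *)
Lemma integral_partial_eq0 (f : V -> R) K j : C1 f -> compact K ->
  (forall x, ~ K x -> f x = 0) -> \int[mu]_x ('D_(evec R j) f x) = 0.
Proof.
move=> Cf cK fK.
have [_] := is_derive_integral_translate j 0 Cf cK fK (measurableT : measurable (setT : set T)).
under eq_Rintegral do rewrite scale0r addr0.
move=> <-; rewrite (_ : (fun s : R => _) = cst (\int[mu]_x f x)); first exact: derive_cst.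
apply/funext => s; rewrite /Rintegral.
have mf : measurable_fun setT (f : T -> R) by apply: continuous_measurableV; exact: C1_continuous.
have intf : mu.-integrable setT (EFin \o (f : T -> R)).
  by apply: (supp_integrable (C1_continuous Cf) cK fK).
by have [_ /= <-] := integral_translate Hmu (s *: evec R j) mf intf.
Qed.

End CompactSupport.

(** * Perimeter *)

Section Euclidean.
Context {R : realType} {n : nat}.
Local Notation V := 'rV[R]_n.
Implicit Types x y : V.

Definition dot x y : R := \sum_(i < n) x ord0 i * y ord0 i.
Definition sqnorm x : R := \sum_(i < n) x ord0 i ^+ 2.

Lemma sqnorm_ge0 x : 0 <= sqnorm x.
Proof. by apply: sumr_ge0 => i _; exact: sqr_ge0. Qed.

Lemma enorm_ge0 x : 0 <= enorm x.
Proof. exact: sqrtr_ge0. Qed.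

Lemma sqr_enorm x : enorm x ^+ 2 = sqnorm x.
Proof. by rewrite sqr_sqrtr// sqnorm_ge0. Qed.

Lemma enorm_le x c : 0 <= c -> (enorm x <= c) = (sqnorm x <= c ^+ 2).
Proof. by move=> c0; rewrite -sqr_enorm ler_pXn2r// nnegrE ?enorm_ge0. Qed.

Lemma enormZ c x : enorm (c *: x) = `|c| * enorm x.
Proof.
rewrite /enorm -sqrtr_sqr -sqrtrM ?sqr_ge0// mulr_sumr; congr Num.sqrt.
by apply: eq_bigr => i _; rewrite mxE exprMn.
Qed.

Lemma enormN x : enorm (- x) = enorm x.
Proof. by rewrite -scaleN1r enormZ normrN1 mul1r. Qed.

Lemma edist0 x : Defs.edist 0 x = enorm x.
Proof. by rewrite /Defs.edist add0r enormN. Qed.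

Lemma enorm0 : enorm (0 : V) = 0.
Proof. by rewrite -(scale0r (0 : V)) enormZ normr0 mul0r. Qed.

Lemma dot_le1 x y : enorm x <= 1 -> enorm y <= 1 -> dot x y <= 1.
Proof.
rewrite !enorm_le// expr1n => x1 y1.
apply: (@le_trans _ _ (2^-1 * (sqnorm x + sqnorm y))); last lra.
rewrite -big_split/= mulr_sumr; apply: ler_sum => i _.
have := sqr_ge0 (x ord0 i - y ord0 i); lra.
Qed.

Lemma dotZl c x y : dot (c *: x) y = c * dot x y.
Proof. by rewrite mulr_sumr; apply: eq_bigr => i _; rewrite mxE mulrA. Qed.

Lemma dotC x y : dot x y = dot y x.
Proof. by apply: eq_bigr => i _; rewrite mulrC. Qed.

Lemma dotDl x y z : dot (x + y) z = dot x z + dot y z.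
Proof. by rewrite -big_split; apply: eq_bigr => i _; rewrite mxE mulrDl. Qed.

Lemma dotNl x y : dot (- x) y = - dot x y.
Proof. by rewrite -scaleN1r dotZl mulN1r. Qed.

Lemma dotxx x : dot x x = sqnorm x.
Proof. by apply: eq_bigr => i _; rewrite expr2. Qed.

Lemma enorm_coord x i : `|x ord0 i| <= enorm x.
Proof.
rewrite -sqrtr_sqr ler_wsqrtr// (bigD1 i)//= lerDl sumr_ge0// => j _; exact: sqr_ge0.
Qed.

Lemma enorm_eq0 x : enorm x = 0 -> x = 0.
Proof.
move=> x0; apply/rowP => i; rewrite mxE; apply/eqP; rewrite -normr_eq0.
by rewrite eq_le normr_ge0 andbT -x0 enorm_coord.
Qed.

(** By homogeneity it is enough to treat unit vectors, where the bound is the sum over coordinates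
    of 2ab <= a^2 + b^2, see [dot_le1]. *)
Lemma cauchy_schwarz x y : dot x y <= enorm x * enorm y.
Proof.
have [/enorm_eq0 ->|x0] := eqVneq (enorm x) 0.
  by rewrite enorm0 mul0r -(scale0r (0 : V)) dotZl mul0r.
have [/enorm_eq0 ->|y0] := eqVneq (enorm y) 0.
  by rewrite enorm0 mulr0 dotC -(scale0r (0 : V)) dotZl mul0r.
have xp : 0 < enorm x by rewrite lt_neqAle eq_sym x0 enorm_ge0.
have yp : 0 < enorm y by rewrite lt_neqAle eq_sym y0 enorm_ge0.
have : dot ((enorm x)^-1 *: x) ((enorm y)^-1 *: y) <= 1.
  by apply: dot_le1; rewrite enormZ gtr0_norm ?invr_gt0// mulVf.
by rewrite dotZl dotC dotZl dotC mulrA -invfM ler_pdivrMl ?mulr_gt0// mulr1.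
Qed.

Lemma enormD x y : enorm (x + y) <= enorm x + enorm y.
Proof.
rewrite enorm_le ?addr_ge0 ?enorm_ge0//.
rewrite -dotxx dotDl (dotC x) (dotC y) !dotDl !dotxx -!sqr_enorm (dotC y x).
have := cauchy_schwarz x y; nra.
Qed.

Lemma norm_le_enorm x : `|x| <= enorm x.
Proof. by apply/norm_leP => [|i]; [exact: enorm_ge0|exact: enorm_coord]. Qed.

(** The sharp factor is the square root of [n]; the factor [n] avoids roots and is good enough
    everywhere. *)
Lemma enorm_le_norm x : enorm x <= n%:R * `|x|.
Proof.
rewrite enorm_le ?mulr_ge0//; apply: (@le_trans _ _ (\sum_(i < n) `|x| ^+ 2)).
  by apply: ler_sum => i _; rewrite -[leLHS]real_normK ?num_real// ler_pXn2r ?nnegrE// coord_le_norm.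
rewrite sumr_const card_ord -(mulr_natl (`|x| ^+ 2)) exprMn ler_wpM2r ?exprn_ge0//.
by rewrite -natrX ler_nat; case: n => // m; rewrite expnS leq_pmulr.
Qed.

Lemma C1_sqnorm : C1 sqnorm /\
  forall j x, 'D_(evec R j) sqnorm x = 2 * x ord0 j.
Proof.
split.
  apply: (@C1_sum R n 'I_n (index_enum _) (fun i y => y ord0 i ^+ 2)) => i.
  rewrite (_ : (fun y => _) = (fun y : V => y ord0 i) \* (fun y : V => y ord0 i)).
    by apply: C1M; exact: C1_coord.
  by apply/funext => y /=; rewrite expr2.
move=> j x.
have h i : is_derive x (evec R j) (fun y : V => y ord0 i ^+ 2) (2 * x ord0 i * (i == j)%:R).
  have hi := is_derive_coord i x (evec R j).
  have := is_deriveX 2 hi; rewrite evecE => h; apply: is_derive_eq h _.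
  by rewrite /GRing.scale/= expr1; ring.
have -> : sqnorm = \sum_(i < n) (fun y : V => y ord0 i ^+ 2).
  by apply/funext => y; rewrite fct_sumE.
have [_ ->] := is_derive_sum h.
rewrite (bigD1 j)//= eqxx mulr1 big1 ?addr0// => i /negbTE ->; by rewrite mulr0.
Qed.

Lemma C1_dot nu : C1 (fun x : V => dot x nu) /\
  forall j x, 'D_(evec R j) (fun x : V => dot x nu) x = nu ord0 j.
Proof.
split.
  apply: (@C1_sum R n 'I_n (index_enum _) (fun i y => y ord0 i * nu ord0 i)) => i.
  by apply: (@C1M R n _ (cst (nu ord0 i))); [exact: C1_coord|exact: C1_cst].
move=> j x.
have h i : is_derive x (evec R j) (fun y : V => y ord0 i * nu ord0 i) (nu ord0 i * (i == j)%:R).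
  have hi := is_derive_coord i x (evec R j).
  have hc := is_derive_cst (nu ord0 i) x (evec R j).
  have := is_deriveM hi hc; rewrite evecE => h; apply: is_derive_eq h _.
  by rewrite /GRing.scale/=; ring.
have -> : (fun x : V => dot x nu) = \sum_(i < n) (fun y : V => y ord0 i * nu ord0 i).
  by apply/funext => y; rewrite fct_sumE.
have [_ ->] := is_derive_sum h.
rewrite (bigD1 j)//= eqxx mulr1 big1 ?addr0// => i /negbTE ->; by rewrite mulr0.
Qed.

Lemma dstep1 (t : R) : 1 <= t -> dstep t = 0.
Proof. by move=> t1; rewrite /dstep /ppart !max_l; [field|lra..]. Qed.

(** The step is applied to M^2 + 2 - |x|^2, because the squared norm is C1 at the origin while the
    norm is not. This argument is at least 2 on the ball of radius M and negative beyond radius M +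
    2. As [chi] is 1 with zero derivatives on the closed ball, multiplying by it does not affect a
    divergence there. *)
Lemma cutoff_exists M : 0 <= M -> exists chi : V -> R, [/\ C1 chi,
  forall x, 0 <= chi x <= 1,
  forall x, enorm x <= M -> chi x = 1 /\ forall j, 'D_(evec R j) chi x = 0 &
  forall x, M + 2 <= enorm x -> chi x = 0].
Proof.
move=> M0; have [C1s Ds] := C1_sqnorm.
have C1g : C1 (fun x => M ^+ 2 + 2 - sqnorm x).
  rewrite (_ : (fun x => _) = cst (M ^+ 2 + 2) \+ (cst (-1) \* sqnorm)).
    by apply: C1D; [exact: C1_cst|apply: C1M => //; exact: C1_cst].
  by apply/funext => x /=; rewrite mulN1r.
have [C1c Dc] := C1_comp C1g (@is_derive_step R) dstep_continuous.
exists (@step R \o (fun x => M ^+ 2 + 2 - sqnorm x)); split => //.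
- by move=> x; exact: step_itv.
- move=> x; rewrite enorm_le// => xM; split => [/=|j]; first by apply: step1; lra.
  by rewrite Dc dstep1 ?mul0r//; lra.
- move=> x Mx; apply: step0; rewrite -sqr_enorm.
  by have := enorm_ge0 x; nra.
Qed.

Lemma enorm_supp_compact (M : R) : exists K : set V, compact K /\ forall x, ~ K x -> M < enorm x.
Proof.
exists (cbox (const_mx (- M)) (const_mx M)); split; first exact: cbox_compact.
move=> x; rewrite ltNge => xK; apply/negP => xM; apply: xK => i; rewrite !mxE.
by rewrite -ler_norml (le_trans (enorm_coord x i)).
Qed.

End Euclidean.

(** * Perimeter of complements, of null modifications and of cuts *)

Section Perimeter.
Context {R : realType} {n : nat}.
Local Notation V := 'rV[R]_n.
Local Notation T := (g_sigma_algebraType (@open V)).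
Context (mu : {measure set T -> \bar R}) (Hmu : is_lebesgue mu).
Implicit Types (phi : V -> V) (E F : set V).

Definition field1 (U : set V) : set (V -> V) :=
  [set phi | C1c_field phi /\ (forall x, enorm (phi x) <= 1) /\ (forall x, ~ U x -> phi x = 0)].

Lemma C1c_fieldP phi : C1c_field phi <->
  (forall i, C1 (Defs.comp phi i)) /\ exists K, compact K /\ forall x, ~ K x -> phi x = 0.
Proof.
split=> [[d [c K]]|[C K]].
  by split => [i|//]; split => [j x|j]; [exact: d|exact: c].
by split; [move=> i j x; have [d _] := C i; exact: d|split => // i j; have [_ c] := C i; exact: c].
Qed.

Lemma div_continuous phi : C1c_field phi -> continuous (Defs.div phi).
Proof.
move=> [_ [c _]].
rewrite (_ : Defs.div phi = fun x => \sum_(i <- index_enum 'I_n) 'D_(evec R i) (Defs.comp phi i) x)//.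
elim: (index_enum _) => [|i r IH].
  rewrite (_ : (fun x => _) = cst 0); first exact: cst_continuous.
  by apply/funext => x; rewrite big_nil.
rewrite (_ : (fun x => _) = (fun x => 'D_(evec R i) (Defs.comp phi i) x +
    \sum_(i <- r) 'D_(evec R i) (Defs.comp phi i) x)).
  exact: (@normed_continuousD _ 'rV[R]_n _ _ (c i i) IH).
by apply/funext => x; rewrite big_cons.
Qed.

Lemma div_supp phi : C1c_field phi -> exists K, compact K /\ forall x, ~ K x -> Defs.div phi x = 0.
Proof.
move=> [_ [_ [K [cK phiK]]]]; exists K; split => // x Kx.
rewrite /Defs.div big1// => i _; apply: (derive_out_compact _ cK) => // y Ky.
by rewrite /Defs.comp phiK// mxE.
Qed.

Lemma div_measurable phi : C1c_field phi -> measurable_fun setT (Defs.div phi : T -> R).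
Proof. by move=> Cphi; apply: continuous_measurableV; exact: div_continuous. Qed.

Lemma div_integrable phi (E : set T) : C1c_field phi -> measurable E ->
  mu.-integrable E (EFin \o (Defs.div phi : T -> R)).
Proof.
move=> Cphi mE; have [K [cK h]] := div_supp Cphi.
exact: (supp_integrable Hmu (div_continuous Cphi) cK h).
Qed.

Lemma integral_div_eq0 phi : C1c_field phi -> (\int[mu]_x (Defs.div phi x)%:E = 0)%E.
Proof.
move=> Cphi; have [C [K [cK phiK]]] := (C1c_fieldP phi).1 Cphi.
have phiK' i x : ~ K x -> Defs.comp phi i x = 0 by move=> /phiK h; rewrite /Defs.comp h mxE.
under eq_integral do rewrite /Defs.div -sumEFin.
have int_i i : mu.-integrable setT (fun x : T => ('D_(evec R i) (Defs.comp phi i) x)%:E).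
  have [_ c] := C i.
  exact: (supp_integrable Hmu (c i) cK (fun x => derive_out_compact _ cK (phiK' i) (x := x)) measurableT).
rewrite integral_sum//; apply: big1 => i _.
have := integral_partial_eq0 Hmu i (C i) cK (phiK' i); rewrite /Rintegral => h.
by rewrite -[LHS]fineK ?h//; apply: integrable_fin_num.
Qed.

Lemma div0 : Defs.div (cst 0 : V -> V) = cst 0.
Proof.
apply/funext => x; rewrite /Defs.div big1// => i _.
rewrite (_ : Defs.comp _ i = cst 0) ?derive_cst//.
by apply/funext => y; rewrite /Defs.comp mxE.
Qed.

Lemma field1_0 U : field1 U (cst 0).
Proof.
split; last by split => [x|//]; rewrite enorm0.
apply/C1c_fieldP; split; last by exists set0; split => //; exact: compact0.
move=> i; rewrite (_ : Defs.comp _ i = cst 0); first exact: C1_cst.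
by apply/funext => y; rewrite /Defs.comp mxE.
Qed.

Lemma field1N U phi : field1 U phi -> field1 U (fun x => - phi x) /\
  Defs.div (fun x => - phi x) = fun x => - Defs.div phi x.
Proof.
move=> [Cphi [p1 pU]]; have [C [K [cK phiK]]] := (C1c_fieldP phi).1 Cphi.
have E i : Defs.comp (fun x => - phi x) i = - (Defs.comp phi i).
  by apply/funext => x; rewrite /Defs.comp !mxE.
split.
  split; last by split => x; [rewrite enormN|move=> /pU ->; rewrite oppr0].
  apply/C1c_fieldP; split; last by exists K; split => // x /phiK ->; rewrite oppr0.
  move=> i; rewrite E (_ : - _ = cst (-1) \* Defs.comp phi i).
    by apply: C1M => //; exact: C1_cst.
  by apply/funext => x /=; rewrite mulN1r.
apply/funext => x; rewrite /Defs.div -sumrN; apply: eq_bigr => i _.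
by rewrite E deriveN//; have [] := C i.
Qed.

Lemma perimeter_ub E phi : field1 setT phi -> (\int[mu]_(x in (E : set T)) (Defs.div phi x)%:E <= perimeter mu E)%E.
Proof. by move=> fp; apply: ereal_sup_ubound; exists phi. Qed.

Lemma perimeter_in_ub U E phi : field1 U phi -> (\int[mu]_(x in (E : set T)) (Defs.div phi x)%:E <= perimeter_in mu U E)%E.
Proof. by move=> fp; apply: ereal_sup_ubound; exists phi. Qed.

Lemma perimeter_le E (c : \bar R) :
  (forall phi, field1 setT phi -> \int[mu]_(x in (E : set T)) (Defs.div phi x)%:E <= c)%E ->
  (perimeter mu E <= c)%E.
Proof. by move=> h; apply: ge_ereal_sup => _ [phi fp <-]; exact: h. Qed.

Lemma perimeter_ge0 E : (0 <= perimeter mu E)%E.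
Proof.
apply: le_trans (perimeter_ub E (field1_0 setT)).
by rewrite div0 integral0_eq.
Qed.

Lemma perimeter_in_le U E : (perimeter_in mu U E <= perimeter mu E)%E.
Proof.
apply: ge_ereal_sup => _ [phi [Cp [p1 pU]] <-]; apply: perimeter_ub.
by split => //; split => // x; case.
Qed.


Definition divI phi E : R := \int[mu]_(x in (E : set T)) Defs.div phi x.

Lemma divIE phi (E : set T) : measurable E -> C1c_field phi ->
  (\int[mu]_(x in E) (Defs.div phi x)%:E = (divI phi E)%:E)%E.
Proof.
move=> mE Cphi; rewrite /divI /Rintegral fineK//.
by apply: integrable_fin_num => //; exact: div_integrable.
Qed.

Lemma divIC phi (E : set T) : measurable E -> C1c_field phi ->
  divI phi (~` E) = - divI phi E.
Proof.
move=> mE Cphi; apply/eqP; rewrite -addr_eq0 addrC; apply/eqP.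
rewrite /divI -Rintegral_setU ?setUv//; [|exact: measurableC|exact: div_integrable|].
  by rewrite /Rintegral integral_div_eq0.
by apply/disj_setPS; rewrite setICr.
Qed.

(** The integral of a divergence over the whole space is zero, so passing to the complement flips
    the sign of the flux, and replacing [phi] by its opposite flips it back. *)
Lemma perimeter_inC (U : set V) (E : set T) : measurable E ->
  perimeter_in mu U (~` E) = perimeter_in mu U E.
Proof.
have le (F : set T) : measurable F -> (perimeter_in mu U (~` F) <= perimeter_in mu U F)%E.
  move=> mF; apply: ge_ereal_sup => _ [phi fp <-]; have [Cphi _] := fp.
  have [fN dN] := field1N fp; have [CN _] := fN.
  apply: le_trans (perimeter_in_ub F fN).
  rewrite (divIE (measurableC mF) Cphi) (divIE mF CN) lee_fin (divIC mF Cphi) /divI dN.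
  by rewrite -[X in _ <= X]mul1r -mulrN1 mulrC -RintegralZl//; [under eq_Rintegral do rewrite mulN1r; rewrite mul1r|exact: div_integrable].
move=> mE; apply/eqP; rewrite eq_le le//=.
by rewrite -[X in (perimeter_in mu U X <= _)%E]setCK le//; exact: measurableC.
Qed.

Lemma integral_ae_set (E F : set T) (f : T -> \bar R) : measurable E -> measurable F ->
  mu (E `+` F) = 0%E ->
  mu.-integrable E f -> mu.-integrable F f -> (\int[mu]_(x in E) f x = \int[mu]_(x in F) f x)%E.
Proof.
move=> mE mF EF0 iE iF; have mY : measurable (E `+` F).
  by apply: measurableU; exact: measurableD.
rewrite (negligible_integral mY mE iE EF0) (negligible_integral mY mF iF EF0).
by congr (integral _ _ _); apply/seteqP; split => x [Ex nY]; split => //;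
  apply: contrapT => nF; apply: nY; [left|right].
Qed.

Lemma perimeter_in_ae (U : set V) (E F : set T) : measurable E -> measurable F ->
  mu (E `+` F) = 0%E -> perimeter_in mu U E = perimeter_in mu U F.
Proof.
move=> mE mF EF0; rewrite /perimeter_in; congr ereal_sup.
apply/seteqP; split => _ [phi fp <-]; exists phi => //; have [Cphi _] := fp;
  apply/esym; apply: integral_ae_set => //; try exact: div_integrable.
by rewrite setYC.
Qed.

Lemma C1_is_derive f (j : 'I_n) (x : V) : C1 f -> is_derive x (evec R j) f ('D_(evec R j) f x).
Proof. by move=> [d _]; apply: derivableP. Qed.

Lemma dominated_by_div (g : nat -> V -> R) (h : T -> R) phi (E : set T) : measurable E ->
  C1c_field phi -> (forall k, measurable_fun setT (g k : T -> R)) ->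
  measurable_fun setT h -> (forall k x, `|g k x| <= 1) ->
  (forall x, \forall k \near \oo, g k x = h x) ->
  (\int[mu]_(x in E) (g k x * Defs.div phi x)%:E @[k --> \oo] -->
   \int[mu]_(x in E) (h x * Defs.div phi x)%:E)%E.
Proof.
move=> mE Cphi mg mh g1 gh; have mdiv := div_measurable Cphi.
have [] := @dominated_convergence _ _ _ mu E mE
  (fun k x => (g k x * Defs.div phi x)%:E) (fun x => (h x * Defs.div phi x)%:E)
  (fun x => `|Defs.div phi x|%:E) => //.
- by move=> k; apply/measurable_EFinP/measurable_funM; exact: measurable_funTS.
- by apply/measurable_EFinP/measurable_funM; exact: measurable_funTS.
- apply: aeW => x _; apply: cvg_near_cst; near=> k.
  by congr (_ * _)%:E; near: k; exact: gh.
- exact: (integrable_norm (div_integrable Cphi mE)).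
- by apply: aeW => x k _; rewrite lee_fin normrM ler_piMl.
Unshelve. all: end_near. Qed.

Definition halfspace (nu : V) (t : R) : set V := [set x | dot x nu <= t].

Lemma halfspace_closed nu t : closed (halfspace nu t).
Proof.
rewrite -[halfspace nu t]/((fun x : V => dot x nu) @^-1` [set y | y <= t]).
by apply: closed_comp => [x _|]; [exact: (C1_continuous (C1_dot nu).1)|exact: closed_le].
Qed.

(* Interpolating between the test field and the unit normal of the half-space loses nothing:
   the extra divergence term [eta' (1 - phi . nu)] has a sign. *)
Lemma perimeter_cut (E : set T) nu t : measurable E -> Defs.bounded_set E -> enorm nu = 1 ->
  (perimeter mu (E `&` halfspace nu t) <= perimeter mu E)%E.
Proof.
move=> mE [M0 EM0] nu1; set H := halfspace nu t.
pose M : R := `|M0|; have M_ge0 : 0 <= M by exact: normr_ge0.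
have EM x : E x -> enorm x <= M by move=> /EM0/le_trans; apply; exact: ler_norm.
have [C1dot Ddot] := C1_dot nu.
have mH : @measurable _ T H.
  by apply: closed_measurableV; exact: halfspace_closed.
apply: perimeter_le => phi fp; have [Cphi [p1 _]] := fp.
have [C [K [cK phiK]]] := (C1c_fieldP phi).1 Cphi.
have [chi [C1chi chi01 chi1 chi0]] := @cutoff_exists R n M M_ge0.
(* Composed with [step], this is 1 on the half-space and 0 at distance 1/k or more beyond it, for k
   > 0. *)
pose arg k x : R := 1 - k%:R * (dot x nu - t).
have C1arg k : C1 (arg k) /\ forall j x, 'D_(evec R j) (arg k) x = - k%:R * nu ord0 j.
  have E1 : arg k = cst (1 + k%:R * t) \+ (cst (- k%:R) \* (fun x => dot x nu)).
    by apply/funext => x /=; rewrite /arg; ring.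
  split; first by rewrite E1; apply: C1D; [exact: C1_cst|apply: C1M => //; exact: C1_cst].
  move=> j x; have d1 := C1_is_derive j x C1dot.
  have [_] := is_deriveD (is_derive_cst (1 + k%:R * t : R) x (evec R j)) (is_deriveM (is_derive_cst (- k%:R : R) x (evec R j)) d1).
  by rewrite E1 => h; apply: (etrans h); rewrite Ddot /GRing.scale/=; ring.
pose eta k : V -> R := @step R \o arg k.
have C1eta k := C1_comp (C1arg k).1 (@is_derive_step R) dstep_continuous.
have eta01 k x : 0 <= eta k x <= 1 by exact: step_itv.
(* The field passes from [phi] inside the half-space to the constant [nu] outside. A constant field
   has no compact support, whence the factor [chi], invisible on the bounded set E. *)
pose psi k x := chi x *: (eta k x *: phi x + (1 - eta k x) *: nu).
have compE k i : Defs.comp (psi k) i = chi \* ((eta k \* Defs.comp phi i) \+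
    ((cst 1 \+ (cst (-1) \* eta k)) \* cst (nu ord0 i))).
  by apply/funext => x; rewrite /Defs.comp /psi !mxE /=; congr (_ * (_ + _)); ring.
have fpsi k : field1 setT (psi k).
  split; last split => [x|x]; last by case.
    apply/C1c_fieldP; split=> [i|].
      rewrite compE; apply: C1M => //; apply: C1D; first exact: C1M (C1eta k).1 (C i).
      by apply: C1M; [apply: C1D; [exact: C1_cst|apply: C1M; [exact: C1_cst|exact: (C1eta k).1]]|exact: C1_cst].
    have [K' [cK' K'P]] := @enorm_supp_compact R n (M + 2).
    by exists K'; split => // x /K'P/ltW Mx; rewrite /psi chi0// scale0r.
  have /andP[c0 c1] := chi01 x; have /andP[e0 e1] := eta01 k x.
  rewrite /psi enormZ ger0_norm//.
  apply: (@le_trans _ _ (1 * 1)); last by rewrite mulr1.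
  apply: ler_pM => //; first exact: enorm_ge0.
  apply: le_trans (enormD _ _) _; rewrite !enormZ nu1 mulr1 !ger0_norm ?subr_ge0//.
  have := p1 x; have := enorm_ge0 (phi x); nra.
have divpsi k x : E x -> eta k x * Defs.div phi x <= Defs.div (psi k) x.
  move=> Ex; have [cx1 dcx] := chi1 x (EM x Ex).
  have Di i : 'D_(evec R i) (Defs.comp (psi k) i) x =
     eta k x * 'D_(evec R i) (Defs.comp phi i) x
     + k%:R * dstep (arg k x) * (nu ord0 i * nu ord0 i - phi x ord0 i * nu ord0 i).
    have d0 : is_derive x (evec R i) chi 0 by rewrite -(dcx i); exact: C1_is_derive.
    have d1 := C1_is_derive i x (C1eta k).1.
    have d2 := C1_is_derive i x (C i).
    have dc c := is_derive_cst (c : R) x (evec R i).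
    have [_] := is_deriveM d0 (is_deriveD (is_deriveM d1 d2)
      (is_deriveM (is_deriveD (dc 1) (is_deriveM (dc (-1)) d1)) (dc (nu ord0 i)))).
    rewrite compE => h; apply: (etrans h); rewrite (C1eta k).2 (C1arg k).2 cx1 /GRing.scale/= -[Defs.comp phi i x]/(phi x ord0 i).
    rewrite !(mulr0, addr0, add0r, mul1r) -[step (arg k x)]/(eta k x); ring.
  rewrite /Defs.div (eq_bigr _ (fun i _ => Di i)) big_split/= -!mulr_sumr lerDl mulr_ge0//.
    by rewrite mulr_ge0// dstep_ge0.
  rewrite big_split/= sumrN subr_ge0 -/(dot (phi x) nu) -/(dot nu nu) dotxx -sqr_enorm nu1 expr1n.
  by apply: dot_le1; rewrite ?nu1.
have meta k : measurable_fun setT (eta k : T -> R).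
  by apply: continuous_measurableV; apply: C1_continuous; exact: (C1eta k).1.
have mindic : measurable_fun setT (\1_H : T -> R) by exact: measurable_indic.
(* At each point [eta k] is eventually equal to the indicator of H, including on the boundary of H
   since H is closed. *)
have cv : (\int[mu]_(x in E) (eta k x * Defs.div phi x)%:E @[k --> \oo] -->
   \int[mu]_(x in E) (\1_H x * Defs.div phi x)%:E)%E.
  apply: dominated_by_div => // [k x|x].
    by have /andP[h1 h2] := eta01 k x; rewrite ger0_norm.
  have [Hx|Hx] := pselect (H x).
    near=> k; rewrite indicE mem_set//; apply: step1.
    by rewrite /arg lerDl oppr_ge0 mulr_ge0_le0// subr_le0.
  have Hx' : 0 < dot x nu - t by rewrite subr_gt0 ltNge; apply/negP.
  near=> k; rewrite indicE memNset//; apply: step0.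
  rewrite /arg subr_le0 -ler_pdivrMr// mul1r ltW//.
  by near: k; exact: nbhs_infty_gtr.
have -> : (\int[mu]_(x in E `&` H) (Defs.div phi x)%:E =
    \int[mu]_(x in E) (\1_H x * Defs.div phi x)%:E)%E.
  rewrite integral_mkcondr; apply: eq_integral => x _.
  by rewrite patchE indicE; case: (x \in H); rewrite ?mul1r ?mul0r.
rewrite -(cvg_lim _ cv)//; apply: lime_le; first by apply/cvg_ex; eexists; exact: cv.
near=> k; apply: le_trans (perimeter_ub E (fpsi k)).
apply: le_integral => //.
- apply: le_integrable (div_integrable Cphi mE) => //.
    by apply/measurable_EFinP/measurable_funM; apply: measurable_funTS => //; exact: div_measurable.
  move=> x _; rewrite lee_fin normrM ler_piMl//.
  by have /andP[h1 h2] := eta01 k x; rewrite ger0_norm.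
- by apply: div_integrable => //; case: (fpsi k).
- by move=> x /set_mem Ex; rewrite lee_fin; exact: divpsi.
Unshelve. all: end_near. Qed.

(** Multiplying a test field by a cutoff equal to 1 on E confines it to a ball without changing its
    flux, so the local perimeter in that ball bounds the global one. *)
Lemma perimeter_lty (E : set T) : Defs.bounded_set E -> loc_finite_perimeter mu E ->
  (perimeter mu E < +oo)%E.
Proof.
move=> [M0 EM0] [mE Efin]; pose M : R := `|M0|; have M_ge0 : 0 <= M by exact: normr_ge0.
have EM x : E x -> enorm x <= M by move=> /EM0/le_trans; apply; exact: ler_norm.
apply: le_lt_trans (Efin (M + 2) _); last by rewrite ltr_wpDl.
apply: perimeter_le => phi fp; have [Cphi [p1 _]] := fp.
have [C [K [cK phiK]]] := (C1c_fieldP phi).1 Cphi.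
have [chi [C1chi chi01 chi1 chi0]] := @cutoff_exists R n M M_ge0.
pose psi x := chi x *: phi x.
have compE i : Defs.comp psi i = chi \* Defs.comp phi i.
  by apply/funext => x; rewrite /Defs.comp /psi !mxE.
have fpsi : field1 (eball 0 (M + 2)) psi.
  split; last split => [x|x].
  - apply/C1c_fieldP; split=> [i|]; first by rewrite compE; exact: C1M.
    by exists K; split => // x /phiK; rewrite /psi => ->; rewrite scaler0.
  - have /andP[c0 c1] := chi01 x; rewrite /psi enormZ ger0_norm// mulr_ile1//.
    exact: enorm_ge0.
  - move=> h; rewrite /psi chi0 ?scale0r// leNgt; apply/negP => xM; apply: h.
    by rewrite /eball/= edist0.
apply: le_trans (perimeter_in_ub E fpsi).
rewrite le_eqVlt; apply/orP; left; apply/eqP; apply: eq_integral => x /set_mem Ex.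
have [cx1 dcx] := chi1 x (EM x Ex).
congr EFin; apply: eq_bigr => i _; rewrite compE.
have d0 : is_derive x (evec R i) chi 0 by rewrite -(dcx i); exact: C1_is_derive.
have [_] := is_deriveM d0 (C1_is_derive i x (C i)) => h.
by apply/esym/(etrans h); rewrite cx1 scaler0 addr0 scale1r.
Qed.

End Perimeter.

(** * Translation estimate *)

Section Approximation.
Context {R : realType} {n : nat}.
Local Notation V := 'rV[R]_n.
Local Notation T := (g_sigma_algebraType (@open V)).
Context (mu : {measure set T -> \bar R}).

Definition L1gap (Q F : set T) (g : V -> R) : \bar R :=
  \int[mu]_(x in Q) (`|\1_F x - g x|)%:E.

Lemma L1gap_measurable (Q F : set T) g : measurable F -> C1 g ->
  measurable_fun Q (fun x : T => (`|\1_F x - g x|)%:E).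
Proof.
move=> mF Cg; apply: measurable_funTS; apply/measurable_EFinP.
apply: measurableT_comp => //; apply: measurable_funB; first exact: measurable_indic.
by apply: continuous_measurableV; exact: C1_continuous.
Qed.

(** Values in [0, 1] keep the class stable under the union formula below, and later allow the
    approximant to serve as a coefficient of a test field of norm at most 1. *)
Definition C1_approximable (Q : set T) (F : set V) : Prop := @measurable _ T F /\
  forall eps : R, 0 < eps -> exists g : V -> R, [/\ C1 g, forall x, 0 <= g x <= 1 &
    (L1gap Q F g <= eps%:E)%E].

Lemma C1_approximableC Q F : C1_approximable Q F -> C1_approximable Q (~` F).
Proof.
move=> [mF aF]; split=> [|eps e0]; first exact: measurableC.
have [g [Cg g01 gF]] := aF eps e0; exists (cst 1 \+ (cst (-1) \* g)); split.
- by apply: C1D; [exact: C1_cst|apply: C1M => //; exact: C1_cst].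
- by move=> x /=; have /andP[h1 h2] := g01 x; apply/andP; split; lra.
- rewrite (_ : L1gap _ _ _ = L1gap Q F g)//; apply: eq_integral => x _; congr EFin.
  by rewrite !indicE in_setC /= -normrN; congr (`| _ |); case: (x \in F) => /=; ring.
Qed.

Lemma C1_approximableU (Q : set T) A B : measurable Q -> C1_approximable Q A -> C1_approximable Q B ->
  C1_approximable Q (A `|` B).
Proof.
move=> mQ [mA aA] [mB aB]; split=> [|eps e0]; first exact: measurableU.
have e20 : 0 < eps / 2 by rewrite divr_gt0.
have [g [Cg g01 gF]] := aA _ e20; have [h [Ch h01 hF]] := aB _ e20.
(* This is 1 - (1 - g)(1 - h), the smooth counterpart of a union; its error is pointwise at most the
   sum of the two errors. *)
exists (g \+ (h \+ (cst (-1) \* (g \* h)))).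
have C1k : C1 (g \+ (h \+ (cst (-1) \* (g \* h)))).
  by apply: C1D => //; apply: C1D => //; apply: C1M; [exact: C1_cst|exact: C1M].
split => //.
- move=> x /=; have /andP[g0 g1] := g01 x; have /andP[h0 h1] := h01 x.
  by apply/andP; split; nra.
- apply: (@le_trans _ _ (L1gap Q A g + L1gap Q B h)%E); last first.
    by apply: le_trans (leeD gF hF) _; rewrite -EFinD lee_fin; lra.
  rewrite /L1gap -ge0_integralD//; try (by move=> x _; rewrite lee_fin); try exact: L1gap_measurable.
  apply: ge0_le_integral => //; try (by move=> x _; rewrite ?adde_ge0 ?lee_fin).
  + by apply: L1gap_measurable => //; exact: measurableU.
  + by apply: emeasurable_funD; exact: L1gap_measurable.
  + move=> x _; rewrite -EFinD lee_fin !indicE in_setU /=.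
    have /andP[g0 g1] := g01 x; have /andP[h0 h1] := h01 x.
    have D (u v : R) : 0 <= u <= 1 -> 0 <= v <= 1 -> `|u| = u /\ `|1 - v| = 1 - v.
      by move=> /andP[? ?] /andP[? ?]; split; apply: ger0_norm => //; lra.
    have [ng n1g] := D _ _ (g01 x) (g01 x); have [nh n1h] := D _ _ (h01 x) (h01 x).
    case: (x \in A); case: (x \in B) => /=; rewrite ?sub0r ?normrN ?ng ?n1g ?nh ?n1h ler_norml;
      apply/andP; split; nra.
Qed.

Lemma bounded_cvg0 (Q : set T) (u : nat -> T -> R) : measurable Q -> (mu Q < +oo)%E ->
  (forall k, measurable_fun setT (u k)) -> (forall k x, `|u k x| <= 1) ->
  (forall x, \forall k \near \oo, u k x = 0) ->
  (\int[mu]_(x in Q) (`|u k x|)%:E @[k --> \oo] --> 0)%E.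
Proof.
move=> mQ Qfin mu_ u1 u0.
have [] := @dominated_convergence _ _ _ mu Q mQ
  (fun k x => (`|u k x|)%:E) (cst 0%E) (fun x => 1%:E) => //.
- by move=> k; apply/measurable_EFinP/measurableT_comp => //; exact: measurable_funTS.
- apply: aeW => x _; apply: cvg_near_cst; near=> k.
  by rewrite (_ : u k x = 0) ?normr0//; near: k; exact: u0.
- apply: (@measurable_bounded_integrable _ _ _ mu (cst 1)) => //; exact: bounded_cst.
- by apply: aeW => x k _; rewrite lee_fin normr_id.
- by move=> _ _; rewrite integral0.
Unshelve. all: end_near. Qed.

Lemma cvg0_small (u : nat -> \bar R) (eps : R) : (u k @[k --> \oo] --> 0)%E -> 0 < eps ->
  exists k, (u k <= eps%:E)%E.
Proof.
move=> cu e0; have : \forall k \near \oo, (u k < eps%:E)%E.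
  apply: (cu [set y | (y < eps%:E)%E]); apply/nbhs_EFin.
  by near=> r; rewrite /= lte_fin; near: r; exact: lt_nbhsl.
by case=> k _ /(_ k (leqnn k)) /ltW; exists k.
Unshelve. all: end_near. Qed.

(** The approximable sets form a sigma-algebra containing the coordinate half-spaces, so [borel_ind]
    yields all Borel sets. This takes the place of regularity of the measure and mollification. *)
Lemma C1_approx_indic (Q : set T) F : measurable Q -> (mu Q < +oo)%E ->
  @measurable _ T F -> C1_approximable Q F.
Proof.
move=> mQ Qfin; move: F; apply: borel_ind; first split.
- split=> [|eps e0]; first exact: measurable0.
  exists (cst 0); split => //; [exact: C1_cst|by move=> x; rewrite lexx ler01|].
  rewrite /L1gap integral0_eq ?lee_fin ?ltW// => x _.
  by rewrite indic0 subrr normr0.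
- by move=> A aA; rewrite setTD; exact: C1_approximableC.
- move=> A aA; have mA k : @measurable _ T (A k) by have [] := aA k.
  have mU : @measurable _ T (\bigcup_k A k) by exact: bigcup_measurable.
  split=> // eps e0; have e20 : 0 < eps / 2 by rewrite divr_gt0.
  (* The part of the countable union missed by its first K members; its measure tends to 0 because Q
     has finite measure. *)
  pose B K := Q `&` ((\bigcup_k A k) `\` \big[setU/set0]_(k < K) A k).
  have mUK K : @measurable _ T (\big[setU/set0]_(k < K) A k) by exact: bigsetU_measurable.
  have mB K : @measurable _ T (B K) by apply: measurableI => //; exact: measurableD.
  have aK K : C1_approximable Q (\big[setU/set0]_(k < K) A k).
    elim: K => [|K IH]; last by rewrite big_ord_recr/=; exact: C1_approximableU.
    rewrite big_ord0; split=> [|e e'0]; first exact: measurable0.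
    exists (cst 0); split => //; [exact: C1_cst|by move=> x; rewrite lexx ler01|].
    rewrite /L1gap integral0_eq ?lee_fin ?ltW// => x _.
    by rewrite indic0 subrr normr0.
  have cB : (mu (B K) @[K --> \oo] --> 0)%E.
    have -> : 0%E = mu (\bigcap_K B K).
      rewrite (_ : \bigcap_K B K = set0) ?measure0//.
      apply/seteqP; split => // x Bx; have [_ [[k _ Akx] _]] := Bx 0%N I.
      have [_ [_]] := Bx k.+1 I; apply; rewrite -bigcup_mkord.
      by exists k => /=.
    apply: nonincreasing_cvg_mu => //.
    - by apply: le_lt_trans Qfin; apply: le_measure; rewrite ?inE//; exact: subIsetl.
    - by apply: bigcapT_measurable.
    - move=> k l kl; apply/subsetPset => x [Qx [Ux nx]]; split => //; split => // h; apply: nx.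
      by move: h; rewrite -!bigcup_mkord => -[j /= jk Ajx]; exists j => //=; exact: leq_trans jk kl.
  have [K KB] := cvg0_small cB e20.
  have [g [Cg g01 gK]] := (aK K).2 _ e20.
  exists g; split => //.
  apply: (@le_trans _ _ (L1gap Q (\big[setU/set0]_(k < K) A k) g + mu (B K))%E); last first.
    by apply: le_trans (leeD gK KB) _; rewrite -EFinD lee_fin; lra.
  have mr : measurable_fun Q ((cst 1%E) \_ (\bigcup_k A k `\` \big[setU/set0]_(k < K) A k) : T -> \bar R).
    by apply/(measurable_restrict _ (measurableD mU (mUK K)) mQ); exact: measurable_cst.
  rewrite -[mu (B K)]mul1e -(integral_cst mu (mB K) 1) /B integral_mkcondr -ge0_integralD//.
  + apply: ge0_le_integral => //; try exact: L1gap_measurable.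
    * apply: emeasurable_funD; first exact: L1gap_measurable.
      exact: mr.
    * move=> x _; rewrite patchE /= !indicE in_setD.
      case: (boolP (x \in \big[setU/set0]_(k < K) A k)) => xK /=.
        have -> : x \in \bigcup_k A k.
          by move: xK; rewrite !inE -bigcup_mkord => -[k _ Akx]; exists k.
        by rewrite adde0.
      case: (x \in \bigcup_k A k) => /=; last by rewrite adde0.
      rewrite -EFinD lee_fin sub0r normrN; have /andP[g0 g1] := g01 x.
      by rewrite !ger0_norm ?subr_ge0//; lra.
  + exact: L1gap_measurable.
  + by move=> x _; rewrite patchE; case: ifP.
- move=> i a; split=> [|eps e0]; first exact: half_measurable.
  (* Steps of slope of order k, vanishing for [x ord0 i <= a] and eventually equal to 1 at each
     point of the open half-space. *)
  pose arg k (x : V) : R := k%:R * (x ord0 i - a).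
  have C1arg k : C1 (arg k).
    rewrite (_ : arg k = (cst k%:R) \* ((fun x : V => x ord0 i) \+ cst (- a)))//.
    by apply: C1M; [exact: C1_cst|apply: C1D; [exact: C1_coord|exact: C1_cst]].
  pose g k : V -> R := @step R \o arg k.
  have Cg k : C1 (g k) := (C1_comp (C1arg k) (@is_derive_step R) dstep_continuous).1.
  have g01 k x : 0 <= g k x <= 1 by exact: step_itv.
  pose H := [set x : V | a < x ord0 i].
  suff cv : (L1gap Q H (g k) @[k --> \oo] --> 0)%E.
    by have [k gk] := cvg0_small cv e0; exists (g k); split.
  apply: (@bounded_cvg0 Q (fun k x => \1_H x - g k x)) => //.
  + move=> k; apply: measurable_funB; first by apply: measurable_indic; exact: half_measurable.
    by apply: continuous_measurableV; exact: C1_continuous.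
  + move=> k x; rewrite indicE; have /andP[h1 h2] := g01 k x.
    by rewrite ler_norml; case: (_ \in _) => /=; apply/andP; split; lra.
  + move=> x; rewrite indicE; have [ax|xa] := ltP a (x ord0 i).
      near=> k; rewrite mem_set//= [g k x]step1 ?subrr// /arg.
      rewrite -ler_pdivrMr ?subr_gt0// div1r ltW//.
      by near: k; exact: nbhs_infty_gtr.
    near=> k; rewrite memNset/=; last by apply/negP; rewrite -leNgt.
    by rewrite [g k x]step0 ?subrr// /arg mulr_ge0_le0// subr_le0.
Unshelve. all: end_near. Qed.

End Approximation.

Lemma normed_continuous_add {R : realType} {M : normedModType R} (h : M) :
  continuous (fun x : M => x + h).
Proof. by move=> x; apply: cvgD; [exact: cvg_id|exact: cvg_cst]. Qed.

(** * Perimeter controls the measure displaced by a translation *)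

Section TranslationEstimate.
Context {R : realType} {n : nat}.
Local Notation V := 'rV[R]_n.
Local Notation T := (g_sigma_algebraType (@open V)).
Context (mu : {measure set T -> \bar R}) (Hmu : is_lebesgue mu).

Lemma bounded_derive_lipschitz (m dm : R -> R) C a b : (forall s : R, is_derive s 1 m (dm s)) ->
  (forall s, `|dm s| <= C) -> `|m a - m b| <= C * `|a - b|.
Proof.
move=> dmP dmC; have cm u v : {within `[u, v], continuous m}.
  by apply: derivable_within_continuous => s _; apply: ex_derive.
wlog ab : a b / b <= a.
  by move=> H; have [/H//|/ltW/H] := leP b a; rewrite distrC (distrC a).
have [c _ ->] := MVT_segment ab (fun s _ => dmP s) (cm _ _).
by rewrite normrM ler_wpM2r.
Qed.

Lemma mu_fin_num (F : set T) M : measurable F -> (forall x : V, F x -> `|x| <= M) -> mu F \is a fin_num.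
Proof. by move=> mF FM; rewrite ge0_fin_numE//; exact: (mu_bounded_lty Hmu mF FM). Qed.

Lemma translate_measurable (F : set T) (h : V) : measurable F -> @measurable _ T (translate h @^-1` F).
Proof. by move=> mF; rewrite -[X in measurable X]setTI; exact: measurable_translate. Qed.

Lemma bounded_set_norm (E : set V) : Defs.bounded_set E -> exists M : R, forall x, E x -> `|x| <= M.
Proof. by move=> [M EM]; exists M => x /EM; apply: le_trans; exact: norm_le_enorm. Qed.

Lemma test_fieldM (f : V -> R) K i : C1 f -> compact K -> (forall x, ~ K x -> f x = 0) ->
  (forall x, `|f x| <= 1) ->
  field1 setT (fun x => f x *: evec R i) /\
  Defs.div (fun x => f x *: evec R i) = 'D_(evec R i) f.
Proof.
move=> Cf cK fK f1.
have compE j : Defs.comp (fun x => f x *: evec R i) j = f \* cst (i == j)%:R.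
  by apply/funext => x; rewrite /Defs.comp mxE evecE eq_sym.
split.
  split; last split => [x|x]; last by case.
    apply/C1c_fieldP; split=> [j|]; first by rewrite compE; apply: C1M => //; exact: C1_cst.
    by exists K; split => // x /fK ->; rewrite scale0r.
  rewrite enormZ mulr_ile1 ?enorm_ge0//.
  rewrite enorm_le// expr1n /sqnorm (bigD1 i)//= evecE eqxx expr1n big1 ?addr0// => j ji.
  by rewrite evecE (negbTE ji) expr0n.
apply/funext => x; rewrite /Defs.div (bigD1 i)//= [X in _ + X]big1 => [|j ji]; last first.
  rewrite compE eq_sym (negbTE ji) (_ : f \* _ = cst 0) ?derive_cst//.
  by apply/funext => y /=; rewrite mulr0.
rewrite addr0 compE eqxx; congr ('D__ _ _); by apply/funext => y /=; rewrite mulr1.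
Qed.

Lemma divI_abs_le (E : set T) (p : R) phi : measurable E -> (perimeter mu E <= p%:E)%E ->
  field1 setT phi -> `|divI mu phi E| <= p.
Proof.
move=> mE Ep fp; have [fpN dpN] := field1N fp; have [Cfp _] := fp; have [CfpN _] := fpN.
have u1 := le_trans (perimeter_ub mu E fp) Ep; rewrite (divIE Hmu mE Cfp) lee_fin in u1.
have u2 := le_trans (perimeter_ub mu E fpN) Ep; rewrite (divIE Hmu mE CfpN) lee_fin in u2.
move: u2; have -> : divI mu (fun x => - phi x) E = - divI mu phi E.
  rewrite -mulN1r /divI -RintegralZl//; last exact: div_integrable.
  by apply: eq_Rintegral => x _; rewrite mulN1r dpN.
by move=> u2; rewrite ler_norml u1 andbT lerNl.
Qed.

(** Let f be a smooth approximation of the indicator of E \ (E - tau). The derivative of m(s), the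
    integral of f(x + s e_i) over E, is the flux of a test field, hence at most p in absolute value,
    so m(0) - m(-h) is at most |h| p. This difference is the integral of f over E minus that over E
    - tau; it is close to the measure of E \ (E - tau). *)
Lemma mu_setD_translate_axis (E : set T) (p h : R) i : measurable E -> Defs.bounded_set E ->
  (perimeter mu E <= p%:E)%E ->
  (mu (E `\` (translate (h *: evec R i) @^-1` E)) <= (`|h| * p)%:E)%E.
Proof.
move=> mE bE Ep; set tau := h *: evec R i; set Et := translate tau @^-1` E.
have mEt : @measurable _ T Et by exact: translate_measurable.
have [M0 EM0] := bounded_set_norm bE.
(* Large enough for E and for its translate [Et] alike. *)
pose M : R := `|M0| + `|tau|.
have M_ge0 : 0 <= M by rewrite addr_ge0.
have EM (x : V) : E x -> `|x| <= M.
  by move=> /EM0/le_trans; apply; rewrite (le_trans (ler_norm _))// lerDl.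
have EtM (x : V) : Et x -> `|x| <= M.
  rewrite /Et /translate /= => /EM0 h1; rewrite -[x](addrK tau).
  by apply: le_trans (ler_normB _ _) _; rewrite lerD2r (le_trans h1)// ler_norm.
pose F := E `\` Et; have mF : @measurable _ T F by exact: measurableD.
apply/lee_addgt0Pr => eps eps0; have e20 : 0 < eps / 2 by rewrite divr_gt0.
pose Q : set T := cube (M + 1); have M1 : 0 < M + 1 by rewrite ltr_wpDl.
have mQ : measurable Q by exact: cube_measurable.
have Qfin : (mu Q < +oo)%E by rewrite mu_cube ?ltry// ltW.
have [g [Cg g01 gF]] := (C1_approx_indic mQ Qfin mF).2 _ e20.
(* The cutoff is Euclidean and M a sup-norm bound, whence the radius [n%:R * M]. *)
have [chi [Cchi chi01 chi1 chi0]] := @cutoff_exists R n (n%:R * M) (mulr_ge0 (ler0n _ _) M_ge0).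
have [K [cK KP]] := @enorm_supp_compact R n (n%:R * M + 2).
pose f := chi \* g; have Cf : C1 f by exact: C1M.
have fK x : ~ K x -> f x = 0 by move=> /KP/ltW h1; rewrite /f/= chi0// mul0r.
have f01 x : 0 <= f x <= 1.
  have /andP[c0 c1] := chi01 x; have /andP[g0 g1] := g01 x.
  by rewrite /f/= mulr_ge0//= mulr_ile1.
have fg (x : V) : `|x| <= M -> f x = g x.
  move=> xM; rewrite /f/= (chi1 x _).1 ?mul1r//.
  by apply: le_trans (enorm_le_norm x) _; rewrite ler_wpM2l.
have mf : measurable_fun setT (f : T -> R).
  by apply: continuous_measurableV; exact: C1_continuous.
have intf (D : set T) : measurable D -> mu.-integrable D (EFin \o (f : T -> R)).
  exact: (supp_integrable Hmu (C1_continuous Cf) cK fK).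
pose m (s : R) := \int[mu]_(x in E) f (x + s *: evec R i).
have dmP s := is_derive_integral_translate Hmu i s Cf cK fK mE.
have dmp s : `|\int[mu]_(x in E) 'D_(evec R i) f (x + s *: evec R i)| <= p.
  have [Cfs Dfs] := C1_translate (s *: evec R i) Cf.
  pose K' := (fun x : V => x - s *: evec R i) @` K.
  have cK' : compact K'.
    apply: continuous_compact => //; apply: continuous_subspaceT.
    exact: (@normed_continuous_add _ 'rV[R]_n).
  have fsK' x : ~ K' x -> f (x + s *: evec R i) = 0.
    by move=> h1; apply: fK => h2; apply: h1; exists (x + s *: evec R i) => //; rewrite addrK.
  have f1 x : `|f (x + s *: evec R i)| <= 1.
    by have /andP[h1 h2] := f01 (x + s *: evec R i); rewrite ger0_norm.
  have [fp dp] := test_fieldM i Cfs cK' fsK' f1.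
  have dpE : Defs.div (fun x : V => f (x + s *: evec R i) *: evec R i) =
      (fun x => 'D_(evec R i) f (x + s *: evec R i)).
    by rewrite dp; apply/funext => x; rewrite Dfs.
  by rewrite -dpE; exact: (divI_abs_le mE Ep fp).
have := bounded_derive_lipschitz 0 (- h) dmP dmp.
rewrite -/(m 0) -/(m (- h)) opprK add0r.
have -> : m 0 = \int[mu]_(x in E) f x.
  by apply: eq_Rintegral => x _; rewrite scale0r addr0.
have -> : m (- h) = \int[mu]_(x in Et) f x.
  rewrite /m /Rintegral; congr fine.
  rewrite -(@ge0_integral_translate _ _ _ Hmu tau E (fun x => (f (x + - h *: evec R i))%:E))//.
  - by apply: eq_integral => x _; rewrite /translate scaleNr addrK.
  - apply/measurable_EFinP; apply: measurable_funTS.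
    apply: continuous_measurableV.
    exact: (@normed_continuous_translate _ 'rV[R]_n _ _ (C1_continuous Cf)).
  - by move=> x _; rewrite lee_fin; have /andP[] := f01 (x + - h *: evec R i).
have mI : @measurable _ T (E `&` Et) by exact: measurableI.
have mG : @measurable _ T (Et `\` E) by exact: measurableD.
have split1 (A B : set T) : measurable A -> measurable B ->
    \int[mu]_(x in A) f x = \int[mu]_(x in A `&` B) f x + \int[mu]_(x in A `\` B) f x.
  move=> mA mB; rewrite -Rintegral_setU//.
  - by rewrite setUIDK.
  - exact: measurableI.
  - exact: measurableD.
  - by rewrite setUIDK; exact: intf.
  - by apply/disj_setPS => x [[_ Bx] [_ nBx]].
rewrite (split1 E Et)// (split1 Et E)// (setIC Et) opprD addrACA subrr add0r => lip.
have intd (D : set T) (c : R) : measurable D -> (forall x : V, D x -> `|x| <= M) ->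
    mu.-integrable D (EFin \o (fun x : T => c - f x)).
  move=> mD DM; rewrite (_ : _ \o _ = ((EFin \o cst c) \- (EFin \o (f : T -> R)))%E)//.
  apply: integrableB => //; last exact: intf.
  apply: measurable_bounded_integrable => //; first exact: (mu_bounded_lty Hmu mD DM).
  exact: bounded_cst.
(* Both errors, f away from 1 on F and away from 0 on [Et] minus E, are parts over disjoint sets of
   the single gap [gF]. *)
have gapF : \int[mu]_(x in F) `|1 - f x| + \int[mu]_(x in Et `\` E) `|f x| <= eps / 2.
  rewrite -lee_fin.
  have i1 := integrable_norm (intd F 1 mF (fun x h => EM x h.1)).
  have i2 : mu.-integrable (Et `\` E) (EFin \o (fun x : T => `|f x|)).
    by apply: integrable_norm; exact: intf.
  rewrite EFinD /Rintegral !fineK; try by apply: integrable_fin_num.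
  rewrite (eq_integral (fun x => (`|\1_F x - g x|)%:E) (D := F)); last first.
    move=> x xF; rewrite indicE xF fg//; apply: EM; by have [] := set_mem xF.
  rewrite (eq_integral (fun x => (`|\1_F x - g x|)%:E) (D := Et `\` E)); last first.
    move=> x /set_mem [Etx nEx]; rewrite indicE memNset; last by case.
    by rewrite sub0r normrN fg//; exact: EtM.
  rewrite -ge0_integral_setU//.
  - apply: le_trans gF; apply: ge0_subset_integral => //.
    + exact: measurableU.
    + exact: L1gap_measurable.
    + move=> x [[Ex _]|[Etx _]]; apply: cube_norm => //.
        by rewrite (le_lt_trans (EM _ Ex))// ltrDl.
      by rewrite (le_lt_trans (EtM _ Etx))// ltrDl.
  - exact: L1gap_measurable.
  - by apply/disj_setPS => x [[Ex _] [_ nEx]].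
have muF : (mu F)= (\int[mu]_(x in F) 1)%:E.
  rewrite Rintegral_cst// mul1r fineK//.
  exact: (mu_fin_num mF (fun x h => EM x h.1)).
rewrite muF -EFinD lee_fin.
have intF1 : mu.-integrable F (EFin \o cst 1).
  apply: measurable_bounded_integrable => //; last exact: bounded_cst.
  exact: (mu_bounded_lty Hmu mF (fun x h => EM x h.1)).
have h1 : \int[mu]_(x in F) 1 - \int[mu]_(x in F) f x <= \int[mu]_(x in F) `|1 - f x|.
  rewrite -RintegralB//; last exact: intf.
  apply: le_trans (ler_norm _) _; apply: le_normr_Rintegral => //.
  exact: (intd F 1 mF (fun x h => EM x h.1)).
have h2 : \int[mu]_(x in Et `\` E) f x <= \int[mu]_(x in Et `\` E) `|f x|.
  by apply: le_trans (ler_norm _) _; apply: le_normr_Rintegral => //; exact: intf.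
have := le_trans (ler_norm _) lip.
rewrite -/F; lra.
Qed.

(** The shift is decomposed along the axes. A point of E that leaves E under a + b either leaves it
    already under a, or x + a lies in E and leaves it under b; translation invariance removes the
    shift a from the second set. *)
Lemma mu_setD_translate (E : set T) (p : R) (tau : V) : measurable E -> Defs.bounded_set E ->
  (perimeter mu E <= p%:E)%E ->
  (mu (E `\` (translate tau @^-1` E)) <= ((\sum_(i < n) `|tau ord0 i|) * p)%:E)%E.
Proof.
move=> mE bE Ep.
have h (s : seq 'I_n) : (mu (E `\` (translate (\sum_(i <- s) tau ord0 i *: evec R i) @^-1` E))
     <= ((\sum_(i <- s) `|tau ord0 i|) * p)%:E)%E.
  elim: s => [|i s IH].
    rewrite !big_nil mul0r (_ : E `\` _ = set0) ?measure0//.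
    by apply/seteqP; split => // x [Ex]; rewrite /= /translate addr0.
  rewrite !big_cons mulrDl EFinD.
  set a := tau ord0 i *: evec R i; set b := \sum_(j <- s) _.
  apply: le_trans (_ : _ <= mu ((E `\` (translate a @^-1` E)) `|`
     (translate a @^-1` (E `\` (translate b @^-1` E)))))%E _.
    have m1 (u : V) : @measurable _ T (E `\` translate u @^-1` E).
      by apply: measurableD => //; exact: translate_measurable.
    apply: le_measure; rewrite ?inE//.
      by apply: measurableU => //; exact: translate_measurable.
    move=> x [Ex nEx]; have [Eax|] := pselect (E (x + a)); last by left.
    by right; split => // h; apply: nEx; rewrite /translate /= addrA.
  apply: le_trans (measureU2 _ _ _) _.
  - by apply: measurableD => //; exact: translate_measurable.
  - by apply: translate_measurable; apply: measurableD => //; exact: translate_measurable.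
  apply: leeD; first exact: mu_setD_translate_axis.
  have mEb : @measurable _ T (E `\` translate b @^-1` E).
    by apply: measurableD => //; exact: translate_measurable.
  by apply: le_trans IH; rewrite -(mu_translate Hmu a mEb).
have tauE : tau = \sum_(i < n) tau ord0 i *: evec R i.
  apply/rowP => j; rewrite summxE (bigD1 j)//= big1 => [|k kj].
    by rewrite mxE evecE eqxx mulr1 addr0.
  by rewrite mxE evecE eq_sym (negbTE kj) mulr0.
by have := h (index_enum 'I_n); rewrite -tauE.
Qed.

End TranslationEstimate.

(** * Total boundedness of sets of bounded perimeter *)

Section Poincare.
Context {R : realType} {n : nat}.
Local Notation V := 'rV[R]_n.
Local Notation T := (g_sigma_algebraType (@open V)).
Context (mu : {measure set T -> \bar R}) (Hmu : is_lebesgue mu).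

Definition addV (z : T * T) : T := translate (z.2 : V) z.1.

Lemma measurable_addV : measurable_fun setT addV.
Proof.
apply: measurable_fun_coord => i.
rewrite (_ : (fun x => _) = (fun z : T * T => (z.1 : V) ord0 i + (z.2 : V) ord0 i)); last first.
  by apply/funext => z; rewrite /addV /translate mxE.
have mc : measurable_fun setT ((fun x : V => x ord0 i) : T -> R).
  by apply: continuous_measurableV; exact: coord_continuous.
apply: measurable_funD.
  exact: (measurableT_comp mc (measurable_fst : measurable_fun setT (fst : T * T -> T))).
exact: (measurableT_comp mc (measurable_snd : measurable_fun setT (snd : T * T -> T))).
Qed.

(** Tonelli's theorem asks for a sigma-finite structure, which [mu] receives from its exhaustion by
    cubes. *)
Definition sigma_finite_mu : {sigma_finite_measure set T -> \bar R} :=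
  HB.pack (mu : set T -> \bar R) (Measure.class mu)
    (Measure_isSigmaFinite.Build _ T R (Measure.Pack (Measure.class mu)) (mu_sigma_finite Hmu)).

Lemma measurable_mu_xsection (S : set (T * T)) : measurable S ->
  measurable_fun setT (fun x => mu (xsection S x)).
Proof. exact: (@measurable_fun_xsection _ _ _ _ _ sigma_finite_mu). Qed.

Lemma measurable_mu_ysection (S : set (T * T)) : measurable S ->
  measurable_fun setT (fun x => mu (ysection S x)).
Proof. exact: (@measurable_fun_ysection _ _ _ _ _ sigma_finite_mu). Qed.

Lemma integral_section (S : set (T * T)) : measurable S ->
  (\int[mu]_x mu (xsection S x) = \int[mu]_h mu (ysection S h))%E.
Proof.
move=> mS; have := @indic_fubini_tonelli _ _ T T R sigma_finite_mu sigma_finite_mu S mS.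
rewrite (@indic_fubini_tonelli_FE _ _ T T R sigma_finite_mu S mS).
by rewrite (@indic_fubini_tonelli_GE _ _ T T R sigma_finite_mu S mS).
Qed.

(* The left side counts the pairs (x, x + h) inside a common cell that leave E; by Fubini it is
   an integral over the shifts |h| <= delta of |E \ (E - h)|. *)
Lemma grid_overlap (I : finType) (q : I -> set T) (delta p : R) (E : set T) :
  0 < delta -> (forall z, measurable (q z)) -> trivIset setT q ->
  (forall z (x y : V), q z x -> q z y -> `|x - y| <= delta) ->
  measurable E -> Defs.bounded_set E -> (perimeter mu E <= p%:E)%E ->
  (\sum_(z : I) mu (E `&` q z) * mu (q z `\` E) <=
    ((4 * delta) ^+ n * (n%:R * (2 * delta) * p))%:E)%E.
Proof.
move=> d0 mq tq dq mE bE Ep.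
pose a z := E `&` q z; pose b z := q z `\` E.
have ma z : measurable (a z) by exact: measurableI.
have mb z : measurable (b z) by exact: measurableD.
(* Pairs (x, h) with x in the part of a cell inside E and x + h in the part of the same cell outside
   E. *)
pose S : set (T * T) := \big[setU/set0]_(z <- index_enum I)
   ((fst @^-1` a z) `&` (addV @^-1` b z)).
have mS : measurable S.
  apply: bigsetU_measurable => z _; apply: measurableI.
    by rewrite -[X in measurable X]setTI; apply: measurable_fst.
  by rewrite -[X in measurable X]setTI; apply: measurable_addV.
have SP x h : S (x, h) <-> exists z, a z x /\ b z (x + h : V).
  rewrite /S -bigcup_seq; split=> [[z _ [h1 h2]]|[z [h1 h2]]]; first by exists z.
  by exists z => //=; rewrite mem_index_enum.
have p0 : 0 <= p by rewrite -lee_fin (le_trans _ Ep)// perimeter_ge0.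
apply: (@le_trans _ _ (\int[mu]_x mu (xsection S x))%E).
  have mx : measurable_fun setT (fun x => mu (xsection S x)) by exact: measurable_mu_xsection.
  apply: (@le_trans _ _ (\sum_(z <- index_enum I) \int[mu]_(x in a z) mu (xsection S x))%E).
    apply: lee_sum => z _; rewrite muleC -(integral_cst mu (ma z)).
    apply: ge0_le_integral => //; try exact: measurable_funTS.
    move=> x azx /=; rewrite -(mu_translate Hmu (x : V) (mb z)).
    apply: le_measure; rewrite ?inE; [exact: translate_measurable|exact: measurable_xsection|].
    move=> h bh; rewrite /xsection /= inE; apply/SP; exists z; split => //.
    by rewrite addrC.
  rewrite -ge0_integral_bigsetU//.
  - apply: ge0_subset_integral => //; exact: bigsetU_measurable.
  - exact: index_enum_uniq.
  - apply/trivIsetP => i j _ _ ij; rewrite /a setIACA setIid.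
    by move/trivIsetP : tq => /(_ i j Logic.I Logic.I ij) ->; rewrite setI0.
  - exact: measurable_funTS.
rewrite integral_section//.
have my : measurable_fun setT (fun x => mu (ysection S x)) by exact: measurable_mu_ysection.
(* For h in the cube of half-side 2 delta the coordinates sum to at most n (2 delta), so the
   translation estimate bounds each section by c. *)
pose c := n%:R * (2 * delta) * p.
have c0 : 0 <= c by rewrite !mulr_ge0// ltW.
have mC : @measurable _ T (cube (2 * delta)) by exact: cube_measurable.
apply: (@le_trans _ _ (\int[mu]_(h in cube (2 * delta)) (cst c%:E h))%E); last first.
  (* Relevant shifts have sup norm at most delta; the cube is half-open, so half-side 2 delta is
     taken to contain them all, with measure (4 delta)^n. *)
  rewrite integral_cst// (mu_cube Hmu); last by rewrite mulr_ge0// ltW.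
  by rewrite -EFinM lee_fin mulrC (_ : 2 * (2 * delta) = 4 * delta)//; ring.
rewrite [leRHS]integral_mkcond; apply: ge0_le_integral => //.
  by apply/(measurable_restrictT _ mC); exact: measurable_cst.
move=> h _; rewrite patchE.
have yS (x : V) : ysection S h x -> E x /\ ~ E (x + h : V) /\ `|(h : V)| <= delta.
  rewrite /ysection/= inE => /SP [z [[Ex qx] [qxh nExh]]]; split => //; split => //.
  by have := dq _ _ _ qxh qx; rewrite addrC addKr.
case: ifPn => [/set_mem hd|/negP hd].
  apply: (@le_trans _ _ (mu (E `\` translate (h : V) @^-1` E))).
    apply: le_measure; rewrite ?inE; [exact: measurable_ysection| |].
      by apply: measurableD => //; exact: translate_measurable.
    by move=> x /yS [? []].
  apply: le_trans (mu_setD_translate Hmu _ mE bE Ep) _; rewrite lee_fin ler_wpM2r//.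
  apply: (@le_trans _ _ (\sum_(i < n) 2 * delta)); last by rewrite sumr_const card_ord -(mulr_natl (2 * delta)).
  apply: ler_sum => i _; have h2 : `|(h : V)| <= 2 * delta by apply: norm_cube => //; rewrite mulr_gt0.
  by apply: le_trans h2; exact: coord_le_norm.
rewrite (_ : ysection S h = set0) ?measure0//.
apply/seteqP; split => // x /yS [_ [_ hle]]; apply: hd; apply/mem_set/cube_norm.
  by rewrite mulr_gt0.
by apply: (le_lt_trans hle); lra.
Qed.

Lemma mu_lty_sub (A B : set T) : measurable A -> measurable B -> A `<=` B -> (mu B < +oo)%E ->
  mu A \is a fin_num.
Proof.
move=> mA mB AB Bfin; rewrite ge0_fin_numE//; apply: le_lt_trans Bfin.
by apply: le_measure; rewrite ?inE.
Qed.

Lemma measure_bigsetU_le (I : Type) (s : seq I) (F : I -> set T) : (forall i, measurable (F i)) ->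
  (mu (\big[setU/set0]_(i <- s) F i) <= \sum_(i <- s) mu (F i))%E.
Proof.
move=> mF; elim: s => [|i s IH]; first by rewrite !big_nil measure0.
rewrite !big_cons; apply: le_trans (measureU2 _ _ _) _ => //; last exact: leeD.
exact: bigsetU_measurable.
Qed.

(** G collects the cells more than half filled by E. The error in a cell is then the smaller of the
    measures of its two parts; the larger is at least w/2, so this error is at most 2/w times their
    product, which [grid_overlap] controls. *)
Lemma grid_approx (I : finType) (q : I -> set T) (delta p w : R) (E : set T) :
  0 < delta -> 0 < w -> (forall z, measurable (q z)) -> trivIset setT q ->
  (forall z (x y : V), q z x -> q z y -> `|x - y| <= delta) ->
  (forall z, mu (q z) = w%:E) ->
  measurable E -> Defs.bounded_set E -> (perimeter mu E <= p%:E)%E ->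
  E `<=` \bigcup_z q z ->
  exists G : {set I}, (mu (E `+` \big[setU/set0]_(z in G) q z) <=
    (2 / w * ((4 * delta) ^+ n * (n%:R * (2 * delta) * p)))%:E)%E.
Proof.
move=> d0 w0 mq tq dq qw mE bE Ep Eq.
pose a z := E `&` q z; pose b z := q z `\` E.
have ma z : measurable (a z) by exact: measurableI.
have mb z : measurable (b z) by exact: measurableD.
have fq z : (mu (q z) < +oo)%E by rewrite qw ltry.
have fa z : mu (a z) \is a fin_num by apply: mu_lty_sub (fq z) => //; exact: subIsetr.
have fb z : mu (b z) \is a fin_num by apply: mu_lty_sub (fq z) => //; exact: subDsetl.
have abw z : fine (mu (a z)) + fine (mu (b z)) = w.
  rewrite -fineD// -measureU//.
    have -> : a z `|` b z = q z by rewrite /a /b setIC setUIDK.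
    exact: (congr1 fine (qw z)).
  by apply/seteqP; split => // x [[Ex _] [_ nEx]].
pose G : {set I} := finset (fun z => fine (mu (b z)) < fine (mu (a z))); exists G.
apply: (@le_trans _ _ (mu (\big[setU/set0]_(z <- index_enum I) (if z \in G then b z else a z)))).
  apply: le_measure; rewrite ?inE.
  - apply: measurableU; apply: measurableD => //; exact: bigsetU_measurable.
  - by apply: bigsetU_measurable => z _; case: ifP.
  - move=> x; rewrite -bigcup_seq -bigcup_seq_cond => -[[Ex nGx]|[[z /= /andP[_ zG] qx] nEx]].
      have [z _ qzx] := Eq x Ex; exists z; rewrite /= ?mem_index_enum//.
      case: ifPn => zG; last by split.
      by exfalso; apply: nGx; exists z => //=; rewrite mem_index_enum.
    by exists z; rewrite /= ?mem_index_enum// zG.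
apply: le_trans (measure_bigsetU_le _ _) _; first by move=> z; case: ifP.
apply: (@le_trans _ _ (\sum_(z <- index_enum I) (2 / w)%:E * (mu (a z) * mu (b z)))%E).
  apply: lee_sum => z _; rewrite -(fineK (fa z)) -(fineK (fb z)).
  have := abw z; have := fine_ge0 (measure_ge0 mu (a z)); have := fine_ge0 (measure_ge0 mu (b z)).
  rewrite inE; set u := fine (mu (a z)); set v := fine (mu (b z)) => v0 u0 uv.
  have K (s t : R) : 0 <= s -> s <= t -> s + t = w -> s <= 2 / w * (t * s).
    by move=> s0 st st_w; rewrite mulrA ler_peMl// mulrAC ler_pdivlMr// mul1r; lra.
  case: ifPn => [/ltW vu|]; rewrite -?EFinM.
    by rewrite -(fineK (fb z)) lee_fin; apply: K => //; rewrite addrC.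
  by rewrite -leNgt => uv'; rewrite -(fineK (fa z)) lee_fin (mulrC u); exact: K.
rewrite -ge0_sume_distrr; last by move=> z _; exact: mule_ge0.
rewrite [leRHS]EFinM; apply: lee_wpmul2l; first by rewrite lee_fin divr_ge0// ltW.
exact: grid_overlap.
Qed.

Lemma grid_exists (L : R) (N : nat) : 0 < L -> (0 < N)%N ->
  let delta := 2 * L / N%:R in
  exists (I : finType) (q : I -> set T), [/\ forall z, measurable (q z), trivIset setT q,
    forall z (x y : V), q z x -> q z y -> `|x - y| <= delta,
    forall z, mu (q z) = (delta ^+ n)%:E & cube L `<=` \bigcup_z q z].
Proof.
move=> L0 N0 delta; have d0 : 0 < delta by rewrite divr_gt0 ?mulr_gt0// ltr0n.
pose lo (z : {ffun 'I_n -> 'I_N}) : V := \row_i (- L + delta * (z i)%:R).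
pose hi (z : {ffun 'I_n -> 'I_N}) : V := \row_i (- L + delta * (z i).+1%:R).
exists {ffun 'I_n -> 'I_N}, (fun z => hbox (lo z) (hi z)); split.
- by move=> z; exact: hbox_measurable.
- apply/trivIsetP => z z' _ _ zz'; apply/seteqP; split => // x [h1 h2].
  move/eqP: zz'; apply; apply/ffunP => i; apply/val_inj => /=.
  have := h1 i; have := h2 i; rewrite !mxE => /andP[a1 a2] /andP[b1 b2].
  have : delta * (z i)%:R < delta * (z' i).+1%:R by lra.
  have : delta * (z' i)%:R < delta * (z i).+1%:R by lra.
  rewrite !ltr_pM2l// !ltr_nat !ltnS => c1 c2; apply/eqP; by rewrite eqn_leq c1 c2.
- move=> z x y h1 h2; apply/norm_leP => [|i]; first exact: ltW.
  have := h1 i; have := h2 i; rewrite !mxE -natr1 => /andP[a1 a2] /andP[b1 b2].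
  by rewrite ler_norml; apply/andP; split; lra.
- move=> z; rewrite -[hbox _ _]/([set x : V | forall i, lo z ord0 i < x ord0 i <= hi z ord0 i]).
  rewrite Hmu => [|i]; last by rewrite !mxE lerD2l ler_pM2l// ler_nat.
  congr EFin; rewrite -[X in _ ^+ X]card_ord -prodr_const; apply: eq_bigr => i _.
  by rewrite !mxE -natr1; ring.
- move=> x xL.
  have xi i : exists k : 'I_N, - L + delta * k%:R < x ord0 i <= - L + delta * k.+1%:R.
    have /andP[x1 x2] := xL i; rewrite !mxE in x1 x2.
    (* The cell index in each coordinate is the least k whose upper face is not below x; the last
       index always qualifies. *)
    pose P k := x ord0 i <= - L + delta * k.+1%:R.
    have PN : P N.-1.
      rewrite /P prednK// (le_trans x2)// /delta divfK ?pnatr_eq0 -?lt0n//; lra.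
    have exP : exists k, P k by exists N.-1.
    have [k Pk mink] := ex_minnP exP.
    have kN : (k < N)%N by rewrite -(prednK N0) ltnS; exact: mink.
    exists (Ordinal kN) => /=; rewrite /P in Pk mink; rewrite Pk andbT.
    case: k Pk mink kN => [|k] Pk mink kN; first by rewrite mulr0 addr0.
    by rewrite ltNge; apply/negP => /mink; rewrite ltnn.
  have [z zP] := choice xi.
  by exists (finfun z) => // i; rewrite !mxE ffunE; exact: zP.
Qed.

(** The net consists of all unions of grid cells, a finite family independent of E. With w = delta^n
    the powers of delta in [grid_approx] cancel up to one factor, so the error is linear in the mesh
    2 L / N. *)
Lemma finite_net (L p eps : R) : 0 < L -> 0 < eps -> exists (J : finType) (D : J -> set T),
  (forall j, measurable (D j)) /\
  forall E : set T, measurable E -> E `<=` cube L -> (perimeter mu E <= p%:E)%E ->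
    exists j, (mu (E `+` D j) <= eps%:E)%E.
Proof.
move=> L0 e0; pose C : R := 2 * 4 ^+ n * n%:R * 2 * `|p| * (2 * L).
have C0 : 0 <= C by rewrite !mulr_ge0// ltW.
pose N := (Num.truncn (C / eps)).+1.
have NC : C / N%:R <= eps.
  rewrite ler_pdivrMr ?ltr0n// mulrC -ler_pdivrMr//; exact/ltW/Num.Theory.truncnS_gt.
have [I [q [mq tq dq wq cq]]] := grid_exists L0 (ltn0Sn _ : (0 < N)%N).
set delta := 2 * L / N%:R in dq wq.
have d0 : 0 < delta by rewrite divr_gt0 ?mulr_gt0// ltr0n.
exists ({set I} : finType), (fun G : {set I} => \big[setU/set0]_(z in G) q z); split.
  by move=> G; apply: bigsetU_measurable.
move=> E mE EL Ep.
have bE : Defs.bounded_set E.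
  exists (n%:R * L) => x /EL/(norm_cube L0) xL.
  by apply: le_trans (enorm_le_norm x) _; rewrite ler_wpM2l.
have [G GP] := grid_approx d0 (exprn_gt0 n d0) mq tq dq wq mE bE Ep (subset_trans EL cq).
exists G; apply: le_trans GP _; rewrite lee_fin; apply: le_trans NC.
rewrite (exprMn n 4 delta) (_ : 2 / _ * _ = 2 * 4 ^+ n * n%:R * 2 * p * (2 * L) / N%:R); last first.
  by rewrite -[X in _ = X]mulrA -/delta; field; rewrite gt_eqF// exprn_gt0.
apply: ler_wpM2r; first by rewrite invr_ge0.
apply: ler_wpM2r; first by rewrite mulr_ge0// ltW.
by apply: ler_wpM2l; [rewrite !mulr_ge0|exact: ler_norm].
Qed.

End Poincare.

(** * Vitali covering and density points *)

Section Density.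
Context {R : realType} {n : nat}.
Local Notation V := 'rV[R]_n.
Local Notation T := (g_sigma_algebraType (@open V)).
Context (mu : {measure set T -> \bar R}) (Hmu : is_lebesgue mu).

Lemma max_radius (s : seq (V * R)) : s != [::] -> exists2 c, c \in s & forall d, d \in s -> d.2 <= c.2.
Proof.
elim: s => // c s IH _; have [->|/IH [d ds dmax]] := eqVneq s [::].
  by exists c => [|d]; rewrite inE ?eqxx// => /eqP ->.
have [cd|/ltW dc] := leP c.2 d.2.
  by exists d => [|e]; rewrite inE ?ds ?orbT// => /predU1P[->//|]; exact: dmax.
exists c => [|e]; rewrite inE ?eqxx// => /predU1P[->//|/dmax ed]; exact: le_trans ed dc.
Qed.

(** Greedy selection: keep a ball of largest radius, discard all balls meeting it, which lie in its
    threefold enlargement, and recurse on the rest. *)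
Lemma vitali_balls (s : seq (V * R)) : (forall c, c \in s -> 0 < c.2) ->
  exists D : seq (V * R), [/\ uniq D, {subset D <= s},
    trivIset [set` D] (fun c => ball c.1 c.2) &
    forall c, c \in s -> exists2 d, d \in D & ball c.1 c.2 `<=` ball d.1 (3 * d.2)].
Proof.
move: {2}(size s) (leqnn (size s)) => N; elim: N s => [|N IH] s.
  rewrite leqn0 size_eq0 => /eqP -> _; by exists [::]; split.
move=> sN s0; have [->|sn0] := eqVneq s [::].
  by exists [::]; split.
have [c cs cmax] := max_radius sn0.
pose s' := [seq d <- s | `[< ball d.1 d.2 `&` ball c.1 c.2 = set0 >]].
have cs' : c \notin s'.
  rewrite mem_filter; apply/negP => /andP[/asboolP + _]; rewrite setIid => b0.
  by have : set0 c.1 by rewrite -b0; apply: ballxx; exact: s0.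
have s'N : (size s' <= N)%N.
  rewrite -ltnS; apply: leq_trans sN; rewrite size_filter ltn_neqAle count_size andbT -all_count.
  by apply/negP => /allP/(_ c cs) hc; move: cs'; rewrite mem_filter hc cs.
have [|D [uD Ds' tD Dcov]] := IH s' s'N.
  by move=> d; rewrite mem_filter => /andP[_]; exact: s0.
exists (c :: D); split.
- by rewrite /= uD andbT; apply: contra cs'; exact: Ds'.
- by move=> d; rewrite inE => /predU1P[->//|/Ds']; rewrite mem_filter => /andP[].
- have dis d : d \in D -> ball d.1 d.2 `&` ball c.1 c.2 = set0.
    by move=> /Ds'; rewrite mem_filter => /andP[/asboolP].
  move=> d e /=; rewrite !inE => /predU1P[->|dD] /predU1P[->|eD] [y [yd ye]] //.
  + by have : set0 y by rewrite -(dis e eD).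
  + by have : set0 y by rewrite -(dis d dD).
  + by apply: tD => //; exists y.
- move=> d ds; have [d0|/eqP/set0P[y [yd yc]]] := pselect (ball d.1 d.2 `&` ball c.1 c.2 = set0).
    have [|e eD de] := Dcov d; first by rewrite mem_filter ds andbT; apply/asboolP.
    by exists e => //; rewrite inE eD orbT.
  exists c; first by rewrite inE eqxx.
  move=> z zd; rewrite -!ball_normE /ball_/= in yd yc zd *.
  have -> : c.1 - z = (c.1 - y) - (d.1 - y) + (d.1 - z).
    by rewrite opprB !subrKA.
  apply: le_lt_trans (ler_normD _ _) _; have := ler_normB (c.1 - y) (d.1 - y).
  have := cmax d ds; lra.
Qed.

(* The weak (1,1) bound for the maximal function of [u] over small balls. *)
Lemma weak_type (Q X : set T) (u : T -> R) (c eps : R) : measurable Q -> measurable_fun setT u ->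
  (forall x, 0 <= u x) -> 0 < c -> (\int[mu]_(x in Q) (u x)%:E <= eps%:E)%E ->
  (forall x : V, X x -> exists2 r : R, 0 < r & ball x r `<=` Q /\
     ((c * r ^+ n)%:E <= \int[mu]_(y in (ball x r : set T)) (u y)%:E)%E) ->
  exists U : set T, [/\ measurable U, X `<=` U & (mu U <= (6 ^+ n / c * eps)%:E)%E].
Proof.
move=> mQ mu_ u0 c0 ueps Xr.
have mue (D : set T) : measurable_fun D (fun x => (u x)%:E).
  by apply/measurable_EFinP; exact: measurable_funTS.
pose good (z : V * R) := [/\ 0 < z.2, ball z.1 z.2 `<=` Q &
  ((c * z.2 ^+ n)%:E <= \int[mu]_(y in (ball z.1 z.2 : set T)) (u y)%:E)%E].
pose U : set V := \bigcup_(z in good) ball z.1 z.2.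
have oU : open U by apply: bigcup_open => z _; exact: ball_open.
exists U; split; first exact: open_measurableV.
  move=> x /Xr [r r0 [rQ rc]]; exists (x, r); first by split.
  exact: ballxx.
(* The covering lemma is for finite families, so the bound is proved on compact subsets of U and
   extended by exhausting U with finite unions of closed boxes. *)
have Kbound (K : set V) : compact K -> K `<=` U -> (mu K <= (6 ^+ n / c * eps)%:E)%E.
  move=> cK KU; have mK : @measurable _ T K.
    by apply: closed_measurableV; apply: compact_closed.
  have := cK; rewrite compact_cover => /(_ (V * R)%type good (fun z => ball z.1 z.2)) [].
  - by move=> z _; exact: ball_open.
  - exact: KU.
  move=> s0 s0good Ks0.
  have [|D [uD Ds tD Dcov]] := @vitali_balls (finmap.enum_fset s0).
    by move=> d ds; have /s0good := ds; rewrite inE => -[].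
  have Dgood d : d \in D -> good d by move=> /Ds ds; have := s0good d ds; rewrite inE.
  have mB d : d \in D -> @measurable _ T (ball d.1 d.2) by move=> _; apply: open_measurableV; exact: ball_open.
  have mB' (d : V * R) : @measurable _ T (ball d.1 d.2) by apply: open_measurableV; exact: ball_open.
  have mB3 (d : V * R) : @measurable _ T (ball d.1 (3 * d.2)) by apply: open_measurableV; exact: ball_open.
  apply: (@le_trans _ _ (mu (\big[setU/set0]_(d <- D) ball d.1 (3 * d.2)))).
    apply: le_measure; rewrite ?inE//; first exact: bigsetU_measurable.
    move=> x /Ks0 [d ds xd]; have [e eD de] := Dcov d ds.
    by rewrite -bigcup_seq; exists e => //; exact: de.
  apply: le_trans (measure_bigsetU_le _ _ _) _ => //.
  (* The factor 6^n is the threefold enlargement of radii combined with the bound (2 r)^n for the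
     measure of a ball. *)
  apply: (@le_trans _ _ (\sum_(d <- D) (6 ^+ n / c)%:E * \int[mu]_(y in (ball d.1 d.2 : set T)) (u y)%:E)%E).
    rewrite big_seq [leRHS]big_seq; apply: lee_sum => d dD; have [r0 dQ dc] := Dgood d dD.
    apply: le_trans (mu_ball_le Hmu _ _) _; first by rewrite mulr_gt0.
    apply: (@le_trans _ _ ((6 ^+ n / c)%:E * (c * d.2 ^+ n)%:E)%E).
      rewrite -EFinM lee_fin (mulrA (6 ^+ n / c)) divfK ?gt_eqF// -exprMn.
      by rewrite (_ : 2 * (3 * d.2) = 6 * d.2)//; ring.
    by apply: lee_wpmul2l => //; rewrite lee_fin divr_ge0// ltW.
  rewrite -ge0_sume_distrr; last by move=> d _; apply: integral_ge0 => x _; rewrite lee_fin.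
  rewrite [leRHS]EFinM; apply: lee_wpmul2l; first by rewrite lee_fin divr_ge0// ltW.
  apply: le_trans ueps; rewrite -(@ge0_integral_bigsetU _ _ _ _ _ (fun d : V * R => ball d.1 d.2 : set T))//.
    apply: ge0_subset_integral => //; first exact: bigsetU_measurable.
      by move=> x _; rewrite lee_fin.
    move=> x; rewrite -bigcup_seq => -[d /= dD xd]; have [_ dQ _] := Dgood d dD.
    exact: dQ.
  by move=> x _; rewrite lee_fin.
have [F [UF FP]] := open_bigcup_cbox oU.
have cF k : compact (F k).
  by have [->|[a [b ->]]] := FP k; [exact: compact0|exact: cbox_compact].
have mF k : @measurable _ T (F k) by apply: closed_measurableV; apply: compact_closed.
pose G m : set T := \big[setU/set0]_(k < m) F k.
have cG m : compact (G m : set V).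
  rewrite /G; elim: m => [|m IH]; first by rewrite big_ord0; exact: compact0.
  by rewrite big_ord_recr; exact: compactU.
have GU m : G m `<=` U.
  by rewrite UF /G -bigcup_mkord => x [k _ Fx]; exists k.
have cv : mu (G m) @[m --> \oo] --> mu U.
  rewrite (_ : U = \bigcup_m G m); last first.
    rewrite UF; apply/seteqP; split => [x [k _ Fx]|x [m _]]; last by rewrite -UF => /GU.
    by exists k.+1 => //; rewrite /G -bigcup_mkord; exists k => //=.
  apply: nondecreasing_cvg_mu.
  - by move=> m; exact: bigsetU_measurable.
  - by apply: bigcupT_measurable => m; exact: bigsetU_measurable.
  - move=> a b ab; apply/subsetPset; rewrite /G -!bigcup_mkord => x [k /= ka Fx].
    by exists k => //=; exact: leq_trans ka ab.
rewrite -(cvg_lim _ cv)//; apply: lime_le; first by apply/cvg_ex; eexists; exact: cv.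
by apply: nearW => m; apply: Kbound.
Qed.

(** A countable form of density one: radii 1/(j+1), sup-norm balls, and r^n in place of the measure
    of the ball. It exhibits the density set through countable operations, whence its
    measurability. *)
Definition density_seq (E : set V) (x : V) : Prop := forall m, exists k, forall j, (k <= j)%N ->
  (mu (ball x j.+1%:R^-1 `\` E) <= (j.+1%:R^-1 ^+ n / m.+1%:R)%:E)%E.

Lemma eball_open (x : V) r : open (eball x r).
Proof.
have [r0|r0] := leP r 0.
  rewrite (_ : eball x r = set0); first exact: open0.
  by apply/seteqP; split => // y; rewrite /eball/= ltNge (le_trans r0)// enorm_ge0.
have E : eball x r = (fun y : V => sqnorm (y - x)) @^-1` [set t | t < r ^+ 2].
  apply/seteqP; split => y; rewrite /eball/= /Defs.edist -enormN opprB -sqr_enorm.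
    by rewrite ltr_pXn2r// ?nnegrE ?enorm_ge0// ltW.
  by rewrite ltr_pXn2r// ?nnegrE ?enorm_ge0// ltW.
rewrite E; apply: open_comp => [y _|]; last exact: open_lt.
exact: (C1_continuous (C1_translate (- x) (C1_sqnorm).1).1).
Qed.

Lemma eball_ball (x : V) r : eball x r `<=` ball x r.
Proof.
move=> y; rewrite -ball_normE /eball/ball_/= /Defs.edist; apply: le_lt_trans; exact: norm_le_enorm.
Qed.

(** Dividing by [n.+1] instead of [n] keeps the radius positive in dimension 0. *)
Lemma ball_eball (x : V) r : 0 < r -> ball x (r / n.+1%:R) `<=` eball x r.
Proof.
move=> r0 y; rewrite -ball_normE /eball/ball_/= /Defs.edist ltr_pdivlMr ?ltr0n// => h.
apply: le_lt_trans (enorm_le_norm _) _; apply: le_lt_trans h.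
by rewrite mulrC ler_wpM2l// ler_nat.
Qed.

Lemma ball_fin_num (x : V) (r : R) (A : set T) : measurable A -> A `<=` ball x r -> 0 < r ->
  mu A \is a fin_num.
Proof.
move=> mA Ar r0; apply: (mu_lty_sub mA _ Ar); first exact: ball_measurable.
by apply: le_lt_trans (mu_ball_le Hmu _ r0) _; rewrite ltry.
Qed.

(** The relative defect must fall below every 1/(m+1), so constant factors are immaterial: both
    kinds of balls, and a radius r and the nearby 1/(j+1), are comparable up to factors absorbed in
    C. *)
Lemma density_oneP (E : set V) (x : V) : @measurable _ T E -> density_one mu E x <-> density_seq E x.
Proof.
move=> mE; pose C : R := (2 * n.+1%:R) ^+ n; have C0 : 0 < C by rewrite exprn_gt0// mulr_gt0.
have mB r : @measurable _ T (eball x r) by apply: open_measurableV; exact: eball_open.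
have mD r : @measurable _ T (eball x r `\` E) by exact: measurableD.
have mI r : @measurable _ T (E `&` eball x r) by exact: measurableI.
have fB r : 0 < r -> mu (eball x r) \is a fin_num.
  by move=> r0; apply: (ball_fin_num (mB r) (@eball_ball x r) r0).
have fD r : 0 < r -> mu (eball x r `\` E) \is a fin_num.
  by move=> r0; apply: (ball_fin_num (mD r) _ r0); apply: subset_trans (@eball_ball x r); exact: subDsetl.
have fI r : 0 < r -> mu (E `&` eball x r) \is a fin_num.
  by move=> r0; apply: (ball_fin_num (mI r) _ r0); apply: subset_trans (@eball_ball x r); exact: subIsetr.
have Blow r : 0 < r -> (r / n.+1%:R) ^+ n <= fine (mu (eball x r)).
  move=> r0; rewrite -lee_fin fineK ?fB//; apply: le_trans (mu_ball_ge Hmu x _) _.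
    by rewrite divr_gt0.
  by apply: le_measure; rewrite ?inE//; [apply: ball_measurable; rewrite divr_gt0|exact: ball_eball].
have Bup r : 0 < r -> fine (mu (eball x r)) <= (2 * r) ^+ n.
  move=> r0; rewrite -lee_fin fineK ?fB//; apply: le_trans (mu_ball_le Hmu x r0).
  by apply: le_measure; rewrite ?inE//; [exact: ball_measurable|exact: eball_ball].
have Bpos r : 0 < r -> 0 < fine (mu (eball x r)).
  by move=> r0; apply: lt_le_trans (Blow r r0); rewrite exprn_gt0// divr_gt0.
have ratio r : 0 < r -> 1 - fine (mu (E `&` eball x r)) / fine (mu (eball x r)) =
    fine (mu (eball x r `\` E)) / fine (mu (eball x r)).
  move=> r0; have h : fine (mu (eball x r)) = fine (mu (E `&` eball x r)) + fine (mu (eball x r `\` E)).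
    rewrite -fineD ?fI ?fD// -measureU//.
      by rewrite setIC setUIDK.
    by apply/seteqP; split => // y [[Ey _] [_ nEy]].
  by rewrite -[X in X - _](divff (lt0r_neq0 (Bpos r r0))) -mulrBl {1}h addrAC subrr add0r.
split.
(* A sup-norm ball of radius q lies in the Euclidean ball of radius (n+1) q, whose measure is at
   most C q^n. *)
- move=> dE m; pose e := (m.+1%:R * C)^-1.
  have e0 : 0 < e by rewrite invr_gt0 mulr_gt0.
  have /cvgrPdist_le /(_ e e0) := dE.
  rewrite near_withinE => -[d /= d0 dP].
  have dP' r : 0 < r -> r < d -> fine (mu (eball x r `\` E)) <= e * (2 * r) ^+ n.
    move=> r0 rd; have := dP r; rewrite /ball_/= sub0r normrN (gtr0_norm r0) => /(_ rd r0).
    rewrite (ratio r r0) ger0_norm; last by rewrite divr_ge0 ?fine_ge0.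
    rewrite ler_pdivrMr ?Bpos// => h; apply: le_trans h _.
    by rewrite ler_pM2l// Bup.
  exists (Num.truncn (n.+1%:R / d)) => j kj.
  set q : R := j.+1%:R^-1; have q0 : 0 < q by rewrite invr_gt0.
  have nq0 : 0 < n.+1%:R * q by rewrite mulr_gt0.
  have nqd : n.+1%:R * q < d.
    rewrite /q ltr_pdivrMr// mulrC -ltr_pdivrMr//.
    by apply: lt_le_trans (Num.Theory.truncnS_gt _) _; rewrite ler_nat.
  apply: (@le_trans _ _ (mu (eball x (n.+1%:R * q) `\` E))).
    apply: le_measure; rewrite ?inE//; first by apply: measurableD => //; exact: ball_measurable.
    move=> y [yq nEy]; split => //; apply: ball_eball => //.
    by rewrite mulrAC divff ?mul1r// pnatr_eq0.
  rewrite -(fineK (fD _ nq0)) lee_fin; apply: le_trans (dP' _ nq0 nqd) _.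
  rewrite mulrA exprMn -/C /e invfM -mulrA [C^-1 * _]mulrA mulVf ?gt_eqF// mul1r.
  by rewrite mulrC.
- move=> dE; apply/cvgrPdist_le => e e0.
  pose m := Num.truncn (C / e).
  have mC : C / m.+1%:R <= e.
    by rewrite ler_pdivrMr// mulrC -ler_pdivrMr//; exact/ltW/Num.Theory.truncnS_gt.
  have [k kP] := dE m.
  rewrite near_withinE; exists (k.+1%:R^-1) => /=; first by rewrite invr_gt0.
  move=> r /=; rewrite sub0r normrN => rk r0; rewrite (gtr0_norm r0) in rk.
  rewrite (ratio r r0) ger0_norm; last by rewrite divr_ge0 ?fine_ge0.
  rewrite ler_pdivrMr ?Bpos//.
  have r1 : k.+1%:R < r^-1 by rewrite -[ltLHS]invrK ltf_pV2 ?posrE ?invr_gt0.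
  have [|jl ju] := andP (Num.Theory.truncn_itv (_ : 0 <= r^-1)); first by rewrite invr_ge0 ltW.
  have kj : (k.+1 <= Num.truncn r^-1)%N.
    by rewrite -ltnS -(ltr_nat R); apply: lt_trans r1 ju.
  (* Chosen so that j + 1 <= 1/r < j + 2; then q = 1/(j+1) satisfies r <= q <= 2 r. *)
  pose j := (Num.truncn r^-1).-1.
  have jE : j.+1 = Num.truncn r^-1 by rewrite /j prednK// (leq_trans _ kj).
  have /kP : (k <= j)%N by rewrite -ltnS jE.
  set q : R := j.+1%:R^-1; have q0 : 0 < q by rewrite invr_gt0.
  have rq : r <= q by rewrite /q jE -[leLHS]invrK lef_pV2 ?posrE ?invr_gt0// ltr0n (leq_trans _ kj).
  have q2r : q <= 2 * r.
    rewrite /q -[leRHS]invrK lef_pV2 ?posrE ?invr_gt0 ?mulr_gt0// invfM.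
    rewrite -jE in ju; rewrite ler_pdivrMl// -natrM.
    by apply: le_trans (ltW ju) _; rewrite ler_nat mul2n -addnn addnS addSn !ltnS leq_addr.
  move=> h; rewrite -lee_fin fineK ?fD//.
  apply: (@le_trans _ _ (mu (ball x q `\` E))).
    apply: le_measure; rewrite ?inE//; first by apply: measurableD => //; exact: ball_measurable.
    by move=> y [/eball_ball yr nEy]; split => //; exact: le_ball yr.
  apply: le_trans h _; rewrite lee_fin.
  apply: (@le_trans _ _ (C / m.+1%:R * (r / n.+1%:R) ^+ n)); last first.
    by apply: ler_pM => //; [rewrite divr_ge0// ltW|rewrite exprn_ge0// divr_ge0// ltW|exact: Blow].
  rewrite mulrAC ler_pM2r ?invr_gt0// /C -exprMn.
  have -> : 2 * n.+1%:R * (r / n.+1%:R) = 2 * r by rewrite -mulrA (mulrC n.+1%:R) divfK// pnatr_eq0.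
  by apply: lerXn2r => //; rewrite nnegrE ?mulr_ge0// ltW.
Qed.

End Density.

(** * Lebesgue density theorem *)

Section DensityTheorem.
Context {R : realType} {n : nat}.
Local Notation V := 'rV[R]_n.
Local Notation T := (g_sigma_algebraType (@open V)).
Context (mu : {measure set T -> \bar R}) (Hmu : is_lebesgue mu).

(** The function measures the sections of the product set of pairs (x, y) with |x - y| < r and y
    outside E. *)
Lemma measurable_mu_ballD (E : set T) (r : R) : measurable E -> 0 < r ->
  measurable_fun setT (fun x : T => mu (ball (x : V) r `\` E)).
Proof.
move=> mE r0; pose S : set (T * T) := [set z | ball (z.1 : V) r z.2] `&` (snd @^-1` (~` E)).
have sub_meas : measurable_fun setT ((fun z : T * T => (z.1 : V) - z.2) : T * T -> T).
  have mc i : measurable_fun setT ((fun x : V => x ord0 i) : T -> R).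
    by apply: continuous_measurableV; exact: coord_continuous.
  apply: measurable_fun_coord => i.
  rewrite (_ : (fun x => _) = (fun z : T * T => (z.1 : V) ord0 i - (z.2 : V) ord0 i)); last first.
    by apply/funext => z; rewrite !mxE.
  apply: measurable_funB.
    exact: (measurableT_comp (mc i) (measurable_fst : measurable_fun setT (fst : T * T -> T))).
  exact: (measurableT_comp (mc i) (measurable_snd : measurable_fun setT (snd : T * T -> T))).
have mS : measurable S.
  apply: measurableI; last first.
    rewrite -[X in measurable X]setTI.
    by apply: (measurable_snd : measurable_fun setT (snd : T * T -> T)) => //; exact: measurableC.
  rewrite (_ : [set z | _] = setT `&` ((fun z : T * T => (z.1 : V) - z.2) @^-1` ball (0 : V) r)).
    by apply: sub_meas => //; exact: ball_measurable.
  apply/seteqP; split => z /=; rewrite -ball_normE /ball_/= sub0r normrN; first by split.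
  by case.
have := measurable_mu_xsection Hmu mS.
congr (measurable_fun setT _); apply/funext => x; congr (mu _).
by apply/seteqP; split => y; rewrite /xsection /= inE.
Qed.

Definition density_at (E : set V) (m : nat) : set V := [set x | exists k, forall j, (k <= j)%N ->
  (mu (ball x j.+1%:R^-1 `\` E) <= (j.+1%:R^-1 ^+ n / m.+1%:R)%:E)%E].

Lemma density_at_measurable (E : set T) m : measurable E -> @measurable _ T (density_at E m).
Proof.
move=> mE; pose S j : set T := [set x : V |
  (mu (ball x j.+1%:R^-1 `\` E) <= (j.+1%:R^-1 ^+ n / m.+1%:R)%:E)%E].
have mS j : measurable (S j).
  have r0 : (0 : R) < j.+1%:R^-1 by rewrite invr_gt0.
  rewrite -[X in measurable X]setTI /S.
  by apply: emeasurable_fun_infty_c => //; exact: measurable_mu_ballD.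
rewrite (_ : density_at E m = \bigcup_k \bigcap_(j in [set j | (k <= j)%N]) S j).
  by apply: bigcupT_measurable => k; apply: bigcap_measurableType.
by apply/seteqP; split => x [k]; [exists k|move=> _ xk; exists k].
Qed.

Lemma density_oneE (E : set T) : measurable E -> density_one mu E = \bigcap_m density_at E m.
Proof.
move=> mE; apply/seteqP; split => x.
  by move=> /(density_oneP Hmu _ mE) h m _; exact: h.
by move=> h; apply/(density_oneP Hmu _ mE) => m; exact: (h m).
Qed.

Lemma density_one_measurable (E : set T) : measurable E -> @measurable _ T (density_one mu E).
Proof.
by move=> mE; rewrite density_oneE//; apply: bigcapT_measurable => m; exact: density_at_measurable.
Qed.

Lemma measurable_gt_set (u : T -> R) (c : R) : measurable_fun setT u ->
  measurable [set x | c < u x]%R.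
Proof.
move=> /measurable_EFinP mu_; have := emeasurable_fun_o_infty measurableT mu_ c%:E.
by rewrite setTI; congr measurable; apply/seteqP; split => x /=; rewrite lte_fin.
Qed.

Lemma markov_set (Q : set T) (u : T -> R) (c : R) : measurable Q -> measurable_fun setT u ->
  (forall x, 0 <= u x) -> 0 < c ->
  (c%:E * mu (Q `&` [set x | c < u x]%R) <= \int[mu]_(x in Q) (u x)%:E)%E.
Proof.
move=> mQ mu_ u0 c0; set S := [set x | _].
have mS : measurable S by exact: measurable_gt_set.
have mue (D : set T) : measurable_fun D (fun x => (u x)%:E).
  by apply/measurable_EFinP; exact: measurable_funTS.
rewrite -(integral_cst mu (measurableI _ _ mQ mS)).
apply: (@le_trans _ _ (\int[mu]_(x in Q `&` S) (u x)%:E)%E).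
  apply: ge0_le_integral => //; [exact: measurableI|by move=> x _; rewrite lee_fin ltW|].
  by move=> x [_ /ltW]; rewrite lee_fin.
by apply: ge0_subset_integral => //; [exact: measurableI|move=> x _; rewrite lee_fin].
Qed.

(** Approximate the indicator of the complement of E in L1 by a continuous g, with error function u.
    At a point of E that fails the density bound, either g exceeds c', and there u = g, so Markov's
    inequality applies; or g is small nearby, and u has a large integral over some small ball, so
    the weak type bound applies. Both exceptional sets shrink with the L1 error. *)
Lemma density_at_cube (E : set T) m (M : R) : measurable E -> 0 < M ->
  mu ((E `&` cube M) `\` density_at E m) = 0%E.
Proof.
move=> mE M0; set X := _ `\` _.
have mX : measurable X.
  by apply: measurableD; [apply: measurableI => //; exact: cube_measurable|exact: density_at_measurable].
have M1 : 0 < M + 1 by rewrite ltr_wpDl// ltW.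
pose Q : set T := cube (M + 2); have M2 : 0 < M + 2 by rewrite ltr_wpDl// ltW.
have mQ : measurable Q by exact: cube_measurable.
have Qfin : (mu Q < +oo)%E by rewrite mu_cube ?ltry// ltW.
pose c : R := m.+1%:R^-1; have c0 : 0 < c by rewrite invr_gt0.
(* Near x the function g stays below 2 c', and 2 c' (2 r)^n = (c/2) r^n: half of the defect c r^n is
   left for u. The constant K adds the factors of the weak type and Markov bounds. *)
pose c' : R := c / (4 * 2 ^+ n).
have c'0 : 0 < c' by rewrite divr_gt0// mulr_gt0// exprn_gt0.
have c20 : 0 < c / 2 by rewrite divr_gt0.
pose K : R := 6 ^+ n / (c / 2) + c'^-1.
have K0 : 0 < K by rewrite addr_gt0// ?invr_gt0// divr_gt0// exprn_gt0.
have mF : measurable (~` E) by exact: measurableC.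
apply/eqP; rewrite eq_le measure_ge0 andbT; apply/lee_addgt0Pr => eps e0; rewrite add0e.
have eK : 0 < eps / K by rewrite divr_gt0.
have [g [Cg g01 gF]] := (C1_approx_indic mQ Qfin mF).2 _ eK.
have cg : continuous g by exact: C1_continuous.
pose u (x : T) : R := `|\1_(~` E) x - g x|.
have mg : measurable_fun setT (g : T -> R) by exact: continuous_measurableV.
have mu_ : measurable_fun setT u.
  by apply: measurableT_comp => //; apply: measurable_funB => //; exact: measurable_indic.
have u0 x : 0 <= u x by exact: normr_ge0.
pose X' := X `\` (Q `&` [set x | c' < u x]%R).
have [|U [mU XU Ueps]] := weak_type Hmu (X := X') mQ mu_ u0 c20 gF.
  move=> x [[[Ex Mx] ndx] nux].
  have xQ : Q x by apply: cube_norm => //; apply: le_lt_trans (norm_cube M0 Mx) _; rewrite ltrDl.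
  have gx : g x <= c'.
    rewrite leNgt; apply/negP => cgx; apply: nux; split => //=.
    by rewrite /u indicE memNset ?sub0r ?normrN ?ger0_norm//; have /andP[] := g01 x.
  have /cvgrPdist_lt /(_ c' c'0) := cg x; rewrite -nbhs_ballE => -[r0 /= r00 r0P].
  pose k := Num.truncn (1 + r0^-1).
  have [j kj jn] : exists2 j, (k <= j)%N & ~ (mu (ball (x : V) j.+1%:R^-1 `\` E) <= (j.+1%:R^-1 ^+ n / m.+1%:R)%:E)%E.
    apply: contrapT => h; apply: ndx; exists k => j kj; apply: contrapT => h'; apply: h; by exists j.
  set r : R := j.+1%:R^-1 in jn.
  have rpos : 0 < r by rewrite invr_gt0.
  have k1 : 1 + r0^-1 < j.+1%:R.
    by apply: lt_le_trans (Num.Theory.truncnS_gt _) _; rewrite ler_nat.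
  have rr0 : r < r0.
    by rewrite /r -[ltRHS]invrK ltf_pV2 ?posrE ?invr_gt0//; apply: lt_trans k1; rewrite ltrDr.
  have r1 : r <= 1 by rewrite invf_le1// ler1n.
  have mb : @measurable _ T (ball (x : V) r) by exact: ball_measurable.
  exists r => //; split.
    move=> y; rewrite -ball_normE /ball_/= => yr; apply: cube_norm => //.
    rewrite -(subrK x y); apply: le_lt_trans (ler_normD _ _) _; rewrite distrC.
    have := norm_cube M0 Mx; lra.
  have mbg (D : set T) : measurable_fun D (fun x : T => (g x)%:E).
    by apply/measurable_EFinP; exact: measurable_funTS.
  have mbu (D : set T) : measurable_fun D (fun x => (u x)%:E).
    by apply/measurable_EFinP; exact: measurable_funTS.
  (* On the ball the indicator of the complement of E is at most u + g, hence at most u + 2 c'. *)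
  have h1 : (mu (ball (x : V) r `\` E) <= \int[mu]_(y in (ball (x : V) r : set T)) (u y)%:E + (2 * c' * (2 * r) ^+ n)%:E)%E.
    apply: (@le_trans _ _ (\int[mu]_(y in (ball (x : V) r : set T)) (u y)%:E +
      \int[mu]_(y in (ball (x : V) r : set T)) (2 * c')%:E)%E).
      rewrite -ge0_integralD//; try (by move=> y _; rewrite lee_fin ?mulr_ge0// ltW).
      rewrite setDE -(setIT (_ `&` _)) -integral_indic//; last by apply: measurableI => //; exact: measurableC.
      rewrite [leRHS]integral_mkcond.
      apply: ge0_le_integral => //; try (by move=> y _; rewrite lee_fin).
      - by apply/measurable_EFinP; apply: measurable_indic; apply: measurableI => //; exact: measurableC.
      - apply/(measurable_restrictT _ mb); apply: emeasurable_funD => //.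
      move=> y _; rewrite patchE indicE.
      have [yb|ynb] := pselect (ball (x : V) r y); last first.
        by rewrite memNset ?memNset// => -[].
      have yb' : y \in (ball (x : V) r : set T) by exact/mem_set.
      rewrite in_setI yb' -EFinD lee_fin andTb.
      have := r0P y (le_ball (ltW rr0) yb); rewrite /= ltr_norml => /andP[gy _].
      rewrite /u indicE; have := ler_norm ((y \in ~` E)%:R - g y); lra.
    rewrite integral_cst// leeD2l// [leRHS]EFinM.
    by apply: lee_wpmul2l; [rewrite lee_fin mulr_ge0// ltW|exact: mu_ball_le].
  move/negP: jn; rewrite -ltNge => jn.
  have := lt_le_trans jn h1.
  have -> : 2 * c' * (2 * r) ^+ n = c / 2 * r ^+ n.
    by rewrite exprMn /c'; field; rewrite ?pnatr_eq0 ?expf_neq0.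
  move=> /ltW h2; rewrite -leeBlDr// in h2; apply: le_trans h2.
  rewrite -EFinB lee_fin -/c; lra.
apply: (@le_trans _ _ (mu (U `|` (Q `&` [set x | c' < u x]%R)))).
  have mS : measurable [set x | c' < u x]%R by exact: measurable_gt_set.
  apply: le_measure; rewrite ?inE//; first by apply: measurableU => //; exact: measurableI.
  move=> x Xx; have [|nS] := pselect ((Q `&` [set x | c' < u x]%R) x); first by right.
  by left; apply: XU; split.
have mS : measurable [set x | c' < u x]%R by exact: measurable_gt_set.
apply: le_trans (measureU2 _ mU (measurableI _ _ mQ mS)) _.
apply: (@le_trans _ _ ((6 ^+ n / (c / 2) * (eps / K))%:E + (c'^-1 * (eps / K))%:E)%E).
  apply: leeD => //; have := le_trans (markov_set mQ mu_ u0 c'0) gF.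
  by rewrite muleC -lee_pdivlMr// -EFinM mulrC.
by rewrite -EFinD lee_fin -mulrDl -/K mulrC divfK ?gt_eqF.
Qed.

Lemma mu_null_bigcup (F : nat -> set T) : (forall k, measurable (F k)) -> (forall k, mu (F k) = 0%E) ->
  mu (\bigcup_k F k) = 0%E.
Proof.
move=> mF F0; have mU : measurable (\bigcup_k F k) by exact: bigcupT_measurable.
apply/(measure_negligible mU).
by apply: negligible_bigcup => k; exists (F k); split.
Qed.

Lemma mu_null_sub (A B : set T) : measurable A -> measurable B -> A `<=` B -> mu B = 0%E -> mu A = 0%E.
Proof.
move=> mA mB AB B0; apply/eqP; rewrite eq_le measure_ge0 andbT -B0.
by apply: le_measure; rewrite ?inE.
Qed.

Lemma mu_null_setU (A B : set T) : measurable A -> measurable B -> mu A = 0%E -> mu B = 0%E ->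
  mu (A `|` B) = 0%E.
Proof.
move=> mA mB A0 B0; apply/eqP; rewrite eq_le measure_ge0 andbT.
by apply: (@le_trans _ _ (mu A + mu B)%E); [exact: measureU2|rewrite A0 B0 adde0].
Qed.

Lemma mu_setD_density_one (E : set T) : measurable E -> mu (E `\` density_one mu E) = 0%E.
Proof.
move=> mE; pose X M m := (E `&` cube M.+1%:R) `\` density_at E m.
have mX M m : measurable (X M m).
  by apply: measurableD; [apply: measurableI => //; exact: cube_measurable|exact: density_at_measurable].
have X0 : mu (\bigcup_M \bigcup_m X M m) = 0%E.
  apply: mu_null_bigcup => M; first exact: bigcupT_measurable.
  by apply: mu_null_bigcup => // m; exact: density_at_cube.
apply: (mu_null_sub _ _ _ X0).
- by apply: measurableD => //; exact: density_one_measurable.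
- by apply: bigcupT_measurable => M; exact: bigcupT_measurable.
- move=> x [Ex]; rewrite density_oneE// => ndx.
  have [M _ xM] : (\bigcup_k cube k.+1%:R) (x : V) by rewrite bigcup_cube.
  exists M => //; apply: contrapT => h; apply: ndx => m _; apply: contrapT => nm.
  by apply: h; exists m.
Qed.

Lemma mu_ballD_disjoint (E : set T) (x : V) (r : R) : measurable E -> 0 < r ->
  ((r ^+ n)%:E <= mu (ball x r `\` E) + mu (ball x r `&` E))%E.
Proof.
move=> mE r0; apply: le_trans (mu_ball_ge Hmu x r0) _.
have mb : @measurable _ T (ball x r) by exact: ball_measurable.
rewrite -{1}(setUIDK (ball x r) E) setUC.
by apply: measureU2; [exact: measurableD|exact: measurableI].
Qed.

Lemma density_oneC (E : set T) (x : V) : measurable E -> density_one mu E x -> ~ density_one mu (~` E) x.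
Proof.
move=> mE; rewrite !density_oneE//; last exact: measurableC.
(* With m = 2 each of the two parts of a small ball has measure at most r^n / 3, whereas the ball
   has measure at least r^n. *)
move=> /(_ 2%N Logic.I) [k kP] /(_ 2%N Logic.I) [l lP].
have := kP (maxn k l) (leq_maxl _ _); have := lP (maxn k l) (leq_maxr _ _).
set r : R := _.+1%:R^-1; have r0 : 0 < r by rewrite invr_gt0.
rewrite [_ `\` ~` _]setDE setCK => h1 h2.
have := le_trans (mu_ballD_disjoint x mE r0) (leeD h2 h1).
have : 0 < r ^+ n by rewrite exprn_gt0.
by rewrite -EFinD lee_fin; lra.
Qed.

(** Almost every point of E is a density point of E. Applied to the complement, the same fact shows
    that density points of E outside E are negligible, since no point has density one for both
    sets. *)
Lemma density_one_ae (E : set T) : measurable E -> mu (E `+` density_one mu E) = 0%E.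
Proof.
move=> mE; have mC := measurableC mE; have mD := density_one_measurable.
apply: mu_null_setU; try by apply: measurableD => //; exact: mD.
  exact: mu_setD_density_one.
apply: (mu_null_sub _ _ _ (mu_setD_density_one mC)); try by apply: measurableD => //; exact: mD.
by move=> x [dx nEx]; split => //; exact: density_oneC.
Qed.

Lemma mu_setI_congr (E F B : set T) : measurable E -> measurable F -> measurable B ->
  mu (E `+` F) = 0%E -> mu (E `&` B) = mu (F `&` B).
Proof.
move=> mE mF mB EF0.
have le (A C : set T) : measurable A -> measurable C -> mu (A `+` C) = 0%E -> (mu (A `&` B) <= mu (C `&` B))%E.
  move=> mA mC AC0; have mAC : measurable (A `+` C) by apply: measurableU; exact: measurableD.
  apply: (@le_trans _ _ (mu ((C `&` B) `|` (A `+` C)))).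
    apply: le_measure; rewrite ?inE; [exact: measurableI|by apply: measurableU => //; exact: measurableI|].
    by move=> x [Ax Bx]; have [Cx|nCx] := pselect (C x); [left|right; left].
  apply: (@le_trans _ _ (mu (C `&` B) + mu (A `+` C))%E); last by rewrite AC0 adde0.
  by apply: measureU2 => //; exact: measurableI.
apply/eqP; rewrite eq_le !le//.
by rewrite (_ : F `+` E = E `+` F)// /setY setUC.
Qed.

Lemma density_one_congr (E F : set T) : measurable E -> measurable F -> mu (E `+` F) = 0%E ->
  density_one mu E = density_one mu F.
Proof.
move=> mE mF EF0; apply/funext => x; rewrite /density_one; rewrite (_ : (fun r : R => _) = (fun r : R => fine (mu (F `&` eball x r)) / fine (mu (eball x r))))//.
apply/funext => r; rewrite (mu_setI_congr mE mF _ EF0)//.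
by apply: open_measurableV; exact: eball_open.
Qed.

Lemma density_one_idem (E : set T) : measurable E ->
  density_one mu E = density_one mu (density_one mu E).
Proof.
move=> mE; apply: density_one_congr => //; [exact: density_one_measurable|exact: density_one_ae].
Qed.

Lemma density_one_pos (E : set T) (x : V) (r : R) : measurable E -> density_one mu E x -> 0 < r ->
  (0 < mu (E `&` ball x r))%E.
Proof.
(* With m = 1 a small ball has at most q^n / 2 of its measure outside E, which is less than its
   total measure. *)
move=> mE; rewrite density_oneE// => /(_ 1%N Logic.I) [k kP] r0.
rewrite lt0e measure_ge0 andbT; apply/eqP => E0.
pose j := maxn k (Num.truncn r^-1); have := kP j (leq_maxl _ _).
set q : R := _.+1%:R^-1 => h; have q0 : 0 < q by rewrite invr_gt0.
have qr : q <= r.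
  rewrite /q -[leRHS]invrK lef_pV2 ?posrE ?invr_gt0//.
  by apply: le_trans (ltW (Num.Theory.truncnS_gt _)) _; rewrite ler_nat ltnS leq_maxr.
have mb s : 0 < s -> @measurable _ T (ball x s) by exact: ball_measurable.
have E0' : mu (ball x q `&` E) = 0%E.
  apply: (mu_null_sub _ _ _ E0); try (by apply: measurableI => //; exact: mb).
  by move=> y [yq Ey]; split => //; exact: le_ball yq.
have := le_trans (mu_ballD_disjoint x mE q0) (leeD h (lexx (mu (ball x q `&` E)))).
have : 0 < q ^+ n by rewrite exprn_gt0.
by rewrite E0' adde0 lee_fin; lra.
Qed.

Lemma density_one_closed (E : set T) (C : set V) : measurable E -> closed C -> E `<=` C ->
  density_one mu E `<=` C.
Proof.
move=> mE cC EC x dx; apply: contrapT => nCx.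
have : nbhs x (~` C) by apply: open_nbhs_nbhs; split => //; exact: closed_openC.
rewrite -nbhs_ballE => -[r /= r0 rC].
have := density_one_pos mE dx r0; rewrite (_ : E `&` ball x r = set0) ?measure0 ?ltxx//.
by apply/seteqP; split => // y [/EC Cy /rC].
Qed.

End DensityTheorem.

(** * Partitions almost everywhere, cutting by half-spaces *)

Section Energy.
Context {R : realType} {n : nat}.
Local Notation V := 'rV[R]_n.
Local Notation T := (g_sigma_algebraType (@open V)).
Context (mu : {measure set T -> \bar R}) (Hmu : is_lebesgue mu).

Lemma setY_measurable (E F : set T) : measurable E -> measurable F -> measurable (E `+` F).
Proof. by move=> mE mF; apply: measurableU; exact: measurableD. Qed.

Lemma ae_null (E : set T) : measurable E -> mu E = 0%E -> {ae mu, forall x, ~ E x}.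
Proof. by move=> mE E0; exists E; split => // x /contrapT. Qed.

Lemma null_ae (E : set T) : measurable E -> {ae mu, forall x, ~ E x} -> mu E = 0%E.
Proof.
move=> mE [Z [mZ Z0 EZ]]; apply: (mu_null_sub mE mZ _ Z0).
by move=> x Ex; apply: EZ => nE; exact: nE.
Qed.

Lemma ae_set_eq (E F : set T) : measurable E -> measurable F ->
  mu (E `+` F) = 0%E -> {ae mu, forall x, E x <-> F x}.
Proof.
move=> mE mF /(ae_null (setY_measurable mE mF)); apply: filterS => x h.
split => [Ex|Fx]; apply: contrapT => nx; apply: h; [by left|by right].
Qed.

Lemma set_eq_ae (E F : set T) : measurable E -> measurable F ->
  {ae mu, forall x, E x <-> F x} -> mu (E `+` F) = 0%E.
Proof.
move=> mE mF h; apply: null_ae; first exact: setY_measurable.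
by apply: filterS h => x [EF FE] [[Ex nF]|[Fx nE]]; [exact/nF/EF|exact/nE/FE].
Qed.

Lemma ge0_integral_ae_set (E F : set T) (f : T -> \bar R) : measurable E -> measurable F ->
  measurable_fun setT f -> (forall x, 0 <= f x)%E -> mu (E `+` F) = 0%E ->
  (\int[mu]_(x in E) f x = \int[mu]_(x in F) f x)%E.
Proof.
move=> mE mF mf f0 EF0; have mY := setY_measurable mE mF.
rewrite (ge0_negligible_integral mY mE (measurable_funTS mf) _ EF0)//.
rewrite (ge0_negligible_integral mY mF (measurable_funTS mf) _ EF0)//.
by congr (integral _ _ _); apply/seteqP; split => x [Ex nY]; split => //;
  apply: contrapT => nF; apply: nY; [left|right].
Qed.

Lemma dist_to_ge0 (S : set V) (x : V) : (0 <= dist_to S x)%E.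
Proof. by apply: le_ereal_inf_tmp => _ [y _ <-]; rewrite lee_fin enorm_ge0. Qed.

(** Openness of the strict sublevel sets is enough for Borel measurability, and this form also
    covers an empty S, where the distance is infinite. *)
Lemma dist_to_lt_open (S : set V) (c : \bar R) : open [set x : V | (dist_to S x < c)%E].
Proof.
rewrite (_ : [set x | _] = \bigcup_(y in S) [set x | ((Defs.edist x y)%:E < c)%E]).
  apply: bigcup_open => y Sy; case: c => [r| |].
  - rewrite (_ : [set x | _] = eball y r); first exact: eball_open.
    by apply/seteqP; split => x; rewrite /eball/= lte_fin /Defs.edist -enormN opprB.
  - rewrite (_ : [set x | _] = setT); first exact: openT.
    by apply/seteqP; split => x //= _; rewrite ltry.
  - rewrite (_ : [set x | _] = set0); first exact: open0.
    by apply/seteqP; split.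
apply/seteqP; split => x /=.
  by move=> /ereal_inf_lt [_ [y Sy <-] h]; exists y.
move=> [y Sy h]; apply: le_lt_trans h; apply: ereal_inf_lbound; by exists y.
Qed.

Lemma dist_to_measurable (S : set V) : measurable_fun setT (dist_to S : T -> \bar R).
Proof.
have mN : measurable_fun setT (fun x : T => (- dist_to S x)%E).
  apply: (measurability _ (ErealGenOInfty.measurableE R)).
  move=> /= _ [_ [a ->]] <-; rewrite setTI preimage_itvoy; apply: open_measurableV.
  rewrite (_ : [set x | _] = [set x : V | (dist_to S x < (- a)%:E)%E]); first exact: dist_to_lt_open.
  by apply/seteqP; split => x /=; rewrite EFinN lteNr.
rewrite (_ : dist_to S = (fun x => - - dist_to S x)%E); first exact: measurableT_comp mN.
by apply/funext => x; rewrite oppeK.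
Qed.

Lemma sigma_bar_ge0 (E G : set T) : (0 <= sigma_bar mu E G)%E.
Proof. by apply: integral_ge0 => x _; exact: dist_to_ge0. Qed.

Lemma sigma_bar_ae (E F G : set T) : measurable E -> measurable F -> measurable G ->
  mu (E `+` F) = 0%E -> sigma_bar mu E G = sigma_bar mu F G.
Proof.
move=> mE mF mG EF0; apply: ge0_integral_ae_set; try exact: setY_measurable.
- exact: dist_to_measurable.
- by move=> x; exact: dist_to_ge0.
- by rewrite -setYA [F `+` G]setYC [G `+` _]setYA setYK set0Y.
Qed.

Lemma perimeter_ae (E F : set T) : measurable E -> measurable F ->
  mu (E `+` F) = 0%E -> perimeter mu E = perimeter mu F.
Proof. exact: (@perimeter_in_ae _ _ _ Hmu setT). Qed.

(** * Families that are partitions almost everywhere *)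

Section Families.
Context {N : nat}.
Implicit Types E A B : 'I_N.+1 -> set T.

(** The pointwise counterpart of the partition identity; holding almost everywhere, it passes
    through cuts and limits more easily than a sum of measures. *)
Definition exactly_one E (x : T) : Prop := exists i, E i x /\ forall j, E j x -> j = i.

Lemma exactly_one_inj E x i j : exactly_one E x -> E i x -> E j x -> i = j.
Proof. by move=> [k [_ h]] /h -> /h ->. Qed.

Lemma exactly_one_sum E (Q : set T) : (forall i, measurable (E i)) -> measurable Q ->
  {ae mu, forall x, exactly_one E x} -> (\sum_(i < N.+1) mu (E i `&` Q) = mu Q)%E.
Proof.
move=> mE mQ [Z [mZ Z0 EZ]].
pose G i := E i `&` Q `\` Z.
have mG i : measurable (G i) by apply: measurableD => //; exact: measurableI.
have nullD (X : set T) : measurable X -> mu X = mu (X `\` Z).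
  move=> mX; rewrite -[X in mu X = _]setIT -[X in _ = mu X]setIT.
  apply: (@mu_setI_congr _ _ mu) => //; first exact: measurableD.
  apply: (mu_null_sub _ mZ _ Z0); first by apply: setY_measurable => //; exact: measurableD.
  by move=> x [[Xx h]|[[Xx _] h]]; [apply: contrapT => nZ; exact: h|].
have GE i : mu (E i `&` Q) = mu (G i) by rewrite nullD//; exact: measurableI.
rewrite (eq_bigr (fun i => mu (G i)))// -(@measure_bigsetU_ord _ _ _ mu _ xpredT)//.
  rewrite [RHS]nullD//; congr (mu _); rewrite -bigcup_mkord_ord.
  apply/seteqP; split => [x [i _ [[_ Qx] nZ]]//|x [Qx nZ]].
  have [i [Ex _]] : exactly_one E x by apply: contrapT => h; apply: nZ; exact: EZ.
  by exists i; rewrite /= ?inord_val.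
move=> i j _ _ [x [[[Ei _] nZ] [[Ej _] _]]].
by apply: (exactly_one_inj _ Ei Ej); apply: contrapT => h; apply: nZ; exact: EZ.
Qed.

Lemma hbox_bigcup_cbox (a b : V) :
  hbox a b = \bigcup_k cbox (a + const_mx (k.+1%:R^-1)) b.
Proof.
apply/seteqP; split => [x xab|x [k _ xk] i]; last first.
  have := xk i; rewrite !mxE => /andP[h ->]; rewrite andbT.
  by apply: lt_le_trans h; rewrite ltrDl invr_gt0.
have : \forall k \near \oo, forall i, a ord0 i + k.+1%:R^-1 <= x ord0 i.
  apply: filter_forall => i; have /andP[ax _] := xab i.
  have ax0 : 0 < x ord0 i - a ord0 i by rewrite subr_gt0.
  near=> k; rewrite -lerBrDl; apply: ltW.
  by near: k; exact: (near_infty_natSinv_lt (PosNum ax0)).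
case=> k _ /(_ k (leqnn k)) h; exists k => // i; have /andP[_ xb] := xab i.
by rewrite !mxE h.
Unshelve. all: end_near. Qed.

(** The identity is assumed on compact sets only. The sum of the restricted measures is itself a
    measure; it agrees with [mu] on closed boxes, on half-open boxes by monotone limits, and on
    Borel sets by uniqueness. *)
Lemma partition_sum A (F : set T) : (forall i, measurable (A i)) ->
  (forall Q : set V, compact Q -> \sum_(i < N.+1) mu (A i `&` Q) = mu Q)%E ->
  measurable F -> (\sum_(i < N.+1) mu (A i `&` F) = mu F)%E.
Proof.
move=> mA Asum mF.
pose m1 : {measure set T -> \bar R} := msum (fun k => mrestr mu (mA (inord k))) N.+1.
have m1E (G : set T) : m1 G = (\sum_(i < N.+1) mu (A i `&` G))%E.
  by apply: eq_bigr => i _; rewrite /= /mrestr setIC inord_val.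
rewrite -m1E.
have box (a b : V) : (forall i, a ord0 i <= b ord0 i) -> m1 (hbox a b) = mu (hbox a b).
  move=> ab; pose K k : set T := cbox (a + const_mx (k.+1%:R^-1)) b.
  have mK k : measurable (K k).
    by apply: closed_measurableV; apply: compact_closed => //; exact: cbox_compact.
  have KK : nondecreasing_seq K.
    move=> k l kl; apply/subsetPset => x xk i; have := xk i; rewrite !mxE => /andP[h ->].
    rewrite andbT; apply: le_trans h; rewrite lerD2l lef_pV2 ?posrE// ler_nat ltnS.
    exact: kl.
  rewrite hbox_bigcup_cbox.
  have cvK (m : {measure set T -> \bar R}) : m (K k) @[k --> \oo] --> m (\bigcup_k K k).
    by apply: nondecreasing_cvg_mu => //; exact: bigcupT_measurable.
  rewrite -(cvg_lim _ (cvK m1))// -(cvg_lim _ (cvK mu))//; congr (limn _); apply/funext => k /=.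
  by rewrite m1E Asum//; exact: cbox_compact.
apply: (borel_measure_unique (m1 := m1) (m2 := mu)) => //.
move=> a b ab; rewrite box//; apply: le_lt_trans (mu_compact_lty Hmu (@cbox_compact R n a b)).
apply: le_measure; rewrite ?inE; [exact: hbox_measurable| |].
  by apply: closed_measurableV; apply: compact_closed => //; exact: cbox_compact.
by move=> x xab i; have /andP[/ltW -> ->] := xab i.
Qed.

(** Tested on the set that no chamber covers, the identity shows that this set is null. Tested on
    the overlap of two chambers it counts the overlap twice; intersecting with cubes makes the
    measure finite, so that it can be cancelled. *)
Lemma partition_exactly_one A : (forall i, measurable (A i)) ->
  (forall Q : set V, compact Q -> \sum_(i < N.+1) mu (A i `&` Q) = mu Q)%E ->
  {ae mu, forall x, exactly_one A x}.
Proof.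
move=> mA Asum; have sumE (F : set T) : measurable F -> _ := partition_sum (F := F) mA Asum.
have h1 : {ae mu, forall x, ~ (\bigcap_i ~` A i) x}.
  have mW : measurable (\bigcap_i ~` A i).
    by apply: fin_bigcap_measurable => [|i _]; [exact: finite_finset|exact: measurableC].
  apply: ae_null => //; rewrite -sumE// big1// => i _.
  rewrite (_ : A i `&` _ = set0) ?measure0//.
  by apply/seteqP; split => // x [Ax /(_ i Logic.I)].
have h2 i j : i != j -> {ae mu, forall x, ~ (A i `&` A j) x}.
  move=> ij; have mAA : measurable (A i `&` A j) by exact: measurableI.
  apply: ae_null => //; pose X M : set T := A i `&` A j `&` cube M.+1%:R.
  have mX M : measurable (X M) by apply: measurableI => //; exact: cube_measurable.
  rewrite (_ : A i `&` A j = \bigcup_M X M); last first.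
    by rewrite -setI_bigcupr bigcup_cube setIT.
  apply: mu_null_bigcup => // M.
  have fX : mu (X M) \is a fin_num.
    apply: (mu_lty_sub (mX M) (@cube_measurable _ _ M.+1%:R)); first exact: subIsetr.
    by rewrite mu_cube ?ltry.
  have := sumE (X M) (mX M); rewrite (bigD1 i)//= (bigD1 j) 1?eq_sym//=.
  have Xi k : k = i \/ k = j -> A k `&` X M = X M.
    by move=> ek; apply/setIidPr => x [[Ai Aj] _]; case: ek => ->.
  rewrite !Xi; [|by right|by left].
  set s := (\sum_(_ < _ | _) _)%E => h.
  have s0 : (0 <= s)%E by apply: sume_ge0.
  have : (mu (X M) + mu (X M) <= mu (X M))%E by rewrite -{3}h addeA leeDl.
  rewrite -(fineK fX) -EFinD lee_fin => hle; congr EFin.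
  have : 0 <= fine (mu (X M)) by exact: fine_ge0.
  lra.
have h3 : {ae mu, forall x, forall i j, i != j -> ~ (A i `&` A j) x}.
  apply: filter_forall => i; apply: filter_forall => j.
  by have [->|ij] := eqVneq i j; [apply: filterE|apply: filterS (h2 i j ij)].
apply: filterS2 h1 h3 => x n1 n2.
have [i Ai] : exists i, A i x.
  by apply: contrapT => h; apply: n1 => i _ Ai; apply: h; exists i.
exists i; split => // j Aj; apply: contrapT => /eqP ji; exact: (n2 j i ji).
Qed.

Lemma density_one_bounded (E : set T) : measurable E -> Defs.bounded_set E ->
  Defs.bounded_set (density_one mu E).
Proof.
move=> mE /bounded_set_norm [M EM]; exists (n%:R * M) => x dx.
apply: le_trans (enorm_le_norm x) _; rewrite ler_wpM2l//.
apply: (density_one_closed (C := [set x : V | `|x| <= M]) Hmu mE) => //.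
rewrite -[X in closed X]/((fun x : V => `|x|) @^-1` [set y | y <= M]).
by apply: closed_comp => [y _|]; [exact: norm_continuous|exact: closed_le].
Qed.

(** Perimeter and distance terms ignore null sets, and replacing each chamber by its density points
    is a null modification after which the chamber equals its own density set. *)
Lemma normalise E A (lambda : R) : (forall i, measurable (E i)) -> (forall i, measurable (A i)) ->
  {ae mu, forall x, exactly_one E x} -> (forall i, perimeter mu (E i) < +oo)%E ->
  (forall i, i != ord_max -> Defs.bounded_set (E i)) ->
  let B i := density_one mu (E i) in
  partition_b mu B /\ Fenergy mu B A lambda = Fenergy mu E A lambda.
Proof.
move=> mE mA oneE PE bE B.
have mB i : @measurable _ T (B i) by exact: density_one_measurable.
have EB i : mu (E i `+` B i) = 0%E by exact: density_one_ae.
have PB i : perimeter mu (B i) = perimeter mu (E i) by apply/esym; exact: perimeter_ae.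
have oneB : {ae mu, forall x, exactly_one B x}.
  have h : {ae mu, forall x, forall i, E i x <-> B i x}.
    by apply: filter_forall => i; exact: ae_set_eq.
  apply: filterS2 oneE h => x [i [Ei uE]] EBx; exists i; split; first exact/EBx.
  by move=> j /EBx; exact: uE.
split.
  split; last by move=> i im; apply: density_one_bounded => //; exact: bE.
  split; [|split].
  - move=> i; split=> // r r0; apply: le_lt_trans (perimeter_in_le _ _ _) _.
    by rewrite PB.
  - move=> Q cQ; apply: exactly_one_sum => //.
    by apply: closed_measurableV; apply: compact_closed.
  - by move=> i; exact: density_one_idem.
rewrite /Fenergy; congr (_ * _ + _ * _)%E; apply: eq_bigr => i _ //.
apply/esym/sigma_bar_ae => //; exact: mA.
Qed.

Definition bounded_part E : set T := \bigcup_(i in [set i | i != ord_max]) E i.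

Lemma bounded_part_measurable E : (forall i, measurable (E i)) -> measurable (bounded_part E).
Proof. by move=> mE; apply: fin_bigcup_measurable => //; exact: finite_finset. Qed.

Lemma bounded_part_bounded E : (forall i, i != ord_max -> Defs.bounded_set (E i)) ->
  Defs.bounded_set (bounded_part E).
Proof.
move=> bE; have /choice [M EM] : forall i, exists M : R, i != ord_max -> forall x, E i x -> enorm x <= M.
  by move=> i; have [->|/bE [M EM]] := eqVneq i ord_max; [exists 0|exists M].
exists (\sum_i `|M i|) => x [i /= im /(EM i im) xM].
apply: le_trans xM _; apply: le_trans (ler_norm _) _.
by rewrite (bigD1 i)//= lerDl sumr_ge0.
Qed.

Lemma bounded_part_ae E : {ae mu, forall x, exactly_one E x} ->
  {ae mu, forall x, bounded_part E x <-> (~` E ord_max) x}.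
Proof.
apply: filterS => x one; split=> [[i /= im Ei] Em|nEm].
  by move/eqP: im; apply; exact: exactly_one_inj one Ei Em.
have [i [Ei _]] := one; exists i => //=; apply/eqP => im; apply: nEm; by rewrite -im.
Qed.

(** Reduces the last chamber to a bounded set, as required by [perimeter_cut] and
    [perimeter_lty]. *)
Lemma perimeter_bounded_part E : (forall i, measurable (E i)) ->
  {ae mu, forall x, exactly_one E x} ->
  perimeter mu (E ord_max) = perimeter mu (bounded_part E).
Proof.
move=> mE oneE; rewrite /perimeter -perimeter_inC//; apply/esym/perimeter_in_ae => //.
- exact: bounded_part_measurable.
- exact: measurableC.
- apply: set_eq_ae; [exact: bounded_part_measurable|exact: measurableC|exact: bounded_part_ae].
Qed.

Lemma partition_b_perimeter A : partition_b mu A -> forall i, (perimeter mu (A i) < +oo)%E.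
Proof.
move=> [[lA [sA _]] bA] i; have mA j : measurable (A j) by have [] := lA j.
have oneA := partition_exactly_one mA sA.
have [->|im] := eqVneq i ord_max; last exact: perimeter_lty (bA i im) (lA i).
rewrite perimeter_bounded_part//; apply: perimeter_lty; first exact: bounded_part_bounded.
split=> [|r r0]; first exact: bounded_part_measurable.
rewrite (@perimeter_in_ae _ _ _ Hmu _ _ (~` A ord_max)).
- by rewrite perimeter_inC//; exact: (lA ord_max).2.
- exact: bounded_part_measurable.
- exact: measurableC.
- apply: set_eq_ae; [exact: bounded_part_measurable|exact: measurableC|exact: bounded_part_ae].
Qed.

Lemma ge0_integral_ae_le (E F : set T) (f : T -> \bar R) : measurable E -> measurable F ->
  measurable_fun setT f -> (forall x, 0 <= f x)%E -> {ae mu, forall x, E x -> F x} ->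
  (\int[mu]_(x in E) f x <= \int[mu]_(x in F) f x)%E.
Proof.
move=> mE mF mf f0 EF; rewrite (@ge0_integral_ae_set E (E `&` F))//; last first.
- apply: set_eq_ae => //; first exact: measurableI.
  by apply: filterS EF => x h; split=> [Ex|[]//]; split => //; exact: h.
- exact: measurableI.
by apply: ge0_subset_integral => //; [exact: measurableI|exact: measurable_funTS].
Qed.

Definition cut_family (H : set T) E (i : 'I_N.+1) : set T :=
  if i == ord_max then E i `|` ~` H else E i `&` H.

Lemma cut_family_measurable (H : set T) E : measurable H -> (forall i, measurable (E i)) ->
  forall i, measurable (cut_family H E i).
Proof.
move=> mH mE i; rewrite /cut_family; case: ifP => _; last exact: measurableI.
by apply: measurableU => //; exact: measurableC.
Qed.

Lemma cut_family_exactly_one (H : set T) E x : exactly_one E x -> exactly_one (cut_family H E) x.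
Proof.
move=> [i [Ei uE]]; rewrite /cut_family; have [Hx|nHx] := pselect (H x).
  exists i; split; first by case: ifP => _; [left|].
  by move=> j; case: ifP => _; [case=> [|/(_ Hx)//]; exact: uE|case=> /uE].
exists ord_max; rewrite eqxx; split; first by right.
by move=> j; case: ifPn => [/eqP ->|_ []].
Qed.

Lemma cut_family_le (H : set T) E i : i != ord_max -> cut_family H E i `<=` E i.
Proof. by move=> /negPf im; rewrite /cut_family im; exact: subIsetl. Qed.

(** * Effect of a half-space cut on each energy term *)

Section Cut.
Context E A (nu : V) (t : R).
Hypothesis mE : forall i, measurable (E i).
Hypothesis mA : forall i, measurable (A i).
Hypothesis oneE : {ae mu, forall x, exactly_one E x}.
Hypothesis oneA : {ae mu, forall x, exactly_one A x}.
Hypothesis bE : forall i, i != ord_max -> Defs.bounded_set (E i).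
Hypothesis nu1 : enorm nu = 1.
Let H : set T := halfspace nu t.
Hypothesis AH : forall i, i != ord_max -> A i `<=` H.
Let mH : measurable H.
Proof. exact: (closed_measurableV (@halfspace_closed _ _ nu t)). Qed.

Lemma perimeter_cut_family i : (perimeter mu (cut_family H E i) <= perimeter mu (E i))%E.
Proof.
have [->|im] := eqVneq i ord_max; last first.
  by rewrite /cut_family (negPf im); apply: perimeter_cut => //; exact: bE.
have mC := cut_family_measurable mH mE.
have oneC : {ae mu, forall x, exactly_one (cut_family H E) x}.
  by apply: filterS oneE => x; exact: cut_family_exactly_one.
rewrite !perimeter_bounded_part//.
have -> : bounded_part (cut_family H E) = bounded_part E `&` H.
  rewrite setI_bigcupl; apply: eq_bigcupr => j /= jm.
  by rewrite /cut_family (negPf jm).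
apply: perimeter_cut => //; [exact: bounded_part_measurable|exact: bounded_part_bounded].
Qed.

(** Almost every point beyond the half-space belongs to the last chamber of A, the others lying
    inside H. What the cut adds to the last chamber thus leaves the symmetric difference. *)
Lemma sigma_bar_cut_family_max :
  (sigma_bar mu (cut_family H E ord_max) (A ord_max) <= sigma_bar mu (E ord_max) (A ord_max))%E.
Proof.
apply: ge0_integral_ae_le; try (by apply: setY_measurable => //; exact: cut_family_measurable).
- exact: dist_to_measurable.
- by move=> x; exact: dist_to_ge0.
apply: filterS oneA => x [i [Ai uA]]; rewrite /cut_family eqxx.
move=> [[[Ex|nHx] nAx]|[Ax /not_orP[nEx _]]]; [by left| |by right].
exfalso; apply: nAx; have [<-//|im] := eqVneq i ord_max.
by exfalso; apply: nHx; exact: AH im _ Ai.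
Qed.

(** As A i lies in H, the removed piece of E i is disjoint from A i and belongs to the symmetric
    difference. An exact identity is kept because its integral term is the strict gain behind the
    hull property. *)
Lemma sigma_bar_cut_family i : i != ord_max ->
  (sigma_bar mu (cut_family H E i) (A i) +
   \int[mu]_(x in E i `\` H) dist_to (tboundary (A i)) x = sigma_bar mu (E i) (A i))%E.
Proof.
move=> im; have mC := cut_family_measurable mH mE i.
rewrite /sigma_bar -ge0_integral_setU//=; first last.
- apply/disj_setPS => x [hx [Ex nHx]]; move: hx; rewrite /cut_family (negPf im).
  by move=> [[[_ //]]|[/(AH im)]].
- by move=> x _; exact: dist_to_ge0.
- by apply: measurable_funTS; exact: dist_to_measurable.
- exact: measurableD.
- exact: setY_measurable.
congr (integral _ _ _); rewrite /cut_family (negPf im).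
apply/seteqP; split => x; have AHx := AH im (t := x).
  by move=> [[[[Ex Hx] nA]|[Ax nEH]]|[Ex nH]]; [left|right; split => // Ex; apply: nEH; split => //; exact: AHx|left; split => // /AHx].
have [Hx|nHx] := pselect (H x); move=> [[Ex nA]|[Ax nE]].
- by left; left.
- by left; right; split => // -[].
- by right.
- by exfalso; exact/nHx/AHx.
Qed.

End Cut.

End Families.
End Energy.

(** * Confinement to a cube *)

Section Confine.
Context {R : realType} {n : nat}.
Local Notation V := 'rV[R]_n.
Local Notation T := (g_sigma_algebraType (@open V)).
Context (mu : {measure set T -> \bar R}) (Hmu : is_lebesgue mu).
Context {N : nat}.
Implicit Types E A B : 'I_N.+1 -> set T.

Lemma Fenergy_ge0 E A (lambda : R) : 0 <= lambda -> (0 <= Fenergy mu E A lambda)%E.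
Proof.
move=> l0; apply: adde_ge0; apply: mule_ge0; rewrite ?lee_fin ?divr_ge0//.
- by apply: sume_ge0 => i _; exact: perimeter_ge0.
- by apply: sume_ge0 => i _; exact: sigma_bar_ge0.
Qed.

Lemma perimeter_Fenergy E A (lambda : R) i : 0 <= lambda ->
  (perimeter mu (E i) <= 2%:E * Fenergy mu E A lambda)%E.
Proof.
move=> l0; apply: (@le_trans _ _ (2%:E * (2^-1%:E * \sum_(j < N.+1) perimeter mu (E j)))%E).
  rewrite muleA -EFinM divff ?pnatr_eq0// mul1e (bigD1 i)//= leeDl//.
  by apply: sume_ge0 => j _; exact: perimeter_ge0.
apply: lee_wpmul2l => //; rewrite leeDl//; apply: mule_ge0; first by rewrite lee_fin divr_ge0.
by apply: sume_ge0 => j _; exact: sigma_bar_ge0.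
Qed.

Lemma sigma_bar_Fenergy E A (lambda : R) i : 0 <= lambda ->
  ((lambda / 2)%:E * sigma_bar mu (E i) (A i) <= Fenergy mu E A lambda)%E.
Proof.
move=> l0; apply: (@le_trans _ _ ((lambda / 2)%:E * \sum_(j < N.+1) sigma_bar mu (E j) (A j))%E).
  apply: lee_wpmul2l; first by rewrite lee_fin divr_ge0.
  rewrite (bigD1 i)//= leeDl//.
  by apply: sume_ge0 => j _; exact: sigma_bar_ge0.
rewrite leeDr//; apply: mule_ge0 => //.
by apply: sume_ge0 => j _; exact: perimeter_ge0.
Qed.

Lemma sigma_bar_id (E : set T) : sigma_bar mu E E = 0%E.
Proof. by rewrite /sigma_bar setYK integral_set0. Qed.

Lemma Fenergy_self_lty A (lambda : R) : partition_b mu A -> (Fenergy mu A A lambda < +oo)%E.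
Proof.
move=> pA; rewrite /Fenergy [X in (_ + _ * X)%E]big1 => [|i _]; last exact: sigma_bar_id.
rewrite mule0 adde0.
by apply: lte_mul_pinfty => //; apply: lte_sum_pinfty => i _; exact: partition_b_perimeter.
Qed.

(** The gain stands on the left as a summand, so that no possibly infinite quantities are
    subtracted. *)
Lemma Fenergy_cut E A (lambda : R) nu t i : 0 <= lambda ->
  (forall i, measurable (E i)) -> (forall i, measurable (A i)) ->
  {ae mu, forall x, exactly_one E x} -> {ae mu, forall x, exactly_one A x} ->
  (forall i, i != ord_max -> Defs.bounded_set (E i)) -> enorm nu = 1 ->
  (forall i, i != ord_max -> A i `<=` halfspace nu t) -> i != ord_max ->
  (Fenergy mu (cut_family (halfspace nu t) E) A lambda +
    (lambda / 2)%:E * \int[mu]_(x in E i `\` halfspace nu t) dist_to (tboundary (A i)) x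
   <= Fenergy mu E A lambda)%E.
Proof.
move=> l0 mE mA oneE oneA bE nu1 AH im; set H : set T := halfspace nu t.
have l20 : (0 <= (lambda / 2)%:E)%E by rewrite lee_fin divr_ge0.
set I := (\int[mu]_(x in _) _)%E; have I0 : (0 <= I)%E.
  by apply: integral_ge0 => x _; exact: dist_to_ge0.
have s0 (F : 'I_N.+1 -> set T) j : (0 <= sigma_bar mu (F j) (A j))%E by exact: sigma_bar_ge0.
rewrite /Fenergy -addeA; apply: leeD.
  apply: lee_wpmul2l => //; apply: lee_sum => j _; exact: perimeter_cut_family.
rewrite -ge0_muleDr//; last by apply: sume_ge0.
apply: lee_wpmul2l => //; rewrite (bigD1 i)//= [leRHS](bigD1 i)//= addeAC; apply: leeD.
  by rewrite sigma_bar_cut_family.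
apply: lee_sum => j ji; have [->|jm] := eqVneq j ord_max.
  exact: sigma_bar_cut_family_max.
by rewrite -[leRHS](sigma_bar_cut_family mu mE mA AH jm) leeDl// integral_ge0// => x _; exact: dist_to_ge0.
Qed.

Lemma confine_halfspaces A (lambda : R) (s : seq (V * R)) : (0 < N)%N -> 0 <= lambda ->
  (forall i, measurable (A i)) -> {ae mu, forall x, exactly_one A x} ->
  (forall c, c \in s -> enorm c.1 = 1 /\ forall i, i != ord_max -> A i `<=` halfspace c.1 c.2) ->
  forall E, (forall i, measurable (E i)) -> {ae mu, forall x, exactly_one E x} ->
  (forall i, i != ord_max -> Defs.bounded_set (E i)) ->
  exists E', [/\ forall i, measurable (E' i), {ae mu, forall x, exactly_one E' x},
    forall i, i != ord_max -> E' i `<=` E i,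
    forall i c, i != ord_max -> c \in s -> E' i `<=` halfspace c.1 c.2 &
    (Fenergy mu E' A lambda <= Fenergy mu E A lambda)%E].
Proof.
move=> N0 l0 mA oneA; elim: s => [|c s IH] sP E mE oneE bE; first by exists E; split => // i _; exact: subset_refl.
have [c1 cA] := sP c (mem_head _ _).
have mH := closed_measurableV (halfspace_closed (nu := c.1) (t := c.2)).
have [||||E' [mE' oneE' E'E E's FE']] := IH _ (cut_family (halfspace c.1 c.2) E).
- by move=> d ds; apply: sP; rewrite inE ds orbT.
- exact: cut_family_measurable.
- by apply: filterS oneE => x; exact: cut_family_exactly_one.
- move=> i im; have [M EM] := bE i im; exists M => x /(cut_family_le im); exact: EM.
exists E'; split => //.
- by move=> i im; apply: subset_trans (E'E i im) _; exact: cut_family_le.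
- move=> i d im; rewrite inE => /predU1P[->|]; last exact: E's.
  by apply: subset_trans (E'E i im) _; rewrite /cut_family (negPf im); exact: subIsetr.
- apply: le_trans FE' _.
  (* Since N > 0, the index 0 is a bounded chamber; its gain is discarded here. *)
  have i0 : (ord0 : 'I_N.+1) != ord_max by rewrite -val_eqE /= eq_sym -lt0n.
  apply: le_trans (Fenergy_cut l0 mE mA oneE oneA bE c1 cA i0); rewrite leeDl//.
  by apply: mule_ge0; [rewrite lee_fin divr_ge0|apply: integral_ge0 => x _; exact: dist_to_ge0].
Qed.

Lemma dot_evec (x : V) j : dot x (evec R j) = x ord0 j.
Proof.
rewrite /dot (bigD1 j)//= big1 ?addr0 => [|i ij]; first by rewrite mxE !eqxx mulr1.
by rewrite mxE eqxx (negPf ij) mulr0.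
Qed.

Lemma enorm_evec (j : 'I_n) : enorm (evec R j) = 1.
Proof.
have /eqP := dotxx (evec R j); rewrite dot_evec mxE !eqxx /= eq_sym => h.
by apply/eqP; rewrite -(@eqrXn2 _ 2%N) ?enorm_ge0// expr1n sqr_enorm.
Qed.

(** L depends on A only, so it serves a whole minimizing sequence at once. *)
Lemma confine A (lambda : R) : (0 < N)%N -> 0 <= lambda -> partition_b mu A ->
  exists2 L : R, 0 < L & forall B, partition_b mu B -> exists E,
    [/\ forall i, measurable (E i), {ae mu, forall x, exactly_one E x},
      forall i, i != ord_max -> E i `<=` cube L &
      (Fenergy mu E A lambda <= Fenergy mu B A lambda)%E].
Proof.
move=> N0 l0 [[lA [sA _]] bA]; have mA i : measurable (A i) by have [] := lA i.
have oneA := partition_exactly_one Hmu mA sA.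
have [M0 AM0] := bounded_set_norm (bounded_part_bounded bA).
pose M : R := `|M0|; have AM i x : i != ord_max -> A i x -> `|x| <= M.
  by move=> im Ax; apply: le_trans (ler_norm _); apply: AM0; exists i.
have M10 : 0 < M + 1 by rewrite ltr_wpDl ?normr_ge0.
(* The 2 n coordinate half-spaces bounding the sup-norm ball of radius M; the cube gets half-side M
   + 1 because it is half-open. *)
pose s : seq (V * R) := [seq (evec R j, M) | j <- enum 'I_n] ++ [seq (- evec R j, M) | j <- enum 'I_n].
exists (M + 1) => // B [[lB [sB _]] bB]; have mB i : measurable (B i) by have [] := lB i.
have [||E [mE oneE EB Es FE]] := @confine_halfspaces A lambda s N0 l0 mA oneA _ B mB _ bB.
- move=> c; rewrite mem_cat => /orP[] /mapP[j _ ->] /=.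
    split=> [|i im x Ax]; first exact: enorm_evec.
    rewrite /halfspace/= dot_evec; apply: le_trans (AM i x im Ax).
    by apply: le_trans (ler_norm _) _; exact: coord_le_norm.
  split=> [|i im x Ax]; first by rewrite enormN enorm_evec.
  rewrite /halfspace/= dotC dotNl dotC dot_evec; apply: le_trans (AM i x im Ax).
  by apply: le_trans (coord_le_norm x j); rewrite -normrN ler_norm.
- exact: partition_exactly_one.
exists E; split => // i im x Ex; apply: cube_norm => //.
apply: (@le_lt_trans _ _ M); last by rewrite ltrDl.
apply/norm_leP => [|j]; first exact: normr_ge0.
rewrite ler_norml; apply/andP; split.
  have /(_ x Ex) : E i `<=` halfspace (- evec R j) M.
    by apply: (Es i (- evec R j, M)) => //; rewrite mem_cat; apply/orP; right; apply/mapP; exists j; rewrite ?mem_enum.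
  by rewrite /halfspace/= dotC dotNl dotC dot_evec lerNl.
have /(_ x Ex) : E i `<=` halfspace (evec R j) M.
  by apply: (Es i (evec R j, M)) => //; rewrite mem_cat; apply/orP; left; apply/mapP; exists j; rewrite ?mem_enum.
by rewrite /halfspace/= dot_evec.
Qed.

End Confine.

(** * Lower semicontinuity *)

Section LiminfLemmas.
Context {R : realType}.
Implicit Types u v : nat -> \bar R.
Local Open Scope ereal_scope.

Lemma le_limn_einf u v : (forall k, u k <= v k) -> limn_einf u <= limn_einf v.
Proof.
move=> uv; rewrite !limn_einf_lim; apply: lee_lim; try exact: is_cvg_einfs.
apply: nearW => k; apply: le_ereal_inf_tmp => _ [j /= kj <-].
by apply: le_trans (uv j); apply: ereal_inf_lbound; exists j.
Qed.

Lemma einfs_ge0 u k : (forall k, 0 <= u k) -> 0 <= einfs u k.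
Proof. by move=> u0; apply: le_ereal_inf_tmp => _ [j /= kj <-]. Qed.

Lemma limn_einf_ge0 u : (forall k, 0 <= u k) -> 0 <= limn_einf u.
Proof.
move=> u0; rewrite limn_einf_lim; apply: lime_ge; first exact: is_cvg_einfs.
by apply: nearW => k; exact: einfs_ge0.
Qed.

Lemma limn_einfD u v : (forall k, 0 <= u k) -> (forall k, 0 <= v k) ->
  limn_einf u + limn_einf v <= limn_einf (fun k => u k + v k).
Proof.
move=> u0 v0; rewrite !limn_einf_lim -limeD; try exact: is_cvg_einfs; last first.
  by apply: ge0_adde_def; rewrite inE -limn_einf_lim limn_einf_ge0.
apply: lee_lim; [|exact: is_cvg_einfs|].
  apply: is_cvgeD; try exact: is_cvg_einfs.
  by apply: ge0_adde_def; rewrite inE -limn_einf_lim limn_einf_ge0.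
apply: nearW => k; apply: le_ereal_inf_tmp => _ [j /= kj <-].
by apply: leeD; apply: ereal_inf_lbound; exists j.
Qed.

Lemma limn_einf_sum (I : Type) (s : seq I) (u : I -> nat -> \bar R) : (forall i k, 0 <= u i k) ->
  \sum_(i <- s) limn_einf (u i) <= limn_einf (fun k => \sum_(i <- s) u i k).
Proof.
move=> u0; elim: s => [|i s IH].
  by rewrite big_nil; apply: limn_einf_ge0 => k; rewrite big_nil.
rewrite big_cons; apply: le_trans (leeD (lexx _) IH) _.
apply: le_trans (limn_einfD _ _) _ => //; first by move=> k; apply: sume_ge0.
by apply: le_limn_einf => k; rewrite big_cons.
Qed.

Lemma limn_einfZ (c : R) u : (0 <= c)%R -> c%:E * limn_einf u <= limn_einf (fun k => c%:E * u k).
Proof.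
move=> c0; rewrite !limn_einf_lim -limeMl//; last exact: is_cvg_einfs.
apply: lee_lim; [by apply: is_cvgeZl => //; exact: is_cvg_einfs|exact: is_cvg_einfs|].
apply: nearW => k; apply: le_ereal_inf_tmp => _ [j /= kj <-].
by apply: lee_wpmul2l; rewrite ?lee_fin//; apply: ereal_inf_lbound; exists j.
Qed.

Lemma cvg_le_limn_einf u v l : u @ \oo --> l -> (forall k, u k <= v k) -> l <= limn_einf v.
Proof. by move=> /cvg_limn_einf_sup[<- _] uv; exact: le_limn_einf. Qed.

Lemma measurable_fun_limn_einf d (X : measurableType d) (D : set X) (f : nat -> X -> \bar R) :
  (forall k, measurable_fun D (f k)) -> measurable_fun D (fun x => limn_einf (f ^~ x)).
Proof.
move=> mf; rewrite /limn_einf; apply: measurableT_comp => //.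
apply: (measurable_fun_limn_esup (f := fun k x => - f k x)) => k.
exact: measurableT_comp.
Qed.

End LiminfLemmas.

(** * Lower semicontinuity under almost everywhere eventual equality *)

Section Lsc.
Context {R : realType} {n : nat}.
Local Notation V := 'rV[R]_n.
Local Notation T := (g_sigma_algebraType (@open V)).
Context (mu : {measure set T -> \bar R}) (Hmu : is_lebesgue mu).

(** For a fixed test field the fluxes converge by dominated convergence, and a supremum of
    continuous functionals is lower semicontinuous. *)
Lemma perimeter_lsc (F : nat -> set T) (E : set T) :
  (forall k, measurable (F k)) -> measurable E ->
  {ae mu, forall x, \forall k \near \oo, F k x <-> E x} ->
  (perimeter mu E <= limn_einf (fun k => perimeter mu (F k)))%E.
Proof.
move=> mF mE FE; apply: perimeter_le => phi fp; have [Cphi _] := fp.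
pose f k (x : T) := (\1_(F k) x * Defs.div phi x)%:E.
have mdiv : measurable_fun setT (Defs.div phi : T -> R) by exact: div_measurable.
have intE (D : set T) : measurable D -> (\int[mu]_(x in D) (Defs.div phi x)%:E =
    \int[mu]_x (\1_D x * Defs.div phi x)%:E)%E.
  move=> mD; rewrite integral_mkcond; apply: eq_integral => x _; rewrite patchE indicE.
  by case: ifP => _; rewrite ?mul1r ?mul0r.
have idiv : mu.-integrable setT (fun x : T => (`|Defs.div phi x|)%:E).
  have : mu.-integrable setT (fun x : T => (Defs.div phi x)%:E) by exact: div_integrable.
  by move=> /integrable_norm.
have [] := @dominated_convergence _ _ _ mu setT measurableT f
    (fun x => (\1_E x * Defs.div phi x)%:E) (fun x => (`|Defs.div phi x|)%:E) => //.
- move=> k; apply/measurable_EFinP; apply: measurable_funM => //; exact: measurable_indic.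
- apply/measurable_EFinP; apply: measurable_funM => //; exact: measurable_indic.
- apply: filterS FE => x h _; apply: cvg_near_cst; apply: filterS h => k [h1 h2].
  rewrite /f !indicE; congr (_%:R * _)%:E; congr (nat_of_bool _).
  by apply/idP/idP => /set_mem h; apply/mem_set; [exact: h1|exact: h2].
- apply: aeW => x k _; rewrite /f lee_fin normrM ler_piMl// indicE.
  by rewrite ger0_norm//; case: (_ \in _); rewrite ?lexx ?ler01.
move=> _ _ cv; rewrite intE//; apply: (cvg_le_limn_einf cv) => k.
by apply: le_trans (perimeter_ub mu (F k) fp); rewrite intE.
Qed.

(** Fatou's lemma is used because the distance may be infinite and supplies no integrable bound; at
    almost every point the restricted integrand is eventually constant. *)
Lemma sigma_bar_lsc (F : nat -> set T) (E G : set T) :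
  (forall k, measurable (F k)) -> measurable E -> measurable G ->
  {ae mu, forall x, \forall k \near \oo, F k x <-> E x} ->
  (sigma_bar mu E G <= limn_einf (fun k => sigma_bar mu (F k) G))%E.
Proof.
move=> mF mE mG FE; pose d : T -> \bar R := dist_to (tboundary G).
have d0 x : (0 <= d x)%E by exact: dist_to_ge0.
have md (D : set T) : measurable D -> measurable_fun setT (d \_ D).
  by move=> mD; apply/(measurable_restrictT _ mD); apply: measurable_funTS; exact: dist_to_measurable.
have r0 (D : set T) x : (0 <= (d \_ D) x)%E by rewrite patchE; case: ifP.
have mY k : measurable (F k `+` G) by exact: setY_measurable.
rewrite /sigma_bar integral_mkcond.
rewrite (@ge0_ae_eq_integral _ _ _ mu setT _ (fun x => limn_einf (fun k => (d \_ (F k `+` G)) x)))//.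
- apply: le_trans (@fatou _ _ _ mu setT _ (fun k => d \_ (F k `+` G)) _ _) _ => //.
    by move=> k; exact: md.
  by apply: le_limn_einf => k; rewrite -integral_mkcond.
- by apply: md; exact: setY_measurable.
- by apply: measurable_fun_limn_einf => k; exact: md.
- by move=> x _; exact: r0.
- by move=> x _; apply: limn_einf_ge0 => k.
- apply: filterS FE => x h _.
  suff /cvg_limn_einf_sup[-> _] : (d \_ (F k `+` G)) x @[k --> \oo] --> (d \_ (E `+` G)) x by [].
  apply: cvg_near_cst; apply: filterS h => k [h1 h2]; rewrite !patchE.
  have -> : (x \in F k `+` G) = (x \in E `+` G); last by [].
  apply/idP/idP => /set_mem h; apply/mem_set; case: h => -[a b].
  - by left; split => //; exact: h1.
  - by right; split => // /h2.
  - by left; split => //; exact: h2.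
  - by right; split => // /h1.
Qed.

Lemma Fenergy_lsc N (F : nat -> 'I_N.+1 -> set T) (E A : 'I_N.+1 -> set T) (lambda : R) :
  0 <= lambda ->
  (forall k i, measurable (F k i)) -> (forall i, measurable (E i)) -> (forall i, measurable (A i)) ->
  {ae mu, forall x, \forall k \near \oo, forall i, F k i x <-> E i x} ->
  (Fenergy mu E A lambda <= limn_einf (fun k => Fenergy mu (F k) A lambda))%E.
Proof.
move=> l0 mF mE mA FE.
have FEi i : {ae mu, forall x, \forall k \near \oo, F k i x <-> E i x}.
  by apply: filterS FE => x; apply: filterS => k.
have l20 : 0 <= lambda / 2 by rewrite divr_ge0.
have h20 : (0 : R) <= 2^-1 by rewrite invr_ge0.
have P0 k : (0 <= \sum_(j < N.+1) perimeter mu (F k j))%E by apply: sume_ge0 => i _; exact: perimeter_ge0.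
have S0 k : (0 <= \sum_(j < N.+1) sigma_bar mu (F k j) (A j))%E by apply: sume_ge0 => i _; exact: sigma_bar_ge0.
apply: le_trans (limn_einfD _ _) => [|k|k]; last 2 first.
  by apply: mule_ge0.
  by apply: mule_ge0.
apply: leeD; apply: le_trans (limn_einfZ _ _) => //; apply: lee_wpmul2l; rewrite ?lee_fin//.
- apply: le_trans (limn_einf_sum _ _) => [|i k]; last exact: perimeter_ge0.
  by apply: lee_sum => i _; exact: perimeter_lsc.
- apply: le_trans (limn_einf_sum _ _) => [|i k]; last exact: sigma_bar_ge0.
  by apply: lee_sum => i _; exact: sigma_bar_lsc.
Qed.

End Lsc.

(** * Compactness *)

Section Compactness.
Context {R : realType} {n : nat}.
Local Notation V := 'rV[R]_n.
Local Notation T := (g_sigma_algebraType (@open V)).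
Context (mu : {measure set T -> \bar R}) (Hmu : is_lebesgue mu).

(** An ultrafilter containing the tails of the sequence stands in for repeated extraction of
    subsequences: every finite colouring is constant on one of its members, for all scales and
    chambers simultaneously. *)
Lemma ultra_pigeonhole (X : Type) (J : finType) (U : set_system X) (f : X -> J) :
  UltraFilter U -> exists j, U (f @^-1` [set j]).
Proof.
move=> UF; apply: contrapT => h.
have : U (fun x => forall j, ~ (f @^-1` [set j]) x).
  apply: filter_forall => j; have [|//] := @in_ultra_setVsetC _ _ (f @^-1` [set j]) UF.
  by move=> Uj; exfalso; apply: h; exists j.
by move=> /filter_ex[x /(_ (f x) erefl)].
Qed.

Lemma ultra_close (X : Type) (U : set_system X) (F : X -> set T) (L p eps : R) :
  UltraFilter U -> 0 < L -> 0 < eps -> (forall x, measurable (F x)) ->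
  (forall x, F x `<=` cube L) -> (forall x, perimeter mu (F x) <= p%:E)%E ->
  exists2 K, U K & forall x y, K x -> K y -> (mu (F x `+` F y) <= eps%:E)%E.
Proof.
move=> UF L0 e0 mF FL FP; have e20 : 0 < eps / 2 by rewrite divr_gt0.
have [J [D [mD net]]] := finite_net Hmu p L0 e20.
have /choice [f fP] x : exists j, (mu (F x `+` D j) <= (eps / 2)%:E)%E by exact: net.
have [j Uj] := ultra_pigeonhole f UF; exists (f @^-1` [set j]) => // x y /= xj yj.
apply: (@le_trans _ _ (mu ((F x `+` D j) `|` (F y `+` D j)))).
  apply: le_measure; rewrite ?inE; [exact: setY_measurable| |].
    by apply: measurableU; exact: setY_measurable.
  by move=> z [[Fx nFy]|[Fy nFx]]; have [Dz|nDz] := pselect (D j z);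
    [right; right|left; left|left; right|right; left].
apply: le_trans (measureU2 _ _ _) _; try exact: setY_measurable.
apply: (@le_trans _ _ ((eps / 2)%:E + (eps / 2)%:E)%E); last by rewrite -EFinD lee_fin -splitr.
by apply: leeD; [rewrite -xj|rewrite -yj]; exact: fP.
Qed.

Lemma fast_cauchy (I : finType) (F : nat -> I -> set T) (L p : R) : 0 < L ->
  (forall k i, measurable (F k i)) -> (forall k i, F k i `<=` cube L) ->
  (forall k i, perimeter mu (F k i) <= p%:E)%E ->
  exists s : nat -> nat, (forall j, (j <= s j)%N) /\
    forall j i, (mu (F (s j) i `+` F (s j.+1) i) <= (2^-1 ^+ j)%:E)%E.
Proof.
move=> L0 mF FL FP; have PF : ProperFilter (\oo : set_system nat) by exact: _.
have [U [UF ooU]] := ultraFilterLemma PF.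
have /choice [K KP] : forall j, exists K, U K /\ forall k l, K k -> K l ->
    forall i, (mu (F k i `+` F l i) <= (2^-1 ^+ j)%:E)%E.
  move=> j; have e0 : (0 : R) < 2^-1 ^+ j by rewrite exprn_gt0.
  have /choice [K KP] i : exists K, U K /\ forall k l, K k -> K l ->
      (mu (F k i `+` F l i) <= (2^-1 ^+ j)%:E)%E.
    have [K UK KP] := @ultra_close _ U (F ^~ i) L p _ UF L0 e0 (mF ^~ i) (FL ^~ i) (FP ^~ i).
    by exists K.
  exists (fun k => forall i, K i k); split; first by apply: filter_forall => i; have [] := KP i.
  by move=> k l Kk Kl i; apply: (KP i).2.
(* The index s j lies in K 0, ..., K j, so s j and s (j+1) are both in K j. Only [j <= s j] is
   recorded, which is all the limit argument needs. *)
have /choice [s sP] : forall j, exists k, (j <= k)%N /\ forall i : 'I_j.+1, K i k.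
  move=> j; have : U (fun k => (j <= k)%N /\ forall i : 'I_j.+1, K i k).
    apply: filterI; first by apply: ooU; exists j.
    by apply: filter_forall => i; have [] := KP i.
  by move=> /filter_ex[k]; exists k.
exists s; split=> [j|j i]; first by have [] := sP j.
apply: (KP j).2; first exact: ((sP j).2 ord_max).
exact: ((sP j.+1).2 (widen_ord (leqnSn _) ord_max)).
Qed.

(** Borel-Cantelli: the measures of successive symmetric differences have sum at most 2, so almost
    every point lies in finitely many of them and its membership is eventually constant. *)
Lemma fast_cauchy_ae (F : nat -> set T) : (forall k, measurable (F k)) ->
  (forall j, mu (F j `+` F j.+1) <= (2^-1 ^+ j)%:E)%E ->
  {ae mu, forall x, \forall k \near \oo, F k x <-> (\forall k \near \oo, F k x)}.
Proof.
move=> mF Fs; have mY j : measurable (F j `+` F j.+1) by exact: setY_measurable.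
have L0 : mu (lim_sup_set (fun j => F j `+` F j.+1)) = 0%E.
  apply: lim_sup_set_cvg0 => //.
  apply: (@le_lt_trans _ _ (2 : R)%:E); last by rewrite ltry.
  apply: lime_le; first exact: is_cvg_ereal_nneg_natsum_cond.
  apply: nearW => k; apply: (@le_trans _ _ (\sum_(0 <= j < k) (2^-1 ^+ j)%:E)%E).
    by apply: lee_sum => j _; exact: Fs.
  have -> : (\sum_(0 <= j < k) (2^-1 ^+ j)%:E = (2 - 2 * 2^-1 ^+ k)%:E :> \bar R)%E.
    elim: k => [|k IH]; first by rewrite big_nil expr0 mulr1 subrr.
    by rewrite big_nat_recr//= IH -EFinD exprS; congr EFin; field.
  by rewrite lee_fin gerBl mulr_ge0// exprn_ge0.
have mL : measurable (lim_sup_set (fun j => F j `+` F j.+1)).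
  by apply: bigcap_measurableType => // k _; exact: bigcup_measurable.
apply: filterS (ae_null mL L0) => x nx.
have [k0 k0P] : exists k0, forall j, (k0 <= j)%N -> F j x <-> F j.+1 x.
  apply: contrapT => h; apply: nx => k _; apply: contrapT => h2; apply: h; exists k => j kj.
  split=> [Fx|Fx]; apply: contrapT => nF; apply: h2; exists j => //; [by left|by right].
have kP j : F (k0 + j)%N x <-> F k0 x.
  by elim: j => [|j IH]; rewrite ?addn0// addnS -k0P ?leq_addr.
have [Fk|nFk] := pselect (F k0 x).
  have FF : \forall k \near \oo, F k x.
    by exists k0 => // k /= k0k; rewrite -(subnKC k0k); apply/kP.
  by apply: filterS (FF) => k Fkx; split.
exists k0 => // k /= k0k; rewrite -(subnKC k0k); split=> [/kP//|].
move=> [l _ /(_ (k0 + l)%N (leq_addl _ _)) /kP] //.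
Qed.

Lemma near_set_measurable (F : nat -> set T) : (forall k, measurable (F k)) ->
  measurable [set x | \forall k \near \oo, F k x].
Proof.
move=> mF; rewrite (_ : [set x | _] = \bigcup_k0 \bigcap_(k in [set k | (k0 <= k)%N]) F k).
  by apply: bigcupT_measurable => k0; apply: bigcap_measurableType.
by apply/seteqP; split => x [k0 _ h]; exists k0.
Qed.

Lemma compact_families N (F : nat -> 'I_N.+1 -> set T) (L p : R) : 0 < L ->
  (forall k i, measurable (F k i)) -> (forall k, {ae mu, forall x, exactly_one (F k) x}) ->
  (forall k i, i != ord_max -> F k i `<=` cube L) ->
  (forall k i, perimeter mu (F k i) <= p%:E)%E ->
  exists (s : nat -> nat) (E : 'I_N.+1 -> set T), [/\ forall j, (j <= s j)%N,
    forall i, measurable (E i), {ae mu, forall x, exactly_one E x},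
    forall i, i != ord_max -> E i `<=` cube L &
    {ae mu, forall x, \forall j \near \oo, forall i, F (s j) i x <-> E i x}].
Proof.
move=> L0 mF oneF FL FP.
(* Total boundedness needs sets inside a cube, so the last chamber is left out; in the limit it is
   defined as the complement of the others and its convergence follows from exact covering. *)
pose G k (i : 'I_N) := F k (lift ord_max i).
have liftE (P : 'I_N.+1 -> Prop) : (forall i : 'I_N, P (lift ord_max i)) -> forall i, i != ord_max -> P i.
  by move=> h i im; have [|j -> _] := @unlift_some _ ord_max i; [rewrite eq_sym|exact: h].
have lift_max (i : 'I_N) : lift ord_max i != ord_max by rewrite eq_sym neq_lift.
have [s [sj sP]] := @fast_cauchy 'I_N G L p L0 (fun k i => mF k _)
   (fun k i => FL k _ (lift_max i)) (fun k i => FP k _).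
pose E0 (i : 'I_N.+1) : set T := [set x | \forall j \near \oo, F (s j) i x].
have mE0 i : measurable (E0 i) by exact: near_set_measurable.
pose E (i : 'I_N.+1) : set T := if i == ord_max then ~` bounded_part E0 else E0 i.
have Emax : E ord_max = ~` bounded_part E0 by rewrite /E eqxx.
have EE i : i != ord_max -> E i = E0 i by rewrite /E => /negPf ->.
have aeF : {ae mu, forall x, \forall j \near \oo, forall i, i != ord_max -> F (s j) i x <-> E i x}.
  have : {ae mu, forall x, forall i : 'I_N, \forall j \near \oo, G (s j) i x <-> E (lift ord_max i) x}.
    apply: filter_forall => i; rewrite EE//; apply: (fast_cauchy_ae (F := fun j => G (s j) i)) => //.
    by move=> j; exact: mF.
  apply: filterS => x h; have : \forall j \near \oo, forall i : 'I_N, G (s j) i x <-> E (lift ord_max i) x.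
    by apply: filter_forall => i; exact: h.
  by apply: filterS => j hj; apply: liftE.
have aeF' : {ae mu, forall x, \forall j \near \oo, forall i, F (s j) i x <-> E i x}.
  have one : {ae mu, forall x, forall k, exactly_one (F k) x} by exact: ae_foralln.
  apply: filterS2 one aeF => x onex; apply: filterS => j hj i.
  have [->|] := eqVneq i ord_max; last exact: hj.
  rewrite Emax; split=> [Fm [l /= lm El]|nE].
    have Fl : F (s j) l x by apply/hj => //; rewrite EE.
    by rewrite (exactly_one_inj (onex (s j)) Fl Fm) eqxx in lm.
  have [l [Fl _]] := onex (s j); have [<-//|lm] := eqVneq l ord_max.
  by exfalso; apply: nE; exists l => //; rewrite -EE//; apply/hj.
exists s, E; split => //.
- move=> i; rewrite /E; case: ifP => // _; apply: measurableC; exact: bounded_part_measurable.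
- have one : {ae mu, forall x, forall k, exactly_one (F k) x} by exact: ae_foralln.
  apply: filterS2 one aeF' => x onex [j _ /(_ j (leqnn j)) hj].
  have [i [Fi uF]] := onex (s j); exists i; split; first exact/hj.
  by move=> l /hj; exact: uF.
- by move=> i im x; rewrite EE// => -[j _ /(_ j (leqnn j))]; exact: FL.
Qed.

End Compactness.

(** * Existence and the convex hull property *)

Section Main.
Context {R : realType} {n : nat}.
Local Notation V := 'rV[R]_n.
Local Notation T := (g_sigma_algebraType (@open V)).
Implicit Types x y p nu : V.

Lemma sqnormDZ x y (t : R) : sqnorm (x + t *: y) = sqnorm x + 2 * t * dot y x + t ^+ 2 * sqnorm y.
Proof.
rewrite -!dotxx dotDl dotZl [dot x (_ + _)]dotC [dot y (_ + _)]dotC !dotDl !dotZl (dotC x y).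
by ring.
Qed.

Lemma nearest_point (C : set V) x : closed C -> C !=set0 ->
  exists2 p, C p & forall y, C y -> sqnorm (x - p) <= sqnorm (x - y).
Proof.
move=> cC [c0 Cc0]; pose f y := sqnorm (y + (- x)).
have cf : continuous f by exact: (C1_continuous (C1_translate (- x) C1_sqnorm.1).1).
have fE y : f y = sqnorm (x - y) by rewrite /f -!sqr_enorm -enormN opprD opprK addrC.
(* Outside K, |y| > |c0| + 2 |c0 - x|, hence |y - x| > |c0 - x|: such points do worse than [c0], and
   the minimum may be sought on the compact part. *)
have [K [cK KP]] := @enorm_supp_compact R n (enorm c0 + 2 * enorm (c0 - x)).
have cCK : compact (C `&` K) by rewrite setIC; apply: compact_closedI.
have c0K : K c0.
  by apply: contrapT => /KP; rewrite ltNge lerDl mulr_ge0// enorm_ge0.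
have [|||p /set_mem[Cp Kp] pmin0] := @EVT_min_rV R n f (C `&` K).
- by exists c0.
- exact: cCK.
- exact: continuous_subspaceT.
have pmin y : C y -> K y -> f p <= f y by move=> Cy Ky; apply: pmin0; exact/mem_set.
exists p => // y Cy; rewrite -!fE; have [Ky|/KP Ky] := pselect (K y); first exact: pmin.
apply: le_trans (pmin c0 Cc0 c0K) _.
rewrite /f -!sqr_enorm lerXn2r ?nnegrE ?enorm_ge0//.
have := enormD (y - x) (x - c0); rewrite subrKA => h1.
have := enormD (y - c0) c0; rewrite subrK => h2.
move: Ky h1 h2; rewrite -(enormN (x - c0)) opprB; lra.
Qed.

Lemma separating_halfspace (C : set V) x : closed C -> C !=set0 -> Defs.convex_set C -> ~ C x ->
  exists nu (t : R), [/\ enorm nu = 1, C `<=` halfspace nu t & t < dot x nu].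
Proof.
move=> cC C0 convC nCx; have [p Cp pmin] := nearest_point x cC C0.
pose v := x - p; have v0 : 0 < enorm v.
  rewrite lt0r enorm_ge0 andbT; apply/eqP => /enorm_eq0/eqP; rewrite subr_eq0 => /eqP xp.
  by apply: nCx; rewrite xp.
have obtuse y : C y -> dot (y - p) v <= 0.
  move=> Cy; rewrite leNgt; apply/negP => d0.
  set d := dot _ _ in d0; pose q := sqnorm (y - p); have q0 : 0 <= q by exact: sqnorm_ge0.
  (* Moving from p towards y by t changes the squared distance to x by t (t q - 2 d). This t lies in
     (0, 1] and gives t q <= d < 2 d, so the distance would decrease; it is well defined without
     knowing q > 0. *)
  pose t := d / (d + q); have dq0 : 0 < d + q by rewrite ltr_wpDr.
  have t0 : 0 < t by rewrite divr_gt0.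
  have t1 : t <= 1 by rewrite ler_pdivrMr// mul1r lerDl.
  have tE : t * (d + q) = d by rewrite divfK// gt_eqF.
  have /pmin : C (t *: y + (1 - t) *: p) by apply: convC => //; rewrite ltW.
  have -> : x - (t *: y + (1 - t) *: p) = v + (- t) *: (y - p).
    rewrite scalerBl scale1r scaleNr scalerBr /v !opprD !opprK !addrA.
    by congr (_ + _); rewrite addrAC.
  rewrite sqnormDZ -/d -/q -/v => h.
  have : 0 <= t * (t * q - 2 * d) by nra.
  rewrite pmulr_rge0//; nra.
exists ((enorm v)^-1 *: v), (dot p ((enorm v)^-1 *: v)); split.
- by rewrite enormZ ger0_norm ?invr_ge0 ?enorm_ge0// mulVf// gt_eqF.
- move=> y /obtuse h; rewrite /halfspace /= -subr_le0 -dotNl -dotDl dotC dotZl dotC.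
  by rewrite pmulr_rle0 ?invr_gt0.
- rewrite -subr_gt0 -dotNl -dotDl dotC dotZl dotxx -sqr_enorm.
  by rewrite mulr_gt0 ?invr_gt0 ?exprn_gt0.
Qed.

Lemma le_dist_to_halfspace (S : set V) nu (t : R) y : enorm nu = 1 -> S `<=` halfspace nu t ->
  ((dot y nu - t)%:E <= dist_to S y)%E.
Proof.
move=> nu1 SH; apply: le_ereal_inf_tmp => _ [s /SH st <-]; rewrite lee_fin.
rewrite /halfspace /= in st.
apply: (@le_trans _ _ (dot (y - s) nu)); first by rewrite dotDl dotNl lerD2l lerN2.
by apply: le_trans (cauchy_schwarz _ _) _; rewrite nu1 mulr1.
Qed.

Context (mu : {measure set T -> \bar R}) (Hmu : is_lebesgue mu) {N : nat}.
Implicit Types A B : 'I_N.+1 -> set V.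

Lemma existence A (lambda : R) : (0 < N)%N -> 0 <= lambda -> partition_b mu A ->
  exists B, partition_b mu B /\
    forall B', partition_b mu B' -> (Fenergy mu B A lambda <= Fenergy mu B' A lambda)%E.
Proof.
move=> N0 l0 pA; have mA i : @measurable _ T (A i) by have [[lA _] _] := pA; have [] := lA i.
pose S := [set Fenergy mu B A lambda | B in [set B : 'I_N.+1 -> set V | partition_b mu B]].
have S0 : (0 <= ereal_inf S)%E by apply: le_ereal_inf_tmp => _ [B _ <-]; exact: Fenergy_ge0.
(* The datum A is itself a competitor: its distance term vanishes and its perimeters are finite. *)
have Sfin : ereal_inf S \is a fin_num.
  rewrite ge0_fin_numE//; apply: le_lt_trans (Fenergy_self_lty Hmu lambda pA).
  by apply: ereal_inf_lbound; exists A.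
pose I := fine (ereal_inf S); have SE : ereal_inf S = I%:E by rewrite fineK.
have [L L0 LP] := confine Hmu N0 l0 pA.
have /choice [F FP] : forall k : nat, exists E : 'I_N.+1 -> set T,
    [/\ forall i, measurable (E i), {ae mu, forall x, exactly_one E x},
      forall i, i != ord_max -> E i `<=` cube L &
      (Fenergy mu E A lambda <= (I + k.+1%:R^-1)%:E)%E].
  move=> k; have k0 : (0 : R) < k.+1%:R^-1 by rewrite invr_gt0.
  have [_ [B pB <-] Bk] := lb_ereal_inf_adherent k0 Sfin.
  have [E [mE oneE EL FE]] := LP B pB; exists E; split => //.
  by apply: le_trans FE _; rewrite EFinD -SE ltW.
have mF k i : @measurable _ T (F k i) by have [h _ _ _] := FP k; exact: h.
(* The factor 2 undoes the weight 1/2 of the perimeters in the energy, and 1/(k+1) is at most 1. *)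
have FPer k i : (perimeter mu (F k i) <= (2 * (I + 1))%:E)%E.
  apply: le_trans (perimeter_Fenergy mu (F k) A i l0) _; rewrite EFinM; apply: lee_wpmul2l => //.
  have [_ _ _ h] := FP k; apply: le_trans h _; rewrite lee_fin lerD2l invf_le1// ler1n //.
have [s [E [sj mE oneE EL FE]]] := compact_families Hmu L0 mF
  (fun k => let: And4 _ h _ _ := FP k in h) (fun k => let: And4 _ _ h _ := FP k in h) FPer.
have EI : (Fenergy mu E A lambda <= I%:E)%E.
  apply: le_trans (Fenergy_lsc Hmu l0 (fun k i => mF (s k) i) mE mA FE) _.
  have c : ((I + k.+1%:R^-1)%:E @[k --> \oo] --> I%:E)%E.
    apply: cvg_EFin; first exact: nearW.
    rewrite -[X in _ --> X]addr0; apply: cvgD; first exact: cvg_cst.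
    exact: cvg_harmonic.
  have [<- _] := cvg_limn_einf_sup c; apply: le_limn_einf => k.
  have [_ _ _ h] := FP (s k); apply: le_trans h _; rewrite lee_fin lerD2l.
  by rewrite lef_pV2 ?posrE// ler_nat ltnS.
have PE i : (perimeter mu (E i) < +oo)%E.
  apply: le_lt_trans (perimeter_Fenergy mu E A i l0) _.
  by apply: le_lt_trans (lee_wpmul2l _ EI) _ => //; rewrite -EFinM ltry.
have bE i : i != ord_max -> Defs.bounded_set (E i).
  move=> im; exists (n%:R * L) => x /(EL i im) /(norm_cube L0) h.
  by apply: le_trans (enorm_le_norm x) _; rewrite ler_wpM2l.
have [pB FB] := normalise Hmu lambda mE mA oneE PE bE.
eexists; split; first exact: pB.
move=> B' pB'; rewrite FB; apply: le_trans EI _; rewrite -SE.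
by apply: ereal_inf_lbound; exists B'.
Qed.

Lemma minimizer_hull A (lambda : R) B : 0 < lambda -> partition_b mu A -> partition_b mu B ->
  (forall B', partition_b mu B' -> (Fenergy mu B A lambda <= Fenergy mu B' A lambda)%E) ->
  forall i, i != ord_max -> B i `<=` hull A.
Proof.
move=> l0 pA pB Bmin i im x Bx C [cC [convC AC]]; apply: contrapT => nCx.
have l20 : 0 < lambda / 2 by rewrite divr_gt0.
have [[lA [sA _]] _] := pA; have [[lB [sB dB]] bB] := pB.
have mA j : @measurable _ T (A j) by have [] := lA j.
have mB j : @measurable _ T (B j) by have [] := lB j.
have oneA := partition_exactly_one Hmu mA sA; have oneB := partition_exactly_one Hmu mB sB.
have FBlty : (Fenergy mu B A lambda < +oo)%E.
  by apply: le_lt_trans (Bmin A pA) _; exact: Fenergy_self_lty.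
have dx : density_one mu (B i) x by rewrite -dB.
have md : measurable_fun setT (dist_to (tboundary (A i)) : T -> \bar R) by exact: dist_to_measurable.
(* An empty C forces the bounded chambers of A to be empty. The distance to the boundary of A i is
   then infinite everywhere, and B i, having a density point, has positive measure, so its energy
   would be infinite. *)
have [C0|/set0P C0] := eqVneq C set0.
  have Ai0 : A i = set0 by apply/seteqP; split => // y /(AC i im); rewrite C0.
  have posB : (0 < mu (B i))%E.
    apply: lt_le_trans (density_one_pos Hmu (mB i) dx (@ltr01 R)) _.
    apply: le_measure; rewrite ?inE; [|exact: mB|exact: subIsetl].
    by apply: measurableI => //; exact: ball_measurable.
  have := sigma_bar_Fenergy mu B A i (ltW l0).
  have -> : sigma_bar mu (B i) (A i) = +oo%E.
    rewrite /sigma_bar Ai0 setY0 /tboundary closure0 set0D.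
    rewrite (eq_integral (cst +oo%E)) => [|y _]; last by rewrite /dist_to image_set0 ereal_inf0.
    by rewrite (integral_cst mu (mB i)) gt0_mulye.
  by rewrite gt0_muley ?lte_fin// leye_eq => /eqP FBy; move: FBlty; rewrite FBy ltxx.
have [nu [t [nu1 CH xt]]] := separating_halfspace cC C0 convC nCx.
have AH j : j != ord_max -> A j `<=` halfspace nu t by move=> /AC/subset_trans; exact.
have cutF := Fenergy_cut Hmu (ltW l0) mB mA oneB oneA bB nu1 AH im.
set H := halfspace nu t in cutF; pose E := cut_family H B.
have mH : @measurable _ T H by exact: (closed_measurableV (halfspace_closed (nu := nu) (t := t))).
(* H is closed, so it contains the boundary of A i together with A i. *)
have dH y : ((dot y nu - t)%:E <= dist_to (tboundary (A i)) y)%E.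
  apply: le_dist_to_halfspace => // z [cz _].
  have cH : closed H by exact: halfspace_closed.
  by rewrite -/H ((closure_id H).1 cH); apply: closureS cz; exact: AH.
set J := (\int[mu]_(y in _) _)%E in cutF.
have J0 : (0 < J)%E.
  (* Half of the excess of x beyond H: near x the distance to the boundary is at least e, and B i
     has positive measure there because x is a density point. *)
  pose e := (dot x nu - t) / 2; have e0 : 0 < e by rewrite divr_gt0// subr_gt0.
  have oW : open [set y : V | t + e < dot y nu].
    rewrite -[X in open X]/((fun y : V => dot y nu) @^-1` [set z | t + e < z]).
    by apply: open_comp => [y _|]; [exact: (C1_continuous (C1_dot nu).1)|exact: open_gt].
  have [r /= r0 rW] : nbhs_ball x [set y : V | t + e < dot y nu].
    by rewrite nbhs_ballE; apply: open_nbhs_nbhs; split => //=; rewrite /e; lra.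
  have mBr : @measurable _ T (B i `&` ball x r) by apply: measurableI => //; exact: ball_measurable.
  apply: (@lt_le_trans _ _ (e%:E * mu (B i `&` ball x r))%E).
    by rewrite mule_gt0// ?lte_fin//; exact: density_one_pos.
  rewrite -integral_cst//.
  apply: (@le_trans _ _ (\int[mu]_(y in B i `&` ball x r) dist_to (tboundary (A i)) y)%E).
    apply: ge0_le_integral => //; try (by move=> y _; rewrite ?lee_fin ?ltW// dist_to_ge0).
      exact: measurable_funTS.
    by move=> y [_ /rW /= yW]; apply: le_trans (dH y); rewrite lee_fin; lra.
  apply: ge0_subset_integral => //; [exact: measurableD|exact: measurable_funTS| |].
    by move=> y _; exact: dist_to_ge0.
  by move=> y [By /rW /= yW]; split => //; rewrite /H /halfspace /=; lra.
have E0 : (0 <= Fenergy mu E A lambda)%E by apply: Fenergy_ge0; exact: ltW.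
(* Strictness needs the energy of the cut family to be finite, which follows from that of the
   minimizer. *)
have EB : (Fenergy mu E A lambda < Fenergy mu B A lambda)%E.
  apply: (lt_le_trans _ (cutF)); rewrite lteDl ?mule_gt0 ?lte_fin//.
  rewrite ge0_fin_numE//; apply: le_lt_trans FBlty; apply: le_trans cutF.
  by rewrite leeDl// mule_ge0// ?lee_fin ltW.
have bE j : j != ord_max -> Defs.bounded_set (E j).
  by move=> jm; have [M BM] := bB j jm; exists M => y /(cut_family_le jm); exact: BM.
have PE j : (perimeter mu (E j) < +oo)%E.
  by apply: le_lt_trans (partition_b_perimeter Hmu pB j); exact: perimeter_cut_family.
have oneE : {ae mu, forall x, exactly_one E x}.
  by apply: filterS oneB => y; exact: cut_family_exactly_one.
have [pE FE] := normalise Hmu lambda (cut_family_measurable mH mB) mA oneE PE bE.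
by have := Bmin _ pE; rewrite FE leNgt EB.
Qed.

End Main.

Unset Implicit Arguments.

Theorem theorem4p2 (R : realType) (n : nat)
    (mu : {measure set (g_sigma_algebraType (@open 'rV[R]_n)) -> \bar R}) (Hmu : is_lebesgue mu)
    (N : nat) (HN : (1 <= N)%N)
    (A : 'I_N.+1 -> set 'rV[R]_n) (HA : partition_b mu A)
    (lambda : R) (Hlambda : 1 <= lambda) :
  (exists B : 'I_N.+1 -> set 'rV[R]_n, partition_b mu B /\
     forall B', partition_b mu B' ->
       (Fenergy mu B A lambda <= Fenergy mu B' A lambda)%E) /\
  (forall B : 'I_N.+1 -> set 'rV[R]_n, partition_b mu B ->
     (forall B', partition_b mu B' ->
        (Fenergy mu B A lambda <= Fenergy mu B' A lambda)%E) ->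
     forall i : 'I_N.+1, i != ord_max -> B i `<=` hull A).
Proof.
have l0 : 0 < lambda by exact: lt_le_trans ltr01 Hlambda.
split; first by apply: existence => //; exact: ltW.
move=> B pB Bmin i im; exact: (minimizer_hull Hmu l0 HA pB Bmin im).
Qed.
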